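(* Let $\mathcal F$ be a family of ordered pairs $(f,g)$ of non-negative measurable functions on $\mathbb R^n$ with the following property: for some $p_0$, $0<p_0<\infty$, and every $w\in A_\infty$, $$\int_{\mathbb R^n} f(x)^{p_0}w(x)\,dx\le C\int_{\mathbb R^n} g(x)^{p_0}w(x)\,dx$$ for all $(f,g)\in\mathcal F$ such that the left-hand side is finite, where $C$ depends only on the $A_\infty$ constant of $w$. Let $\theta\ge 1$. Suppose that $u\in A_1$ and that $v$ is a weight such that $v^\delta\in A_\infty$ for some $\delta>0$. Then there is a constant $C$ such that $$\Big\|\frac{f}{v^\theta}\Big\|_{L^{1/\theta,\infty}(uv)}\le C\,\Big\|\frac{g}{v^\theta}\Big\|_{L^{1/\theta,\infty}(uv)}$$ for all $(f,g)\in\mathcal F$ such that the left-hand side is finite. Similarly, the following vector-valued extension holds: if $0<q<\infty$, there is a constant $C$ such that $$\Big\|\frac{\big(\sum_j (f_j)^q\big)^{1/q}}{v^\theta}\Big\|_{L^{1/\theta,\infty}(uv)}\le C\,\Big\|\frac{\big(\sum_j (g_j)^q\big)^{1/q}}{v^\theta}\Big\|_{L^{1/\theta,\infty}(uv)}$$ for any sequence $\{(f_j,g_j)\}_j\subset\mathcal F$ such that the left-hand side is finite.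
   Context: A weight is a non-negative measurable function on $\mathbb R^n$; $A_1$ and $A_\infty$ are the usual Muckenhoupt classes on $\mathbb R^n$. Note that $v$ itself is not assumed locally integrable (only $v^\delta\in A_\infty$). For $0<p<\infty$ and a non-negative measurable function $\mu$ on $\mathbb R^n$, $\|h\|_{L^{p,\infty}(\mu)}=\sup_{t>0}t\,\big(\mu(\{x:|h(x)|>t\})\big)^{1/p}$, where $\mu(E)=\int_E\mu(x)\,dx$; here $\mu=uv$ is the pointwise product. The constants $C$ in the conclusions do not depend on the pair $(f,g)$ or the sequence $\{(f_j,g_j)\}_j$. *)

(* Defs.v *)
From HB Require Import structures.
From mathcomp Require Import all_boot all_order all_algebra.
From mathcomp Require Import all_classical all_reals all_analysis.
From mathcomp Require Import measurable_realfun ess_sup_inf.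

Set Implicit Arguments.
Unset Strict Implicit.
Unset Printing Implicit Defensive.

Import Order.TTheory GRing.Theory Num.Theory.
Import numFieldNormedType.Exports.

Local Open Scope classical_set_scope.
Local Open Scope ring_scope.
Local Open Scope ereal_scope.

(* R^n with its Borel sigma-algebra, the product sigma-algebra on tuples. *)
Notation Rn R n := (n.-tuple (measurableTypeR R)).

(* The library has no n-dimensional Lebesgue measure: it is built here by
   iterating the binary product, R^(n+1) being R * R^n through [Rn_cons];
   [lebesgue_Rn_box] is the usual characterization. *)
Section lebesgue_Rn_cons.
Context (R : realType) (n : nat).

Definition Rn_cons (xy : measurableTypeR R * Rn R n) : Rn R n.+1 :=
  [tuple of xy.1 :: xy.2].

Lemma measurable_Rn_cons : measurable_fun [set: _] Rn_cons.
Proof.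
exact: (@measurable_cons _ _ _ _ fst n snd measurable_fst measurable_snd).
Qed.

Variable m : {sigma_finite_measure set (Rn R n) -> \bar R}.

Definition lebesgue_Rn_cons : set (Rn R n.+1) -> \bar R :=
  pushforward (lebesgue_measure \x m) Rn_cons.

Let lebesgue_Rn_cons0 : lebesgue_Rn_cons set0 = 0.
Proof. by rewrite /lebesgue_Rn_cons /pushforward preimage_set0 measure0. Qed.

Let lebesgue_Rn_cons_ge0 A : 0 <= lebesgue_Rn_cons A.
Proof. by apply: measure_ge0; exact: measurable_Rn_cons. Qed.

Let lebesgue_Rn_cons_semi_sigma_additive :
  semi_sigma_additive lebesgue_Rn_cons.
Proof.
move=> F mF tF mUF; rewrite /lebesgue_Rn_cons /pushforward preimage_bigcup.
apply: measure_semi_sigma_additive.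
- by move=> k; rewrite -[X in measurable X]setTI; exact: measurable_Rn_cons.
- apply/trivIsetP => /= i j _ _ ij; rewrite -preimage_setI.
  by move/trivIsetP : tF => /(_ _ _ _ _ ij) ->//; rewrite preimage_set0.
- rewrite -preimage_bigcup -[X in measurable X]setTI.
  exact: measurable_Rn_cons.
Qed.

HB.instance Definition _ := isMeasure.Build _ _ _ lebesgue_Rn_cons
  lebesgue_Rn_cons0 lebesgue_Rn_cons_ge0 lebesgue_Rn_cons_semi_sigma_additive.

Let lebesgue_Rn_cons_sigma_finite : sigma_finite setT lebesgue_Rn_cons.
Proof.
have /sigma_finiteP[F [TF ndF Foo]] := sigma_finiteT (@lebesgue_measure R).
have /sigma_finiteP[G [TG ndG Goo]] := sigma_finiteT m.
pose dec (z : Rn R n.+1) : measurableTypeR R * Rn R n :=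
  (tnth z ord0, [tuple of behead z]).
have mdec : measurable_fun [set: _] dec.
  apply/measurable_fun_pairP; split.
    exact: measurable_tnth.
  exact: measurable_behead.
have decK xy : dec (Rn_cons xy) = xy.
  case: xy => x y; rewrite /dec /Rn_cons /=; congr pair.
  exact: val_inj.
exists (fun k => dec @^-1` (F k `*` G k)).
  apply/esym/seteqP; split=> // z _.
  have [i _ Fi] : (\bigcup_k F k) (dec z).1 by rewrite -TF.
  have [j _ Gj] : (\bigcup_k G k) (dec z).2 by rewrite -TG.
  exists (maxn i j) => //; split.
  - by move: Fi; exact/subsetPset/ndF/leq_maxl.
  - by move: Gj; exact/subsetPset/ndG/leq_maxr.
move=> k; have [mF Fkoo] := Foo k; have [mG Gkoo] := Goo k; split.
  by rewrite -[X in measurable X]setTI; apply: mdec => //; exact: measurableX.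
rewrite /lebesgue_Rn_cons /pushforward.
rewrite -comp_preimage (_ : dec \o Rn_cons = id); last exact/funext.
by rewrite preimage_id product_measure1E// lte_mul_pinfty// ge0_fin_numE.
Qed.

HB.instance Definition _ := Measure_isSigmaFinite.Build _ _ _ lebesgue_Rn_cons
  lebesgue_Rn_cons_sigma_finite.

End lebesgue_Rn_cons.

Fixpoint lebesgue_Rn (R : realType) (n : nat) :
    {sigma_finite_measure set (Rn R n) -> \bar R} :=
  match n with
  | 0 => \d_([tuple] : Rn R 0)
  | n'.+1 => lebesgue_Rn_cons (lebesgue_Rn R n')
  end.

Lemma lebesgue_Rn_box (R : realType) (n : nat)
    (A : 'I_n -> set (measurableTypeR R)) :
  (forall i, measurable (A i)) ->
  lebesgue_Rn R n [set x | forall i, A i (tnth x i)] =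
  \prod_(i < n) lebesgue_measure (A i).
Proof.
elim: n A => [|n IH] A mA.
  rewrite big_ord0 /= diracE mem_set//= => -[]//.
rewrite big_ord_recl -IH//= /lebesgue_Rn_cons /pushforward.
rewrite -product_measure1E//; last first.
  rewrite [X in measurable X](_ : _ =
      \bigcap_(i in [set: 'I_n]) ((@tnth _ _)^~ i @^-1` A (lift ord0 i))).
    apply: fin_bigcap_measurable => // i _.
    by rewrite -[X in measurable X]setTI; exact: measurable_tnth.
  by apply/seteqP; split=> x /= Ax i; [move=> _|]; exact: Ax.
congr (_ _); apply/seteqP; split=> -[x y] /=.
  move=> Axy; split; first exact: (Axy ord0).
  by move=> i; have := Axy (lift ord0 i); rewrite tnthS.
move=> [Ax Ay] i; case: (unliftP ord0 i) => [j ->|->//].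
by rewrite tnthS; exact: Ay.
Qed.

Section muckenhoupt.
Context (R : realType) (n : nat).
Implicit Types (w : Rn R n -> R) (h : Rn R n -> \bar R) (Q : set (Rn R n)).

Local Notation leb := (lebesgue_Rn R n).

(* Lebesgue measurability: equality with a Borel function off a null set.
   [integral] is, on non-negative functions, a supremum of integrals of Borel
   simple functions, hence it gives the Lebesgue integral of such functions. *)
Definition lebesgue_measurable_fun h : Prop :=
  exists2 k : Rn R n -> \bar R,
    measurable_fun setT k & \forall x \ae leb, h x = k x.

Definition weight w : Prop :=
  (forall x, (0 <= w x)%R) /\ lebesgue_measurable_fun (EFin \o w).

Definition cube (a : Rn R n) (l : R) : set (Rn R n) :=
  [set x | forall i, (tnth a i <= tnth x i <= tnth a i + l)%R].

Definition is_cube Q : Prop := exists a l, (0 < l)%R /\ Q = cube a l.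

Definition avg h Q : \bar R := (\int[leb]_(x in Q) h x) / leb Q.

(* Hardy-Littlewood maximal function of a non-negative function *)
Definition maximal h (x : Rn R n) : \bar R :=
  ereal_sup [set avg h Q | Q in [set Q | is_cube Q /\ Q x]].

(* The weights of the Muckenhoupt classes are locally integrable and positive
   almost everywhere. *)
Definition regular_weight w : Prop :=
  [/\ weight w,
      forall Q, is_cube Q -> \int[leb]_(x in Q) (w x)%:E < +oo &
      \forall x \ae leb, (0 < w x)%R].

Definition A1 w : Prop :=
  regular_weight w /\
  exists C : R, \forall x \ae leb, maximal (EFin \o w) x <= (C * w x)%:E.

Definition Ap (p : R) w : Prop :=
  regular_weight w /\
  exists C : R, forall Q, is_cube Q ->
    avg (EFin \o w) Q *
    (avg (fun x => (w x `^ (- (p - 1)^-1))%:E) Q) `^ (p - 1) <= C%:E.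

Definition Ainfty w : Prop := A1 w \/ exists2 p : R, (1 < p)%R & Ap p w.

(* Fujii-Wilson constant *)
Definition Ainfty_const w : \bar R :=
  ereal_sup [set (\int[leb]_(x in Q) maximal (fun y => (w y * \1_Q y)%:E) x) /
                 (\int[leb]_(x in Q) (w x)%:E) | Q in is_cube].

Definition weighted_measure w : set (Rn R n) -> \bar R :=
  fun E => \int[leb]_(x in E) (w x)%:E.

End muckenhoupt.

Definition weakLnorm (R : realType) (T : Type) (mu : set T -> \bar R) (p : R)
    (h : T -> \bar R) : \bar R :=
  ereal_sup [set t%:E * mu [set x | t%:E < `|h x|] `^ p^-1 |
             t in [set t : R | (0 < t)%R]].

(* "C depends only on the A_infty constant of w" is a function phi of that
   constant, the same for all w and all pairs of the family. *)
Definition Ainfty_comparable (R : realType) (n : nat)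
    (F : set ((Rn R n -> \bar R) * (Rn R n -> \bar R))) (p0 : R) : Prop :=
  exists2 phi : \bar R -> R, (forall c, (0 < phi c)%R) &
    forall w : Rn R n -> R, Ainfty w ->
    forall f g : Rn R n -> \bar R, F (f, g) ->
      \int[lebesgue_Rn R n]_x (f x `^ p0 * (w x)%:E) < +oo ->
      \int[lebesgue_Rn R n]_x (f x `^ p0 * (w x)%:E) <=
      (phi (Ainfty_const w))%:E *
      \int[lebesgue_Rn R n]_x (g x `^ p0 * (w x)%:E).

Definition lq_sum (R : realType) (T : Type) (q : R)
    (h : nat -> T -> \bar R) : T -> \bar R :=
  fun x => (\sum_(0 <= j <oo) h j x `^ q) `^ q^-1.

(* Main.v *)
(* The hypothesis is only used for the weights W = A^t B^-b with A, B in A_1,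
   0 < t < 1 and b > 0, for which it yields a uniform bound: the Fujii-Wilson
   constants of such weights are bounded and, the dependence on the constant
   being arbitrary, W is first replaced by a comparable weight whose constant has
   a prescribed value. Majorizing a function h by the A_1 weight
   X = sum_k 2^-k M^k h / K^k (Rubio de Francia), one passes from the exponent p0
   to all exponents, staying within weights of the form A^t B^-b; taking the
   exponent q and summing gives the l^q-sums, and again all exponents for them.
   For the weak type estimate let mu = uv dx, E = {f / v^theta > t} and
   p = 1 / (2 theta). Then t^p mu(E) <= int_E f^p u v^(1/2) <= int f^p W, where
   W = X^alpha with alpha < 1 and X majorizes 1_E (u v^(1/2))^(1/alpha). The
   algorithm is run simultaneously in L^(p_i alpha)(u^(1-p_i) v^(1-p_i/2)) for two
   exponents p_1 < 2 < p_2, so that W / (u v^(1/2)) has norm at most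
   C mu(E)^(1/p_i) in L^(p_i)(mu); these weights are Muckenhoupt weights because
   u^(1+e) is in A_1 for some e > 0. Pairing with (f / v^theta)^p and
   (g / v^theta)^p, which are in weak L^2(mu), shows that int f^p W is finite and
   that int g^p W <= C ||g / v^theta||^p mu(E)^(1/2). *)
Require Import Defs.
From mathcomp Require Import all_boot all_order all_algebra.
From mathcomp Require Import all_classical all_reals all_analysis.
From mathcomp Require Import measurable_realfun ess_sup_inf.
From mathcomp Require Import ring lra.

Set Implicit Arguments.
Unset Strict Implicit.
Unset Printing Implicit Defensive.

Import Order.TTheory GRing.Theory Num.Theory.
Import numFieldNormedType.Exports.
Import HBNNSimple.

Local Open Scope classical_set_scope.
Local Open Scope ring_scope.
Local Open Scope ereal_scope.

(** The obstacle is that [u v] need not be a Muckenhoupt weight, nor even locally integrable, so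
    that strong type extrapolation cannot be applied to the measure [u v dx]. The exponent
    [1 / (2 theta)] is chosen because it puts [(f / v^theta)^p] in weak L^2(mu), and 2 is the
    exponent at which the weight [u^(1-p) v^(1-p/2)] is free of [v]. The predual of weak L^2 is the
    Lorentz space L^(2,1); a norm bound in L^(p_1) and another one in L^(p_2), on both sides of 2,
    replace it and avoid maximal inequalities in Lorentz spaces. The majorant can only be used to a
    power [alpha < 1], since the bound for the Fujii-Wilson constants of [A^t B^-b] needs [t < 1].
    Hence [u^-1] has to be an A_(2 alpha) weight with [2 alpha < 2], and this takes more than the
    A_1 condition for [u] gives directly: [u] is a power less than 1 of another A_1 weight, by the
    reverse Hoelder inequality. *)

Section integral_basics.
Context d (T : measurableType d) (R : realType).
Variable mu : {measure set T -> \bar R}.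
Implicit Types f g : T -> \bar R.

(** No measurability is assumed: a simple function below [f] is multiplied by the indicator of the
    complement of the exceptional null set, which puts it below [g] and leaves its integral
    unchanged. *)
Lemma ae_le_integral f g : (forall x, 0 <= f x) -> (forall x, 0 <= g x) ->
  (\forall x \ae mu, f x <= g x) -> \int[mu]_x f x <= \int[mu]_x g x.
Proof.
move=> f0 g0 [N [mN N0 fgN]].
rewrite [leLHS]ge0_integralTE// [leRHS]ge0_integralTE//.
apply: ge_ereal_sup => _ [h hf <-].
pose h' := mul_nnsfun h (indic_nnsfun R (measurableC mN)).
apply: ereal_sup_ubound; exists h' => /=.
  move=> x; rewrite mindicE; case: (boolP (x \in ~` N)) => xN.
    rewrite mulr1 (le_trans (hf x))//; apply: contrapT => fg.
    by move/set_mem : xN; apply; apply: fgN.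
  by rewrite mulr0.
rewrite -!integralT_nnsfun; apply: ge0_ae_eq_integral => //.
- exact/measurable_EFinP.
- exact/measurable_EFinP.
- by move=> x _; rewrite lee_fin.
- by move=> x _; rewrite lee_fin.
exists N; split => // x /= hx; apply: contrapT => xN; apply: hx => _.
by rewrite mindicE mem_set//= mulr1.
Qed.

Lemma ae_eq_integralT f g : (forall x, 0 <= f x) -> (forall x, 0 <= g x) ->
  (\forall x \ae mu, f x = g x) -> \int[mu]_x f x = \int[mu]_x g x.
Proof.
move=> f0 g0 fg; apply/eqP; rewrite eq_le; apply/andP; split;
by apply: ae_le_integral => //; apply: filterS fg => x ->.
Qed.

Lemma le_integralT f g : (forall x, 0 <= f x) -> (forall x, f x <= g x) ->
  \int[mu]_x f x <= \int[mu]_x g x.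
Proof.
move=> f0 fg; apply: ae_le_integral => //; last exact: aeW.
by move=> x; exact: le_trans (fg x).
Qed.

Lemma ae_le_integral_in (D : set T) f g : (forall x, 0 <= f x) ->
    (forall x, 0 <= g x) ->
  (\forall x \ae mu, D x -> f x <= g x) ->
  \int[mu]_(x in D) f x <= \int[mu]_(x in D) g x.
Proof.
move=> f0 g0 fg; rewrite integral_mkcond [leRHS]integral_mkcond.
apply: ae_le_integral; [exact: erestrict_ge0|exact: erestrict_ge0|].
apply: filterS fg => x fg; rewrite !patchE; case: ifPn => // /set_mem; exact: fg.
Qed.

Lemma le_integral_subset (A B : set T) f : (forall x, 0 <= f x) ->
  A `<=` B -> \int[mu]_(x in A) f x <= \int[mu]_(x in B) f x.
Proof.
move=> f0 AB; rewrite integral_mkcond [leRHS]integral_mkcond.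
apply: le_integralT; first exact: erestrict_ge0.
move=> x; rewrite !patchE; case: ifPn => xA; last by case: ifPn.
by rewrite mem_set//; apply: AB; exact: set_mem.
Qed.

Lemma integral_eq0_ae f : measurable_fun setT f -> (forall x, 0 <= f x) ->
  \int[mu]_x f x = 0 -> \forall x \ae mu, f x = 0.
Proof.
move=> mf f0 h; have : ae_eq mu setT f (cst 0).
  apply/ae_eq_integral_abs => //.
  by rewrite -[RHS]h; apply: eq_integral => x _; rewrite gee0_abs.
by apply: filterS => x; exact.
Qed.

Lemma young_poweR (t : R) (a b : \bar R) : (0 < t < 1)%R -> 0 <= a -> 0 <= b ->
  a `^ t * b `^ (1 - t) <= t%:E * a + (1 - t)%:E * b.
Proof.
move=> /andP[t0 t1]; have t'0 : (0 < 1 - t)%R by rewrite subr_gt0.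
case: a => [a| |]//; last first.
  move=> _ b0; rewrite gt0_muley ?lte_fin// addye ?leey// gt_eqF//.
  by rewrite (lt_le_trans (ltNyr 0))// mule_ge0// lee_fin ltW.
case: b => [b| |]//; last first.
  move=> a0 _; rewrite gt0_muley ?lte_fin//.
  by rewrite addey// leey.
rewrite !lee_fin => a0 b0.
have := @conjugate_powR _ (a `^ t)%R (b `^ (1 - t))%R (t^-1)%R ((1 - t)^-1)%R.
rewrite !powR_ge0 !invr_gt0 t0 t'0 !invrK => /(_ isT isT isT isT).
rewrite [X in X = _ -> _]addrC subrK => /(_ erefl) h; apply: le_trans h _.
by rewrite -!powRrM !mulfV ?gt_eqF// !powRr1// mulrC [(b * _)%R]mulrC.
Qed.

(* The multiplicative form of Hoelder's inequality avoids conjugate exponents. *)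
Lemma hoelder_geo (t : R) f g : (0 < t < 1)%R ->
  measurable_fun setT f -> measurable_fun setT g ->
  (forall x, 0 <= f x) -> (forall x, 0 <= g x) ->
  \int[mu]_x (f x `^ t * g x `^ (1 - t)) <=
  (\int[mu]_x f x) `^ t * (\int[mu]_x g x) `^ (1 - t).
Proof.
move=> t01 mf mg f0 g0; have /andP[t0 t1] := t01.
have t'0 : (0 < 1 - t)%R by rewrite subr_gt0.
have t'N : (1 - t != 0)%R by rewrite gt_eqF.
have tN : (t != 0)%R by rewrite gt_eqF.
have I0 : 0 <= \int[mu]_x f x by exact: integral_ge0.
have J0 : 0 <= \int[mu]_x g x by exact: integral_ge0.
have [I00|In0] := eqVneq (\int[mu]_x f x) 0.
  rewrite I00 poweR0r// mul0e -[leRHS](integral0 mu setT).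
  apply: ae_le_integral => //.
    by move=> x; rewrite mule_ge0 ?poweR_ge0.
  by apply: filterS (integral_eq0_ae mf f0 I00) => x ->; rewrite poweR0r// mul0e.
have [J00|Jn0] := eqVneq (\int[mu]_x g x) 0.
  rewrite J00 poweR0r// mule0 -[leRHS](integral0 mu setT).
  apply: ae_le_integral => //.
    by move=> x; rewrite mule_ge0 ?poweR_ge0.
  by apply: filterS (integral_eq0_ae mg g0 J00) => x ->; rewrite poweR0r// mule0.
have Ip : 0 < \int[mu]_x f x by rewrite lt0e In0.
have Jp : 0 < \int[mu]_x g x by rewrite lt0e Jn0.
have [Iy|Iy] := eqVneq (\int[mu]_x f x) +oo.
  by rewrite Iy poweRyr// gt0_mulye ?leey// poweR_gt0.
have [Jy|Jy] := eqVneq (\int[mu]_x g x) +oo.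
  by rewrite Jy poweRyr// gt0_muley ?leey// poweR_gt0.
have Ifin : \int[mu]_x f x \is a fin_num by rewrite ge0_fin_numE// ltey.
have Jfin : \int[mu]_x g x \is a fin_num by rewrite ge0_fin_numE// ltey.
set i := fine (\int[mu]_x f x); set j := fine (\int[mu]_x g x).
have iE : \int[mu]_x f x = i%:E by rewrite fineK.
have jE : \int[mu]_x g x = j%:E by rewrite fineK.
have i0 : (0 < i)%R by rewrite -lte_fin -iE.
have j0 : (0 < j)%R by rewrite -lte_fin -jE.
(* Both integrals are now positive and finite; after division by them Young's inequality integrates
   to [t + (1 - t) = 1]. *)
pose c : R := (i `^ t * j `^ (1 - t))%R.
have c0 : (0 <= c)%R by rewrite mulr_ge0 ?powR_ge0.
rewrite iE jE; apply: (@le_trans _ _ (\int[mu]_x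
  (c%:E * (((t / i)%:E * f x + ((1 - t) / j)%:E * g x))))).
  apply: le_integralT => x; first by rewrite mule_ge0 ?poweR_ge0.
  have -> : f x `^ t * g x `^ (1 - t) =
    c%:E * (((i^-1)%:E * f x) `^ t * ((j^-1)%:E * g x) `^ (1 - t)).
    have E : (c * (i^-1 `^ t * j^-1 `^ (1 - t)) = 1)%R.
      rewrite /c mulrACA -!powRM ?invr_ge0 ?ltW// !mulfV ?gt_eqF//.
      by rewrite !powR1 mulr1.
    have i'0 : 0 <= (i^-1)%:E by rewrite lee_fin invr_ge0 ltW.
    have j'0 : 0 <= (j^-1)%:E by rewrite lee_fin invr_ge0 ltW.
    rewrite !poweRM// [X in c%:E * X]muleACA [RHS]muleA -[LHS]mul1e; congr (_ * _).
    by rewrite -[RHS]/((c * (i^-1 `^ t * j^-1 `^ (1 - t)))%R%:E) E.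
  apply: lee_wpmul2l; first by rewrite lee_fin.
  apply: le_trans (young_poweR _ _ _) _ => //.
  - by rewrite mule_ge0// lee_fin invr_ge0 ltW.
  - by rewrite mule_ge0// lee_fin invr_ge0 ltW.
  by rewrite !muleA -!EFinM.
rewrite ge0_integralZl_EFin//; last 2 first.
- by move=> x _; rewrite adde_ge0// mule_ge0// lee_fin divr_ge0 ?ltW.
- by apply: emeasurable_funD; exact: measurable_funeM.
rewrite ge0_integralD//; last 4 first.
- by move=> x _; rewrite mule_ge0// lee_fin divr_ge0 ?ltW.
- exact: measurable_funeM.
- by move=> x _; rewrite mule_ge0// lee_fin divr_ge0 ?ltW.
- exact: measurable_funeM.
have ti0 : (0 <= t / i)%R by rewrite divr_ge0 ?ltW.
have tj0 : (0 <= (1 - t) / j)%R by rewrite divr_ge0 ?ltW.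
rewrite !ge0_integralZl_EFin// iE jE.
rewrite -[leLHS]/((c * (t / i * i + (1 - t) / j * j))%R%:E) !divfK ?gt_eqF//.
by rewrite [(t + _)%R]addrC subrK mulr1.
Qed.

End integral_basics.

(** * Maximal operators over countable families of sets *)

Section maximal_operator.
Context d (T : measurableType d) (R : realType).
Variable mu : {measure set T -> \bar R}.
Implicit Types (f h : T -> \bar R) (w : T -> R).

Lemma integral_setU_le (A B : set T) f : measurable A -> measurable B ->
  measurable_fun setT f -> (forall x, 0 <= f x) ->
  \int[mu]_(x in A `|` B) f x <= \int[mu]_(x in A) f x + \int[mu]_(x in B) f x.
Proof.
move=> mA mB mf f0; rewrite integral_mkcond [X in _ <= X + _]integral_mkcond.
rewrite [X in _ <= _ + X]integral_mkcond -ge0_integralD//; last 4 first.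
- by move=> x _; exact: erestrict_ge0.
- exact/(measurable_restrictT f)/measurable_funTS.
- by move=> x _; exact: erestrict_ge0.
- exact/(measurable_restrictT f)/measurable_funTS.
apply: le_integralT => x; first exact: erestrict_ge0.
rewrite !patchE in_setU; case: (x \in A); case: (x \in B) => //=.
- by rewrite leeDl.
- by rewrite adde0.
- by rewrite add0e.
- by rewrite adde0.
Qed.

Lemma integral_bigcup_le (s : seq nat) (A : nat -> set T) f :
  (forall k, measurable (A k)) ->
  measurable_fun setT f -> (forall x, 0 <= f x) ->
  \int[mu]_(x in \bigcup_(k in [set` s]) A k) f x <=
  \sum_(k <- s) \int[mu]_(x in A k) f x.
Proof.
move=> mA mf f0; rewrite bigcup_seq; elim: s => [|k s IH].
  by rewrite !big_nil integral_set0.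
rewrite !big_cons; apply: le_trans (integral_setU_le _ _ _ _) _ => //.
  by apply: bigsetU_measurable.
exact: leeD2l.
Qed.

Lemma integral_bigcup_ub (F : nat -> set T) f (K : \bar R) :
  nondecreasing_seq F -> (forall k, measurable (F k)) ->
  measurable_fun setT f -> (forall x, 0 <= f x) ->
  (forall k, \int[mu]_(x in F k) f x <= K) ->
  \int[mu]_(x in \bigcup_k F k) f x <= K.
Proof.
move=> ndF mF mf f0 hK.
have h : \int[mu]_(x in F i) f x @[i --> \oo] -->
    \int[mu]_(x in \bigcup_i F i) f x.
  by apply: ge0_nondecreasing_set_cvg_integral => // i; exact: measurable_funTS.
rewrite -(cvg_lim _ h)//; apply: lime_le; first by apply/cvg_ex; eexists; exact: h.
exact: nearW.
Qed.

Variables (B Bs : nat -> set T).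

(** The normalization [m] is a parameter: the measure of [B k] gives the Hardy-Littlewood operator,
    its mass under a weight the weighted maximal operators of Lerner's argument. A countable family
    makes measurability immediate. *)
Definition maxop (m : nat -> R) h (x : T) : \bar R :=
  ereal_sup (range (fun k =>
    ((m k)^-1 * \1_(B k) x)%:E * \int[mu]_(y in B k) h y)).

Hypothesis mB : forall k, measurable (B k).
Hypothesis mBs : forall k, measurable (Bs k).

Lemma maxop_ge m h k x : B k x ->
  ((m k)^-1)%:E * \int[mu]_(y in B k) h y <= maxop m h x.
Proof.
move=> Bx; apply: ereal_sup_ubound; exists k => //=.
by rewrite indicE mem_set// mulr1.
Qed.

Lemma maxop_le m h x (K : \bar R) : 0 <= K ->
  (forall k, B k x -> ((m k)^-1)%:E * \int[mu]_(y in B k) h y <= K) ->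
  maxop m h x <= K.
Proof.
move=> K0 hK; apply: ge_ereal_sup => _ [k _ <-].
rewrite indicE; case: (boolP (x \in B k)) => xB.
  by rewrite mulr1; apply: hK; exact: set_mem.
by rewrite mulr0 mul0e.
Qed.

Lemma maxop_ge0 m h x : (forall k, (0 < m k)%R) -> (forall y, 0 <= h y) ->
  0 <= maxop m h x.
Proof.
move=> m0 h0; apply: (@le_trans _ _ (((m 0%N)^-1 * \1_(B 0%N) x)%:E *
    \int[mu]_(y in B 0%N) h y)).
  apply: mule_ge0; last exact: integral_ge0.
  by rewrite lee_fin mulr_ge0// invr_ge0 ltW.
by apply: ereal_sup_ubound; exists 0%N.
Qed.

Lemma measurable_maxop m h : measurable_fun setT (maxop m h).
Proof.
rewrite (_ : maxop m h = fun x => esups (fun k =>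
    ((m k)^-1 * \1_(B k) x)%:E * \int[mu]_(y in B k) h y) 0%N).
  apply: (measurable_fun_esups (f := fun k x =>
    ((m k)^-1 * \1_(B k) x)%:E * \int[mu]_(y in B k) h y)) => k.
  apply: emeasurable_funM; last exact: measurable_cst.
  apply/measurable_EFinP; apply: measurable_funM; first exact: measurable_cst.
  exact: measurable_indic.
apply/funext => x; rewrite /esups /maxop; congr ereal_sup.
by rewrite /sdrop; apply/seteqP; split=> _ [k _ <-]; exists k.
Qed.

Hypothesis vitali : forall s : seq nat, exists t : seq nat,
  [/\ uniq t, {subset t <= s}, trivIset [set` t] B &
      \bigcup_(k in [set` s]) B k `<=` \bigcup_(k in [set` t]) Bs k].

(** The level set is an increasing union of finite unions of sets [B k] on which the average exceeds
    [l]; the Vitali selection is made in each finite union, so the sizes of the sets need not be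
    bounded. *)
Lemma weak_type w (m : nat -> R) (D : R) h (l : R) :
  measurable_fun setT w -> (forall x, (0 <= w x)%R) -> (0 <= D)%R ->
  (forall k, (0 < m k)%R) ->
  (forall k, \int[mu]_(x in Bs k) (w x)%:E <= (D * m k)%:E) ->
  measurable_fun setT h -> (forall x, 0 <= h x) -> (0 < l)%R ->
  l%:E * \int[mu]_(x in [set x | l%:E < maxop m h x]) (w x)%:E <=
  D%:E * \int[mu]_x h x.
Proof.
move=> mw w0 D0 m0 Dm mh h0 l0.
have mw' : measurable_fun setT (EFin \o w) by exact/measurable_EFinP.
pose s N := [seq k <- iota 0 N |
  `[< l%:E < ((m k)^-1)%:E * \int[mu]_(y in B k) h y >]].
pose E N := \bigcup_(k in [set` s N]) B k.
have mE N : measurable (E N).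
  by rewrite /E bigcup_seq; exact: bigsetU_measurable.
have ndE : nondecreasing_seq E.
  move=> i j ij; apply/subsetPset => x [k /= ks Bx]; exists k => //=.
  move: ks; rewrite !mem_filter !mem_iota => /andP[-> /=].
  by rewrite !add0n => /leq_trans; exact.
have -> : [set x | l%:E < maxop m h x] = \bigcup_N E N.
  apply/seteqP; split=> x /=.
    move=> /ereal_sup_gt [_ [k _ <-]] /=.
    rewrite indicE; case: (boolP (x \in B k)) => [/set_mem|] xB; last first.
      by rewrite mulr0 mul0e ltNge lee_fin ltW.
    rewrite mulr1 => lk; exists k.+1 => //; exists k => //=.
    by rewrite mem_filter mem_iota/= add0n ltnS leqnn andbT; exact/asboolP.
  move=> [N _ [k /=]]; rewrite mem_filter => /andP[/asboolP lk _] Bx.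
  exact: lt_le_trans lk (maxop_ge _ _ Bx).
rewrite -[leRHS]mul1e -(mulfV (lt0r_neq0 l0)) EFinM -muleA.
apply: lee_wpmul2l; first by rewrite lee_fin ltW.
apply: integral_bigcup_ub => // N.
have [t [ut ts tB st]] := vitali (s N).
apply: (@le_trans _ _ (\sum_(k <- t) \int[mu]_(x in Bs k) (w x)%:E)).
  apply: le_trans (integral_bigcup_le _ _ _ _) => //.
  by apply: le_integral_subset => // x; rewrite lee_fin.
apply: (@le_trans _ _ (\sum_(k <- t) (l^-1)%:E *
    (D%:E * \int[mu]_(x in B k) h x))).
  rewrite big_seq [leRHS]big_seq; apply: lee_sum => k kt.
  apply: (le_trans (Dm k)).
  have := ts _ kt; rewrite mem_filter => /andP[/asboolP lk _].
  rewrite muleCA EFinM; apply: lee_wpmul2l; first by rewrite lee_fin.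
  rewrite lee_pdivlMl//.
  by move/ltW : lk; rewrite lee_pdivlMl// muleC.
rewrite -ge0_sume_distrr; last first.
  by move=> k _; rewrite mule_ge0 ?integral_ge0.
rewrite -ge0_sume_distrr; last by move=> k _; rewrite integral_ge0.
apply: lee_wpmul2l; first by rewrite lee_fin invr_ge0 ltW.
apply: lee_wpmul2l; first by rewrite lee_fin.
rewrite -(@ge0_integral_bigsetU _ _ _ mu _ B)//; last exact: measurable_funTS.
exact: le_integral_subset.
Qed.

End maximal_operator.

(** * Dyadic levels and Marcinkiewicz interpolation *)

Section dyadic_levels.
Context (R : realType).
Implicit Types (p q e y : R).

Lemma exists_pow2_ge e y : (0 < e)%R -> exists k, (y <= e * 2 ^+ k)%R.
Proof.
move=> e0; exists (Num.bound (`|y| / e)).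
have h : (`|y| / e < (Num.bound (`|y| / e))%:R)%R.
  by apply: archi_boundP; rewrite divr_ge0// ltW.
rewrite (le_trans (ler_norm y))// mulrC -ler_pdivrMr//.
rewrite (le_trans (ltW h))// -natrX ler_nat ltnW//.
exact: ltn_expl.
Qed.

Lemma powR2M e q k : (0 < e)%R ->
  ((e * 2 ^+ k) `^ q = e `^ q * (2 `^ q) ^+ k)%R.
Proof.
move=> e0; rewrite powRM ?ltW ?exprn_gt0//; congr (_ * _)%R.
by rewrite -powR_mulrn// -!powRrM mulrC powRrM powR_mulrn// powR_ge0.
Qed.

Lemma pow2_gt1 q : (0 < q)%R -> (1 < 2 `^ q :> R)%R.
Proof.
move=> q0; have := gt0_ltr_powR q0 (x := 1%R) (y := 2%R).
by rewrite !nnegrE powR1; apply=> //; rewrite ltr1n.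
Qed.

(* Only finitely many levels contribute, and the last one dominates. *)
Lemma sum_levels_le e q y K : (0 < e)%R -> (0 < q)%R -> (0 <= y)%R ->
  (\sum_(0 <= k < K) (e * 2 ^+ k) `^ q * (e * 2 ^+ k < y)%R%:R <=
   2 `^ q / (2 `^ q - 1) * y `^ q)%R.
Proof.
move=> e0 q0 y0; set r := (2 `^ q)%R; have r1 : (1 < r)%R by exact: pow2_gt1.
have r10 : (0 < r - 1)%R by rewrite subr_gt0.
have c0 : (0 <= r / (r - 1))%R by rewrite divr_ge0// ltW// (lt_trans ltr01).
elim: K => [|K IH]; first by rewrite big_geq// mulr_ge0 ?powR_ge0.
have [yK|Ky] := ltP (e * 2 ^+ K)%R y; last first.
  by rewrite big_nat_recr//= [(_ < _)%R]ltNge Ky/= mulr0 addr0.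
apply: (@le_trans _ _ (\sum_(0 <= k < K.+1) e `^ q * r ^+ k)%R).
  apply: ler_sum => k _; rewrite powR2M//.
  by case: (_ < _)%R; rewrite ?mulr1// mulr0 mulr_ge0 ?powR_ge0// exprn_ge0 ?powR_ge0.
apply: (@le_trans _ _ (r / (r - 1) * (e * 2 ^+ K) `^ q)%R); last first.
  apply: ler_wpM2l => //; apply: ge0_ler_powR; rewrite ?nnegrE// ?ltW//.
  by rewrite mulr_gt0// exprn_gt0.
rewrite -mulr_sumr big_mkord powR2M// -/r mulrCA ler_wpM2l ?powR_ge0//.
have -> : (\sum_(i < K.+1) r ^+ i = (r ^+ K.+1 - 1) / (r - 1))%R.
  by rewrite subrX1 mulrC mulKf// gt_eqF.
by rewrite mulrAC -exprS ler_pM2r ?invr_gt0// gerBl.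
Qed.

Lemma nneseries_levels_le e q (y : \bar R) : (0 < e)%R -> (0 < q)%R -> 0 <= y ->
  \sum_(0 <= k <oo) ((e * 2 ^+ k) `^ q * ((e * 2 ^+ k)%:E < y)%E%:R)%:E <=
  (2 `^ q / (2 `^ q - 1))%:E * y `^ q.
Proof.
move=> e0 q0; have r1 := pow2_gt1 q0.
have c0 : (0 < 2 `^ q / (2 `^ q - 1) :> R)%R.
  by rewrite divr_gt0 ?powR_gt0// subr_gt0.
case: y => [y| |]// y0; last first.
  by rewrite poweRyr ?gt_eqF// gt0_muley ?leey// lte_fin.
apply: lime_le.
  by apply: is_cvg_nneseries => k _ _; rewrite lee_fin mulr_ge0// powR_ge0.
apply: nearW => K; rewrite sumEFin lee_fin.
exact: sum_levels_le.
Qed.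

Lemma le_nneseries_term (u : nat -> \bar R) k : (forall i, 0 <= u i) ->
  u k <= \sum_(0 <= i <oo) u i.
Proof.
move=> u0; apply: le_trans (nneseries_lim_ge k.+1 _) => //.
by rewrite big_nat_recr//= leeDr// sume_ge0.
Qed.

Lemma ge0_nneseriesZr (u : nat -> \bar R) (y : \bar R) : (forall i, 0 <= u i) ->
  0 <= y -> \sum_(0 <= i <oo) (u i * y) = (\sum_(0 <= i <oo) u i) * y.
Proof.
move=> u0; case: y => [y| |]// y0.
  rewrite muleC -nneseriesZl//; apply: eq_eseriesr => i _.
  by rewrite muleC.
have uy0 i : 0 <= u i * +oo by rewrite mule_ge0.
have [[i ui]|] := pselect (exists i, 0 < u i).
  rewrite gt0_muley; last exact: lt_le_trans (le_nneseries_term i u0).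
  apply/eqP; rewrite -leye_eq (le_trans _ (le_nneseries_term i uy0))//.
  by rewrite gt0_muley.
move=> /forallNP hu; have uE i : u i = 0.
  by apply/eqP; rewrite eq_le u0 andbT leNgt; apply/negP/hu.
by rewrite !eseries0 ?mul0e// => i _ _; rewrite uE ?mul0e.
Qed.

(** The largest level [e * 2 ^+ k] below a finite [y] is at least [y / 2], so that this single term
    suffices; for [y = +oo] the terms are unbounded. *)
Lemma le_nneseries_levels e p (y : \bar R) : (0 < e)%R -> (0 < p)%R ->
  e%:E < y ->
  y `^ p <= (2 `^ p)%:E *
    \sum_(0 <= k <oo) ((e * 2 ^+ k) `^ p * ((e * 2 ^+ k)%:E < y)%E%:R)%:E.
Proof.
move=> e0 p0 ey.
have t0 k : 0 <= ((e * 2 ^+ k) `^ p * ((e * 2 ^+ k)%:E < y)%E%:R)%:E.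
  by rewrite lee_fin mulr_ge0// powR_ge0.
have lek k := le_nneseries_term k t0.
case: y => [y| |]// in ey t0 lek *; last first.
  suff -> : \sum_(0 <= k <oo) ((e * 2 ^+ k) `^ p * ((e * 2 ^+ k)%:E < +oo)%E%:R)%:E
    = +oo :> \bar R.
    by rewrite gt0_muley ?leey// lte_fin powR_gt0.
  apply/eqyP => A A0; have [k hk] := exists_pow2_ge (A `^ p^-1) e0.
  apply: le_trans (lek k); rewrite ltry mulr1 lee_fin.
  have -> : A = ((A `^ p^-1) `^ p)%R.
    by rewrite -powRrM mulVf ?lt0r_neq0// powRr1// ltW.
  apply: ge0_ler_powR => //; first exact: ltW.
    by rewrite nnegrE powR_ge0.
  by rewrite nnegrE ltW// mulr_gt0// exprn_gt0.
have [[|k] hk kmin] := ex_minnP (exists_pow2_ge y e0).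
  by move: ey; rewrite lte_fin ltNge; move: hk; rewrite expr0 mulr1 => ->.
have ky : (e * 2 ^+ k < y)%R.
  by rewrite ltNge; apply/negP => /kmin; rewrite ltnn.
apply: (@le_trans _ _ ((2 `^ p)%:E *
    ((e * 2 ^+ k) `^ p * ((e * 2 ^+ k)%:E < y%:E)%E%:R)%:E)); last first.
  by apply: lee_wpmul2l; rewrite ?lek// lee_fin powR_ge0.
have ek0 : (0 <= e * 2 ^+ k)%R by rewrite mulr_ge0 ?exprn_ge0 ?(ltW e0).
rewrite lte_fin ky mulr1 lee_fin -powRM//.
apply: ge0_ler_powR; rewrite ?nnegrE ?(ltW p0) ?mulr_ge0 ?(ltW e0)//.
- by rewrite ltW// (lt_trans e0).
- by rewrite mulrCA -exprS.
Qed.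

End dyadic_levels.

Section marcinkiewicz.
Context d (T : measurableType d) (R : realType).
Variable mu : {measure set T -> \bar R}.

Lemma integral_mul_indic (A : set T) (c : R) (h : T -> \bar R) :
  measurable A -> measurable_fun setT h -> (forall x, 0 <= h x) -> (0 <= c)%R ->
  \int[mu]_x ((c * \1_A x)%:E * h x) = c%:E * \int[mu]_(x in A) h x.
Proof.
move=> mA mh h0 c0; rewrite [in RHS]integral_mkcond -ge0_integralZl_EFin//.
- apply: eq_integral => x _; rewrite patchE indicE; case: (x \in A).
    by rewrite mulr1.
  by rewrite mulr0 mul0e mule0.
- by move=> x _; exact: erestrict_ge0.
- exact/(measurable_restrictT h)/measurable_funTS.
Qed.

(** A layer-cake bound with a geometric sequence of levels in place of an integral over all levels:
    monotone convergence then replaces Fubini's theorem. *)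
Lemma integral_gt_levels (p e : R) (g h : T -> \bar R) :
  (0 < p)%R -> (0 < e)%R ->
  measurable_fun setT g -> measurable_fun setT h ->
  (forall x, 0 <= g x) -> (forall x, 0 <= h x) ->
  \int[mu]_(x in [set x | e%:E < g x]) (g x `^ p * h x) <=
  (2 `^ p)%:E * \sum_(0 <= k <oo) ((e * 2 ^+ k) `^ p)%:E *
    \int[mu]_(x in [set x | (e * 2 ^+ k)%:E < g x]) h x.
Proof.
move=> p0 e0 mg mh g0 h0.
pose A l := [set x | l%:E < g x].
have mA l : measurable (A l).
  by rewrite -[X in measurable X]setTI; exact: emeasurable_fun_o_infty.
pose F k x := ((e * 2 ^+ k) `^ p * \1_(A (e * 2 ^+ k)%R) x)%:E * h x.
have F0 k x : 0 <= F k x by rewrite mule_ge0// lee_fin mulr_ge0// powR_ge0.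
have mF k : measurable_fun setT (F k).
  apply: emeasurable_funM => //; apply/measurable_EFinP.
  by apply: measurable_funM => //; exact: measurable_indic.
rewrite [leRHS](_ : _ = \int[mu]_x ((2 `^ p)%:E * \sum_(0 <= k <oo) F k x)).
  rewrite integral_mkcond; apply: le_integralT.
    by apply: erestrict_ge0 => x _; rewrite mule_ge0// poweR_ge0.
  move=> x; rewrite patchE; case: ifPn => [/set_mem /= ex|_]; last first.
    by rewrite mule_ge0 ?nneseries_ge0// lee_fin powR_ge0.
  rewrite /F (_ : \sum_(0 <= k <oo) _ = (\sum_(0 <= k <oo)
      ((e * 2 ^+ k) `^ p * ((e * 2 ^+ k)%:E < g x)%E%:R)%:E) * h x).
    rewrite muleA; apply: lee_wpmul2r => //.
    exact: le_nneseries_levels.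
  rewrite -ge0_nneseriesZr//; last by move=> k; rewrite lee_fin mulr_ge0// powR_ge0.
  apply: eq_eseriesr => k _; congr ((_ * _)%:E * _).
  rewrite indicE; congr (_%:R); congr (nat_of_bool _).
  by apply/idP/idP => [/set_mem //|xA]; exact: mem_set.
rewrite ge0_integralZl_EFin ?powR_ge0//; last 2 first.
- by move=> x _; exact: nneseries_ge0.
- exact: ge0_emeasurable_sum.
rewrite integral_nneseries//; congr (_ * _); apply: eq_eseriesr => k _.
by rewrite integral_mul_indic// powR_ge0.
Qed.

(** The truncation [l / 2 < f] in the hypothesis carries the L^infinity bound of the operator. [phi]
    is kept apart from [f] because in the application it is [f] times a weight, whereas only [f] is
    compared with the level. *)
Lemma marcinkiewicz (p C : R) (f g phi w : T -> \bar R) :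
  (1 < p)%R -> (0 <= C)%R ->
  measurable_fun setT f -> measurable_fun setT g ->
  measurable_fun setT phi -> measurable_fun setT w ->
  (forall x, 0 <= f x) -> (forall x, 0 <= g x) ->
  (forall x, 0 <= phi x) -> (forall x, 0 <= w x) ->
  (forall l : R, (0 < l)%R ->
    l%:E * \int[mu]_(x in [set x | l%:E < g x]) w x <=
    C%:E * \int[mu]_(x in [set x | (l / 2)%:E < f x]) phi x) ->
  \int[mu]_x (g x `^ p * w x) <=
  (2 `^ p * C * (2 `^ (p - 1) / (2 `^ (p - 1) - 1) * 2 `^ (p - 1)))%:E *
  \int[mu]_x (f x `^ (p - 1) * phi x).
Proof.
move=> p1 C0 mf mg mphi mw f0 g0 phi0 w0 H.
have p0 : (0 < p)%R by exact: lt_trans p1.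
have q0 : (0 < p - 1)%R by rewrite subr_gt0.
set c := (2 `^ (p - 1) / _ * _)%R.
have c0 : (0 <= c)%R.
  rewrite /c mulr_ge0 ?powR_ge0// divr_ge0 ?powR_ge0// subr_ge0 ltW//.
  exact: pow2_gt1.
have cE : c = (2 `^ (p - 1) / (2 `^ (p - 1) - 1) * 2 `^ (p - 1))%R by [].
clearbody c.
have mA l : measurable [set x | l%:E < g x].
  by rewrite -[X in measurable X]setTI; exact: emeasurable_fun_o_infty.
pose A l := [set x | l%:E < f x].
have mA' l : measurable (A l).
  by rewrite -[X in measurable X]setTI; exact: emeasurable_fun_o_infty.
have mgw : measurable_fun setT (fun x => g x `^ p * w x).
  by apply: emeasurable_funM => //; exact: measurableT_comp (measurable_poweR _) mg.
have gw0 x : 0 <= g x `^ p * w x by rewrite mule_ge0// poweR_ge0.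
have main (e : R) : (0 < e)%R ->
    \int[mu]_(x in [set x | e%:E < g x]) (g x `^ p * w x) <=
    (2 `^ p * C * c)%:E * \int[mu]_x (f x `^ (p - 1) * phi x).
  move=> e0; apply: le_trans (integral_gt_levels _ _ _ _ _ _) _ => //.
  rewrite !EFinM -!muleA; apply: lee_wpmul2l; first by rewrite lee_fin powR_ge0.
  pose F k x := ((e * 2 ^+ k) `^ (p - 1) *
    \1_(A (e * 2 ^+ k / 2)%R) x)%:E * phi x.
  have F0 k x : 0 <= F k x by rewrite mule_ge0// lee_fin mulr_ge0// powR_ge0.
  have mF k : measurable_fun setT (F k).
    apply: emeasurable_funM => //; apply/measurable_EFinP.
    by apply: measurable_funM => //; exact: measurable_indic.
  apply: (@le_trans _ _ (\sum_(0 <= k <oo) C%:E * \int[mu]_x F k x)).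
    apply: lee_nneseries => k *.
      by apply: mule_ge0; rewrite ?lee_fin ?powR_ge0// integral_ge0.
    have ek : (0 < e * 2 ^+ k)%R by rewrite mulr_gt0// exprn_gt0.
    rewrite integral_mul_indic ?powR_ge0//.
    (* One factor [e * 2 ^+ k] of the [p]-th power is spent on the weak type hypothesis; the
       remaining power [p - 1] is summed over the levels below [2 * f]. *)
    rewrite -(mulr_powRB1 (ltW ek) p0) mulrC EFinM -muleA [leRHS]muleCA.
    by apply: lee_wpmul2l; rewrite ?lee_fin ?powR_ge0// H.
  rewrite nneseriesZl; last by move=> k _; exact: integral_ge0.
  apply: lee_wpmul2l; first by rewrite lee_fin.
  rewrite -integral_nneseries// -ge0_integralZl_EFin//; last 2 first.
  - by move=> x _; rewrite mule_ge0// poweR_ge0.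
  - by apply: emeasurable_funM => //; exact: measurableT_comp (measurable_poweR _) mf.
  apply: le_integralT => x; first exact: nneseries_ge0.
  rewrite /F (_ : \sum_(0 <= k <oo) _ = (\sum_(0 <= k <oo)
      ((e * 2 ^+ k) `^ (p - 1) * ((e * 2 ^+ k)%:E < 2%:E * f x)%E%:R)%:E) * phi x).
    rewrite muleA; apply: lee_wpmul2r => //.
    apply: le_trans (nneseries_levels_le _ _ _) _ => //; first by rewrite mule_ge0.
    by rewrite poweRM// muleA -EFinM cE.
  rewrite -ge0_nneseriesZr//; last by move=> k; rewrite lee_fin mulr_ge0// powR_ge0.
  apply: eq_eseriesr => k _; congr ((_ * _)%:E * _).
  rewrite indicE; congr (_%:R); congr (nat_of_bool _).
  have -> : ((e * 2 ^+ k)%:E < 2%:E * f x) = ((e * 2 ^+ k / 2)%:E < f x).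
    by rewrite -lte_pdivrMl// muleC EFinM.
  by apply/idP/idP => [/set_mem //|xA]; exact: mem_set.
(* The bound above the level [e] does not depend on [e], and the sets where [g] exceeds
   [1 / (N + 1)] exhaust the set where [g] is positive. *)
have -> : \int[mu]_x (g x `^ p * w x) =
    \int[mu]_(x in \bigcup_N [set x | (N.+1%:R^-1)%:E < g x]) (g x `^ p * w x).
  rewrite [RHS]integral_mkcond; apply: eq_integral => x _.
  rewrite patchE; case: ifPn => // /negP xN; suff -> : g x = 0.
    by rewrite poweR0r ?gt_eqF// mul0e.
  apply/eqP; rewrite eq_le g0 andbT leNgt; apply/negP => gx0; apply: xN.
  apply/mem_set; case E : (g x) gx0 => [y| |]//; last first.
    by exists 0%N => //=; rewrite E ltry.
  rewrite lte_fin => y0.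
  exists (Num.bound (y^-1)) => //=; rewrite E lte_fin invf_plt ?posrE//.
  rewrite (lt_trans (archi_boundP _)) ?invr_ge0 ?ltW// ltr_nat//.
apply: integral_bigcup_ub => //.
  move=> i j ij; apply/subsetPset => x /=; apply: le_lt_trans.
  by rewrite lee_fin lef_pV2 ?posrE// ler_nat ltnS.
by move=> N; apply: main; rewrite invr_gt0.
Qed.

End marcinkiewicz.

Section poweR_extra.
Context (R : realType).
Implicit Types (x y : \bar R) (p r : R).

Lemma le_poweR r x y : (0 <= r)%R -> 0 <= x -> x <= y -> x `^ r <= y `^ r.
Proof.
move=> r0 x0 xy; apply: gt0_ler_poweR => //; rewrite in_itv/= leey andbT//.
exact: le_trans xy.
Qed.

Lemma poweRK r x : (0 < r)%R -> 0 <= x -> (x `^ r) `^ r^-1 = x.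
Proof. by move=> r0 x0; rewrite -poweRrM mulfV ?gt_eqF// poweRe1. Qed.

Lemma poweRVK r x : (0 < r)%R -> 0 <= x -> (x `^ r^-1) `^ r = x.
Proof. by move=> r0 x0; rewrite -poweRrM mulVf ?gt_eqF// poweRe1. Qed.

Lemma le_poweR_rootl r x y : (0 < r)%R -> 0 <= x -> 0 <= y ->
  x <= y `^ r^-1 -> x `^ r <= y.
Proof.
move=> r0 x0 y0 xy; rewrite -(poweRVK r0 y0).
by apply: le_poweR => //; exact: ltW.
Qed.

Lemma le_poweR_rootr r x y : (0 < r)%R -> 0 <= x -> 0 <= y ->
  x `^ r <= y -> x <= y `^ r^-1.
Proof.
move=> r0 x0 y0 xy; rewrite -(poweRK r0 x0).
by apply: le_poweR; rewrite ?poweR_ge0// invr_ge0 ltW.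
Qed.

Lemma poweRDp p r x : (0 < p)%R -> (0 < r)%R -> x `^ (p + r) = x `^ p * x `^ r.
Proof.
move=> p0 r0; rewrite poweRD// /poweRD_def.
by apply/implyP => /eqP h; have := addr_gt0 p0 r0; rewrite h ltxx.
Qed.

Lemma poweR_B1 p x : (1 < p)%R -> 0 <= x -> x `^ (p - 1) * x = x `^ p.
Proof.
move=> p1 x0; rewrite -{2}(poweRe1 x0) -poweRDp ?subr_gt0//.
by rewrite subrK.
Qed.

End poweR_extra.

Lemma eq_le_refl (R : realType) (x y : R) : x = y -> (x <= y)%R.
Proof. by move=> ->. Qed.

Lemma measurable_inv_pos d (T : measurableType d) (R : realType) (w : T -> R) :
  measurable_fun setT w -> (forall x, (0 < w x)%R) ->
  measurable_fun setT (fun x => (w x)^-1)%R.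
Proof.
move=> mw w0; rewrite (_ : (fun x => _) = fun x => (w x `^ (-1))%R).
  exact: measurableT_comp (measurable_powR _) mw.
by apply/funext => x; rewrite powR_inv1// ltW.
Qed.

(** * Muckenhoupt's theorem for an abstract family of sets *)

Section muckenhoupt_theorem.
Context d (T : measurableType d) (R : realType).
Variable mu : {measure set T -> \bar R}.
Variables (B Bs : nat -> set T).
Hypothesis mB : forall k, measurable (B k).
Hypothesis mBs : forall k, measurable (Bs k).
Hypothesis vitali : forall s : seq nat, exists t : seq nat,
  [/\ uniq t, {subset t <= s}, trivIset [set` t] B &
      \bigcup_(k in [set` s]) B k `<=` \bigcup_(k in [set` t]) Bs k].

(** The constant of [marcinkiewicz] for the weak type constant [2 * D], the 2 coming from the half
    level. *)
Definition strong_const (p D : R) : R :=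
  (2 `^ p * (2 * D) * (2 `^ (p - 1) / (2 `^ (p - 1) - 1) * 2 `^ (p - 1)))%R.

Lemma strong_const_ge0 p D : (1 < p)%R -> (0 <= D)%R -> (0 <= strong_const p D)%R.
Proof.
move=> p1 D0; rewrite !mulr_ge0 ?powR_ge0// invr_ge0 subr_ge0 ltW//.
by rewrite pow2_gt1// subr_gt0.
Qed.

(** Since [f] is multiplied by [w] and [m k] is the mass of [B k], the operator averages with
    respect to [w dx]: it is a contraction on L^infinity, and doubling gives the weak type bound. *)
Lemma strong_type (w : T -> R) (m : nat -> R) (p D : R) (f : T -> \bar R) :
  measurable_fun setT w -> (forall x, (0 < w x)%R) -> (1 < p)%R -> (0 <= D)%R ->
  (forall k, (0 < m k)%R) ->
  (forall k, \int[mu]_(x in B k) (w x)%:E = (m k)%:E) ->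
  (forall k, \int[mu]_(x in Bs k) (w x)%:E <= (D * m k)%:E) ->
  measurable_fun setT f -> (forall x, 0 <= f x) ->
  \int[mu]_x (maxop mu B m (fun y => f y * (w y)%:E) x `^ p * (w x)%:E) <=
  (strong_const p D)%:E * \int[mu]_x (f x `^ p * (w x)%:E).
Proof.
move=> mw w0 p1 D0 m0 mE Dm mf f0.
have w0' x : 0 <= (w x)%:E by rewrite lee_fin ltW.
have mw' : measurable_fun setT (EFin \o w) by exact/measurable_EFinP.
pose phi x := f x * (w x)%:E.
have phi0 x : 0 <= phi x by rewrite mule_ge0.
have mphi : measurable_fun setT phi by exact: emeasurable_funM.
have -> : \int[mu]_x (f x `^ p * (w x)%:E) =
    \int[mu]_x (f x `^ (p - 1) * phi x).
  by apply: eq_integral => x _; rewrite /phi muleA poweR_B1.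
apply: marcinkiewicz => //; first by rewrite mulr_ge0.
- exact: measurable_maxop.
- by move=> x; exact: maxop_ge0.
move=> l l0; have l20 : (0 < l / 2)%R by rewrite divr_gt0.
pose A := [set x | (l / 2)%:E < f x].
have mA : measurable A.
  by rewrite -[X in measurable X]setTI; exact: emeasurable_fun_o_infty.
pose h := phi \_ A.
have h0 x : 0 <= h x by exact: erestrict_ge0.
have mh : measurable_fun setT h.
  by apply/(measurable_restrictT phi) => //; exact: measurable_funTS.
rewrite [X in _ <= _ * X]integral_mkcond -/h.
apply: (@le_trans _ _ (2%:E * ((l / 2)%:E *
    \int[mu]_(x in [set x | (l / 2)%:E < maxop mu B m h x]) (w x)%:E))).
  have l2E : 2%:E * (l / 2)%:E = l%:E by rewrite -EFinM mulrC divfK.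
  rewrite muleA l2E; apply: lee_wpmul2l.
    by rewrite lee_fin ltW.
  (* The part of [f] below [l / 2] contributes at most [l / 2] to each average; so where the
     operator exceeds [l], its value on the truncated function exceeds [l / 2]. *)
  apply: le_integral_subset => // x /=; rewrite !ltNge; apply: contra => hx.
  apply: maxop_le; first by rewrite lee_fin ltW.
  move=> k Bx; rewrite lee_pdivrMl//.
  apply: (@le_trans _ _ (\int[mu]_(y in B k) (h y + (l / 2)%:E * (w y)%:E))).
    apply: ae_le_integral_in => //.
      by move=> y; rewrite adde_ge0// mule_ge0// lee_fin ltW.
    apply: aeW => y By; rewrite /h patchE; case: ifPn => [_|/negP yA].
      by rewrite leeDl// mule_ge0// lee_fin ltW.
    rewrite add0e; apply: lee_wpmul2r => //.
    by rewrite leNgt; apply/negP => fy; apply: yA; exact: mem_set.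
  rewrite ge0_integralD//; last 3 first.
  - exact: measurable_funTS.
  - by move=> y _; rewrite mule_ge0// lee_fin ltW.
  - by apply: measurable_funTS; exact: measurable_funeM.
  rewrite ge0_integralZl_EFin//; last 2 first.
  - exact: measurable_funTS.
  - exact: ltW.
  rewrite mE.
  have := le_trans (maxop_ge mu m h Bx) hx; rewrite lee_pdivrMl// => hk.
  apply: (@le_trans _ _ ((m k)%:E * (l / 2)%:E + (l / 2)%:E * (m k)%:E)).
    exact: leeD2r.
  rewrite -[leLHS]/((m k * (l / 2) + l / 2 * m k)%R%:E) -EFinM lee_fin.
  by apply: eq_le_refl; field.
rewrite [X in _ <= X * _]EFinM -[leRHS]muleA; apply: lee_wpmul2l; first by rewrite lee_fin.
by apply: (weak_type mB mBs vitali mw _ D0 m0 Dm mh h0 l20) => x; exact: ltW.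
Qed.

(* Lerner's proof of Muckenhoupt's theorem: for [x] in [B k],
   [(avg f)^(p-1)] is controlled by [avg_w (M_sigma(f/sigma)^(p-1) / w)], and the
   weighted maximal operators are bounded without any condition but doubling. *)
Lemma muckenhoupt_bound (w s : T -> R) (m mw ms : nat -> R) (p D A : R)
    (f : T -> \bar R) :
  measurable_fun setT w -> (forall x, (0 < w x)%R) -> (1 < p)%R -> (0 <= D)%R ->
  (0 <= A)%R ->
  (forall x, s x = w x `^ (- (p - 1)^-1))%R ->
  (forall k, (0 < m k)%R) -> (forall k, (0 < mw k)%R) ->
  (forall k, (0 < ms k)%R) ->
  (forall k, mu (B k) = (m k)%:E) ->
  (forall k, \int[mu]_(x in B k) (w x)%:E = (mw k)%:E) ->
  (forall k, \int[mu]_(x in B k) (s x)%:E = (ms k)%:E) ->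
  (forall k, \int[mu]_(x in Bs k) (w x)%:E <= (D * mw k)%:E) ->
  (forall k, \int[mu]_(x in Bs k) (s x)%:E <= (D * ms k)%:E) ->
  (forall k, mw k * ms k `^ (p - 1) <= A * m k `^ p)%R ->
  measurable_fun setT f -> (forall x, 0 <= f x) ->
  \int[mu]_x (maxop mu B m f x `^ p * (w x)%:E) <=
  (A `^ (p / (p - 1)) * (strong_const (p / (p - 1)) D * strong_const p D))%:E *
  \int[mu]_x (f x `^ p * (w x)%:E).
Proof.
move=> mw_ w0 p1 D0 A0 sE m0 mw0 ms0 mE mwE msE Dw Ds hA mf f0.
have p0 : (0 < p)%R by exact: lt_trans p1.
have q0 : (0 < p - 1)%R by rewrite subr_gt0.
have qN : (p - 1 != 0)%R by rewrite gt_eqF.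
have p'1 : (1 < p / (p - 1))%R by rewrite ltr_pdivlMr// mul1r gtrBl.
have wN x : (w x != 0)%R by rewrite gt_eqF.
have s0 x : (0 < s x)%R by rewrite sE powR_gt0.
have ms_ : measurable_fun setT s.
  rewrite (_ : s = fun x => w x `^ (- (p - 1)^-1))%R; last exact/funext.
  exact: measurableT_comp (measurable_powR _) mw_.
have mw' : measurable_fun setT (EFin \o w) by exact/measurable_EFinP.
pose g := maxop mu B ms f.
have g0 x : 0 <= g x by exact: maxop_ge0.
have mg : measurable_fun setT g by exact: measurable_maxop.
have mgp : measurable_fun setT (fun x => g x `^ (p - 1)).
  exact: measurableT_comp (measurable_poweR _) mg.
pose G x := g x `^ (p - 1) * ((w x)^-1)%:E.
have G0 x : 0 <= G x by rewrite mule_ge0 ?poweR_ge0// lee_fin invr_ge0 ltW.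
have mG : measurable_fun setT G.
  apply: emeasurable_funM => //; apply/measurable_EFinP.
  exact: measurable_inv_pos.
pose F x := f x * ((s x)^-1)%:E.
have F0 x : 0 <= F x by rewrite mule_ge0// lee_fin invr_ge0 ltW.
have mF : measurable_fun setT F.
  apply: emeasurable_funM => //; apply/measurable_EFinP.
  exact: measurable_inv_pos.
have GE : (fun x => G x * (w x)%:E) = fun x => g x `^ (p - 1).
  by apply/funext => x; rewrite -muleA -EFinM mulVf ?gt_eqF// mule1.
have FE : (fun x => F x * (s x)%:E) = f.
  by apply/funext => x; rewrite -muleA -EFinM mulVf ?gt_eqF// mule1.
(* Everywhere on [B k] the function [g] is at least the integral of [f] over [B k] divided by
   [ms k]; averaging the power [p - 1] of this over [B k] and the A_p condition give the bound. *)
have ptw x : maxop mu B m f x `^ (p - 1) <=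
    A%:E * maxop mu B mw (fun y => G y * (w y)%:E) x.
  rewrite GE; have gp0 y : 0 <= g y `^ (p - 1) by exact: poweR_ge0.
  have R0 : 0 <= A%:E * maxop mu B mw (fun y => g y `^ (p - 1)) x.
    by rewrite mule_ge0// maxop_ge0.
  apply: le_poweR_rootl => //; first exact: maxop_ge0.
  apply: maxop_le; first exact: poweR_ge0.
  move=> k Bx; set I := \int[mu]_(y in B k) f y.
  have I0 : 0 <= I by exact: integral_ge0.
  have m'0 : 0 <= ((m k)^-1)%:E by rewrite lee_fin invr_ge0 ltW.
  have ms'0 : 0 <= ((ms k)^-1)%:E by rewrite lee_fin invr_ge0 ltW.
  apply: le_poweR_rootr => //; first by rewrite mule_ge0.
  apply: (@le_trans _ _ (A%:E * (((mw k)^-1)%:E *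
      \int[mu]_(y in B k) (g y `^ (p - 1))))); last first.
    by apply: lee_wpmul2l => //; exact: maxop_ge.
  apply: (@le_trans _ _ (A%:E * (((mw k)^-1)%:E *
      ((((ms k)^-1)%:E * I) `^ (p - 1) * (m k)%:E)))); last first.
    apply: lee_wpmul2l => //; apply: lee_wpmul2l.
      by rewrite lee_fin invr_ge0 ltW.
    rewrite -mE -integral_cst//; apply: ae_le_integral_in => //.
      by move=> y; exact: poweR_ge0.
    apply: aeW => y By /=; apply: le_poweR; [exact: ltW|exact: mule_ge0|].
    exact: maxop_ge.
  rewrite !poweRM// [X in _ <= _ * (_ * X)]muleAC !muleA.
  apply: lee_wpmul2r; first exact: poweR_ge0.
  rewrite -[leLHS]/(((m k)^-1 `^ (p - 1))%R%:E).
  rewrite -[leRHS]/((A * (mw k)^-1 * (ms k)^-1 `^ (p - 1) * m k)%R%:E) lee_fin.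
  have inv_powR (a : R) : (0 < a)%R -> (a^-1 `^ (p - 1) = (a `^ (p - 1))^-1)%R.
    by move=> a0; rewrite -powR_inv1 ?ltW// -powRrM mulN1r powRN.
  rewrite !inv_powR//; have := hA k.
  rewrite -(mulr_powRB1 (ltW (m0 k)) p0) => hk.
  rewrite -[leLHS]mul1r ler_pdivrMr ?powR_gt0//.
  rewrite -(@ler_pM2l _ (mw k * ms k `^ (p - 1))); last first.
    by rewrite mulr_gt0// powR_gt0.
  rewrite mulr1; apply: le_trans hk _; apply: eq_le_refl; field.
  by rewrite !gt_eqF ?powR_gt0.
(* The pointwise bound is raised to the conjugate exponent [p / (p - 1)]; [strong_type] is then used
   for [w] with that exponent and for [s] with the exponent [p]. *)
have -> : \int[mu]_x (maxop mu B m f x `^ p * (w x)%:E) =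
    \int[mu]_x ((maxop mu B m f x `^ (p - 1)) `^ (p / (p - 1)) * (w x)%:E).
  apply: eq_integral => x _; rewrite -poweRrM; congr (_ `^ _ * _).
  by rewrite mulrC divfK.
have Mw0 x : 0 <= maxop mu B mw (fun y => G y * (w y)%:E) x.
  by apply: maxop_ge0 => // y; rewrite mule_ge0// lee_fin ltW.
apply: (@le_trans _ _ ((A `^ (p / (p - 1)))%:E * \int[mu]_x
    (maxop mu B mw (fun y => G y * (w y)%:E) x `^ (p / (p - 1)) * (w x)%:E))).
  rewrite -ge0_integralZl_EFin ?powR_ge0//; last 2 first.
  - by move=> x _; rewrite mule_ge0 ?poweR_ge0// lee_fin ltW.
  - apply: emeasurable_funM => //.
    by apply: measurableT_comp (measurable_poweR _) _; exact: measurable_maxop.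
  apply: le_integralT => x; first by rewrite mule_ge0 ?poweR_ge0// lee_fin ltW.
  rewrite muleA; apply: lee_wpmul2r; first by rewrite lee_fin ltW.
  rewrite -poweR_EFin -poweRM//; apply: le_poweR => //; last exact: poweR_ge0.
  by rewrite divr_ge0// ltW.
rewrite EFinM -muleA; apply: lee_wpmul2l; first by rewrite lee_fin powR_ge0.
apply: (le_trans (strong_type mw_ w0 p'1 D0 mw0 mwE Dw mG G0)).
rewrite [X in _ <= X * _]EFinM -[leRHS]muleA; apply: lee_wpmul2l.
  by rewrite lee_fin strong_const_ge0.
rewrite [leLHS](_ : _ = \int[mu]_x (g x `^ p * (s x)%:E)); last first.
  apply: eq_integral => x _; rewrite /G poweRM ?poweR_ge0//; last first.
    by rewrite lee_fin invr_ge0 ltW.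
  rewrite -poweRrM (_ : (p - 1) * _ = p)%R; last by rewrite mulrC divfK.
  rewrite -muleA; congr (_ * _); rewrite poweR_EFin -EFinM sE; congr (_%:E).
  rewrite -[X in (X `^ _ * _)%R]powR_inv1 ?ltW// -powRrM.
  rewrite -[X in (_ * X)%R]powRr1 ?ltW// -powRD ?wN ?implybT//.
  by congr (_ `^ _)%R; field.
rewrite (_ : \int[mu]_x (f x `^ p * (w x)%:E) =
    \int[mu]_x (F x `^ p * (s x)%:E)); last first.
  apply: eq_integral => x _; rewrite /F poweRM//; last first.
    by rewrite lee_fin invr_ge0 ltW.
  rewrite -muleA; congr (_ * _); rewrite poweR_EFin -EFinM sE; congr (_%:E).
  rewrite -powRN -!powRrM -powRD ?wN ?implybT//.
  rewrite -[LHS]powRr1 ?ltW//; congr (_ `^ _)%R; field.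
  by [].
rewrite /g -[in leLHS]FE.
exact: (strong_type ms_ s0 p1 D0 ms0 msE Ds mF F0).
Qed.

End muckenhoupt_theorem.

(** * Cubes *)

Section vitali_covering.
Context (T : Type) (R : realType).
Variables (B Bs : nat -> set T) (side : nat -> R).

Lemma seq_argmax (s : seq nat) : s != [::] ->
  exists2 k, k \in s & forall j, j \in s -> (side j <= side k)%R.
Proof.
elim: s => // i [|i' s] IH _.
  by exists i; rewrite ?mem_seq1// => j; rewrite mem_seq1 => /eqP ->.
have [k ks kmax] := IH isT.
have [ik|ki] := leP (side i) (side k).
  exists k; first by rewrite in_cons ks orbT.
  by move=> j; rewrite in_cons => /predU1P[->//|/kmax].
exists i; first by rewrite mem_head.
move=> j; rewrite in_cons => /predU1P[->//|/kmax /le_trans]; apply.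
exact: ltW.
Qed.

Hypothesis engulf : forall j k, (side j <= side k)%R -> B j `&` B k !=set0 ->
  B j `<=` Bs k.

(** Greedy selection: a set with the largest side is kept, and all those meeting it are covered by
    its enlargement and discarded. *)
Lemma vitali_finite (s : seq nat) : exists t : seq nat,
  [/\ uniq t, {subset t <= s}, trivIset [set` t] B &
      \bigcup_(k in [set` s]) B k `<=` \bigcup_(k in [set` t]) Bs k].
Proof.
have [N] := ubnP (size s); elim: N s => // N IH s sN.
have [->|s0] := eqVneq s [::].
  by exists [::]; split => // x [k].
have [k ks kmax] := seq_argmax s0.
(* Disjointness alone would not remove [k] itself when [B k] is empty. *)
pose s' := [seq j <- s | (j != k) && `[< B j `&` B k = set0 >]].
have [|t [ut ts tB st]] := IH s'.
  rewrite -ltnS (leq_ltn_trans _ sN)// /s'.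
  rewrite size_filter -(count_predC (pred1 k) s) addnC.
  apply: (@leq_trans (count (predC (pred1 k)) s).+1).
    by rewrite ltnS; apply: sub_count => j /andP[].
  by rewrite -addn1 leq_add2l -has_count has_pred1.
have tdis j : j \in t -> B j `&` B k = set0.
  by move=> /ts; rewrite mem_filter => /andP[/andP[_ /asboolP]].
exists (k :: t); split.
- rewrite /= ut andbT; apply/negP => /ts; rewrite mem_filter eqxx/=.
  by [].
- move=> j; rewrite in_cons => /predU1P[->//|/ts]; rewrite mem_filter.
  by case/andP.
- move=> i j /=; rewrite !in_cons => /predU1P[->|it] /predU1P[->|jt] //.
  + by rewrite setIC tdis// => -[x].
  + by rewrite tdis// => -[x].
  + exact: tB.
- move=> x [j /= js Bx].
  have [jk|/set0P jk] := eqVneq (B j `&` B k) set0; last first.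
    by exists k; [rewrite /= mem_head|exact: engulf (kmax _ js) jk _ Bx].
  have [jEk|jNk] := eqVneq j k.
    have : (B j `&` B k) x by split=> //; rewrite -jEk.
    by rewrite jk.
  have [|i it Bsx] := st x.
    by exists j => //=; rewrite mem_filter js jNk/= andbT; exact/asboolP.
  by exists i => //=; rewrite in_cons it orbT.
Qed.

End vitali_covering.

Section cubes.
Context (R : realType) (n : nat).
Implicit Types (a b x : Rn R n) (l m : R).
Local Notation leb := (lebesgue_Rn R n).

Lemma measurable_box (A : 'I_n -> set (measurableTypeR R)) :
  (forall i, measurable (A i)) ->
  measurable [set x : Rn R n | forall i, A i (tnth x i)].
Proof.
move=> mA; rewrite [X in measurable X](_ : _ =
    \bigcap_(i in [set: 'I_n]) ((@tnth _ _)^~ i @^-1` A i)).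
  apply: fin_bigcap_measurable => // i _.
  by rewrite -[X in measurable X]setTI; exact: measurable_tnth.
by apply/seteqP; split=> x /= Ax i; [move=> _|]; exact: Ax.
Qed.

Lemma cube_box a l :
  cube a l = [set x | forall i, `[tnth a i, (tnth a i + l)%R]%classic (tnth x i)].
Proof. by apply/seteqP; split=> x /= h i; have := h i; rewrite in_itv. Qed.

Lemma measurable_cube a l : measurable (cube a l).
Proof.
rewrite cube_box.
exact: (measurable_box (A := fun i => `[tnth a i, (tnth a i + l)%R]%classic)).
Qed.

Lemma leb_cube a l : (0 <= l)%R -> leb (cube a l) = (l ^+ n)%:E.
Proof.
move=> l0; rewrite cube_box.
rewrite (lebesgue_Rn_box (A := fun i => `[tnth a i, (tnth a i + l)%R]%classic))//.
rewrite (eq_bigr (fun=> l%:E)) => [|i _].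
  by rewrite prodEFin prodr_const card_ord.
rewrite lebesgue_measure_itv/= lte_fin ltrDl.
move: l0; rewrite le_eqVlt => /predU1P[<-|->]; first by rewrite ltxx.
by rewrite EFinD addeAC -EFinB subrr add0e.
Qed.

Definition shift_tuple a l : Rn R n := [tuple (tnth a i + l)%R | i < n].

Lemma cube_engulf a b l m : (l <= m)%R -> cube a l `&` cube b m !=set0 ->
  cube a l `<=` cube (shift_tuple b (- m)) (3 * m).
Proof.
move=> lm [x [/= xa xb]] y /= ya i; rewrite tnth_mktuple.
have /andP[] := xa i; have /andP[] := xb i; have /andP[] := ya i.
lra.
Qed.

Lemma exists_cube_sup x y l : exists a m,
  [/\ (l <= m)%R, (0 < m)%R, cube a m x & cube a m y].
Proof.
pose M := (\sum_(i < n) (`|tnth x i| + `|tnth y i|) + `|l| + 1)%R.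
have S0 : (0 <= \sum_(i < n) (`|tnth x i| + `|tnth y i|))%R.
  by apply: sumr_ge0 => i _; rewrite addr_ge0.
have M0 : (0 < M)%R by rewrite ltr_wpDl// addr_ge0.
have hM i : (`|tnth x i| + `|tnth y i| <= M)%R.
  rewrite /M (bigD1 i)//=; set S := (\sum_(_ < n | _) _)%R.
  have : (0 <= S)%R by apply: sumr_ge0 => j _; rewrite addr_ge0.
  by have := normr_ge0 l; lra.
exists [tuple (- M)%R | i < n], (2 * M)%R; split.
- rewrite (le_trans (ler_norm l))// /M; have := normr_ge0 l; move: S0; lra.
- by rewrite mulr_gt0.
- move=> i; rewrite tnth_mktuple; have := hM i.
  have := ler_norm (tnth x i); have := ler_norm (- tnth x i)%R.
  by rewrite normrN; have := normr_ge0 (tnth y i); lra.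
- move=> i; rewrite tnth_mktuple; have := hM i.
  have := ler_norm (tnth y i); have := ler_norm (- tnth y i)%R.
  by rewrite normrN; have := normr_ge0 (tnth x i); lra.
Qed.

(* A sequence running through the cubes with rational data: it makes the maximal
   function a countable supremum. *)
Definition rcube_data (k : nat) : Rn R n * R :=
  if (unpickle k : option (n.-tuple rat * rat)%type) is Some (q, l) then
    if (0 < l)%R then ([tuple ratr (tnth q i) | i < n], ratr l)
    else ([tuple 0%R | i < n], 1%R)
  else ([tuple 0%R | i < n], 1%R).

Definition rcorner k := (rcube_data k).1.
Definition rside k := (rcube_data k).2.
Definition rcube k := cube (rcorner k) (rside k).
Definition rcube3 k := cube (shift_tuple (rcorner k) (- rside k)) (3 * rside k).

Lemma rside_gt0 k : (0 < rside k)%R.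
Proof.
rewrite /rside /rcube_data; case: unpickle => [[q l]|]//=.
by case: ifPn => //= l0; rewrite ltr0q.
Qed.

Lemma rcube_approx a l c : (l < c)%R -> (0 < l)%R ->
  exists2 k, cube a l `<=` rcube k & (rside k < c)%R.
Proof.
(* A quarter of the gap: the corner is lowered by less than [e], the side lengthened by more than
   [e] and less than [2 * e]. *)
move=> lc l0; pose e := ((c - l) / 4)%R.
have e0 : (0 < e)%R by rewrite divr_gt0// subr_gt0.
have [l' l'P] : exists l' : rat, ratr l' \in `](l + e)%R, (l + 2 * e)%R[.
  by apply: rat_in_itvoo; rewrite ltrD2l; lra.
have /choice[q qP] : forall i : 'I_n, exists q : rat,
    ratr q \in `](tnth a i - e)%R, tnth a i[.
  by move=> i; apply: rat_in_itvoo; rewrite ltrBlDr ltrDl.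
move: l'P; rewrite in_itv/= => /andP[l1 l2].
have l'0 : (0 < l')%R by rewrite -(ltr0q R); lra.
pose k := pickle (([tuple q i | i < n], l') : (n.-tuple rat * rat)%type).
have kE : rcube_data k = ([tuple ratr (q i) | i < n], ratr l').
  rewrite /rcube_data pickleK l'0; congr pair.
  by apply: eq_from_tnth => i; rewrite !tnth_mktuple.
exists k; last by rewrite /rside kE/=; move: l2; rewrite /e; lra.
move=> x /= xa i; rewrite /rcorner /rside kE/= tnth_mktuple.
have := qP i; rewrite in_itv/= => /andP[].
by have /andP[] := xa i; lra.
Qed.

Lemma measurable_rcube k : measurable (rcube k).
Proof. exact: measurable_cube. Qed.

Lemma measurable_rcube3 k : measurable (rcube3 k).
Proof. exact: measurable_cube. Qed.

Lemma leb_rcube k : leb (rcube k) = (rside k ^+ n)%:E.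
Proof. by rewrite leb_cube// ltW// rside_gt0. Qed.

Lemma vitali_rcube (s : seq nat) : exists t : seq nat,
  [/\ uniq t, {subset t <= s}, trivIset [set` t] rcube &
      \bigcup_(k in [set` s]) rcube k `<=` \bigcup_(k in [set` t]) rcube3 k].
Proof.
by apply: (@vitali_finite _ R _ _ rside) => j k jk; exact: cube_engulf.
Qed.

(** Serves to let the side [c] of a rational cube around a given cube decrease to the side [l] of
    the latter. *)
Lemma le_exprn_lim l (I y : \bar R) : (0 < l)%R -> 0 <= y ->
  (forall c, (l < c)%R -> I <= (c ^+ n)%:E * y) -> I <= (l ^+ n)%:E * y.
Proof.
move=> l0; case: y => [y| |]// y0 h; last first.
  by rewrite gt0_muley ?leey// lte_fin exprn_gt0.
have [n0|n0] := posnP n.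
  by have := h (l + 1)%R; rewrite ltrDl ltr01 n0 !expr0; exact.
have [y00|yp] : y = 0%R \/ (0 < y)%R.
  by move: y0; rewrite lee_fin le_eqVlt => /predU1P[|]; auto.
  by have := h (l + 1)%R; rewrite ltrDl ltr01 y00 !mule0; exact.
apply/lee_addgt0Pr => e e0.
(* Chosen so that [l ^+ n * t * y] is [l ^+ n * y + e]; the side with volume [l ^+ n * t] is [l]
   times the [n]-th root of [t]. *)
pose t := (1 + e / (l ^+ n * y))%R.
have ly0 : (0 < l ^+ n * y)%R by rewrite mulr_gt0// exprn_gt0.
have t1 : (1 < t)%R by rewrite ltrDl divr_gt0.
have t0 : (0 < t)%R by exact: lt_trans t1.
have n0R : (0 < n%:R^-1 :> R)%R by rewrite invr_gt0 ltr0n.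
have tn : (1 < t `^ n%:R^-1)%R.
  have := gt0_ltr_powR n0R (x := 1%R) (y := t).
  by rewrite !nnegrE powR1; apply=> //; exact: ltW.
apply: (le_trans (h (l * t `^ n%:R^-1)%R _)); first by rewrite ltr_pMr.
rewrite exprMn -[((t `^ _) ^+ n)%R]powR_mulrn ?powR_ge0// -powRrM.
rewrite mulVf ?pnatr_eq0 -?lt0n// (powRr1 (ltW t0)).
rewrite -[leLHS]/((l ^+ n * t * y)%R%:E) -[leRHS]/((l ^+ n * y + e)%R%:E) lee_fin.
rewrite /t mulrAC mulrDr mulr1 mulrCA mulfV ?gt_eqF// mulr1//.
Qed.

Lemma maximal_maxop (h : Rn R n -> \bar R) x : (forall y, 0 <= h y) ->
  maximal h x = maxop leb rcube (fun k => rside k ^+ n)%R h x.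
Proof.
move=> h0; have s0 k : (0 < rside k ^+ n)%R by rewrite exprn_gt0// rside_gt0.
have avgE a l : (0 < l)%R ->
    avg h (cube a l) = ((l ^+ n)^-1)%:E * \int[leb]_(y in cube a l) h y.
  move=> l0; rewrite /avg leb_cube ?ltW// muleC; congr (_ * _).
  by rewrite inver gt_eqF// exprn_gt0.
apply/eqP; rewrite eq_le; apply/andP; split.
  apply: ge_ereal_sup => _ /= [Q [[a [l [l0 ->]]] Qx] <-].
  rewrite avgE// lee_pdivrMl ?exprn_gt0//.
  apply: le_exprn_lim => //; first exact: maxop_ge0.
  move=> c lc; have [k ak kc] := rcube_approx a lc l0.
  apply: (@le_trans _ _ (\int[leb]_(y in rcube k) h y)).
    exact: le_integral_subset.
  have := maxop_ge leb (fun k => rside k ^+ n)%R h (ak _ Qx).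
  rewrite lee_pdivrMl// => /le_trans; apply; apply: lee_wpmul2r.
    exact: maxop_ge0.
  rewrite lee_fin lerXn2r// ?nnegrE ?ltW// ?rside_gt0//.
  exact: lt_trans lc.
apply: ge_ereal_sup => _ [k _ <-].
have mx0 : 0 <= maximal h x.
  have [a [m [_ m0 ax _]]] := exists_cube_sup x x 1.
  apply: (@le_trans _ _ (avg h (cube a m))).
    by rewrite avgE// mule_ge0 ?integral_ge0// lee_fin invr_ge0 exprn_ge0// ltW.
  by apply: ereal_sup_ubound; exists (cube a m) => //; split => //; exists a, m.
rewrite indicE; case: (boolP (x \in rcube k)) => [/set_mem|] xk; last first.
  by rewrite mulr0 mul0e.
rewrite mulr1 -avgE ?rside_gt0//; apply: ereal_sup_ubound; exists (rcube k) => //.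
by split => //; exists (rcorner k), (rside k); rewrite rside_gt0.
Qed.

End cubes.

(** * Weights *)

Section powR_extra.
Context (R : realType).
Implicit Types (x y a b r s : R).
Local Open Scope ring_scope.

Lemma powRDpos x r s : 0 < x -> x `^ (r + s) = x `^ r * x `^ s.
Proof. by move=> x0; rewrite powRD//; apply/implyP => _; rewrite gt_eqF. Qed.

Lemma powRV x r : 0 <= x -> x^-1 `^ r = x `^ (- r).
Proof. by move=> x0; rewrite -powR_inv1// -powRrM mulN1r. Qed.

Lemma le_powR r x y : 0 <= r -> 0 <= x -> x <= y -> x `^ r <= y `^ r.
Proof.
by move=> r0 x0 xy; apply: ge0_ler_powR; rewrite ?nnegrE// (le_trans x0).
Qed.

Lemma ge_powRN r x y : 0 <= r -> 0 < x -> x <= y -> y `^ (- r) <= x `^ (- r).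
Proof.
move=> r0 x0 xy; rewrite !powRN lef_pV2 ?posrE ?powR_gt0//.
  by apply: le_powR => //; exact: ltW.
exact: lt_le_trans xy.
Qed.

Lemma powR_conj_le x y t b : 0 < x -> 0 < y -> 0 < b -> t * (1 + b) = b ->
  1 <= x `^ t * y `^ (1 + b)^-1 -> x `^ (- b) <= y.
Proof.
move=> x0 y0 b0 tb h; have b1 : 0 < 1 + b by rewrite addr_gt0.
have := le_powR (ltW b1) ler01 h.
rewrite powR1 powRM ?powR_ge0// -!powRrM tb mulVf ?gt_eqF// (powRr1 (ltW y0)).
move=> h'; rewrite powRN -(@ler_pM2l _ (x `^ b)) ?powR_gt0//.
by rewrite mulfV// gt_eqF// powR_gt0.
Qed.

End powR_extra.

Section means.
Context (R : realType) (n : nat).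
Implicit Types (a b x : Rn R n) (l m t : R) (w F G : Rn R n -> R).
Local Notation leb := (lebesgue_Rn R n).

(** Borel and positive everywhere, so that negative powers are taken without exceptional sets;
    general weights are replaced by almost everywhere equal ones of this kind. *)
Definition nice w : Prop :=
  [/\ forall x, (0 < w x)%R, measurable_fun setT w &
      forall a l, (0 < l)%R -> \int[leb]_(x in cube a l) (w x)%:E < +oo].

Definition mean w a l : R :=
  locked (fine (\int[leb]_(x in cube a l) (w x)%:E) / l ^+ n)%R.

Lemma mean_ge0 w a l : (forall x, (0 <= w x)%R) -> (0 <= l)%R -> (0 <= mean w a l)%R.
Proof.
move=> w0 l0; rewrite /mean -lock divr_ge0 ?exprn_ge0// fine_ge0//.
by apply: integral_ge0 => x _; rewrite lee_fin.
Qed.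

Lemma integral_mean w a l : nice w -> (0 < l)%R ->
  \int[leb]_(x in cube a l) (w x)%:E = (mean w a l * l ^+ n)%:E.
Proof.
move=> [w0 mw iw] l0; rewrite /mean -lock divfK ?gt_eqF ?exprn_gt0// fineK//.
rewrite ge0_fin_numE ?iw//; apply: integral_ge0 => x _.
by rewrite lee_fin ltW.
Qed.

Lemma measurable_restrictE w a l : measurable_fun setT w ->
  measurable_fun setT ((EFin \o w) \_ (cube a l)).
Proof.
move=> mw; apply/(measurable_restrictT (EFin \o w)); first exact: measurable_cube.
by apply: measurable_funTS; exact/measurable_EFinP.
Qed.

Lemma integral_cubeZl w a l (c : R) : (forall x, (0 <= w x)%R) ->
  measurable_fun setT w -> (0 <= c)%R ->
  \int[leb]_(x in cube a l) (c%:E * (w x)%:E) =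
  c%:E * \int[leb]_(x in cube a l) (w x)%:E.
Proof.
move=> w0 mw c0; rewrite ge0_integralZl_EFin//.
- exact: measurable_cube.
- by move=> x _; rewrite lee_fin.
- by apply: measurable_funTS; exact/measurable_EFinP.
Qed.

Lemma mean_gt0 w a l : nice w -> (0 < l)%R -> (0 < mean w a l)%R.
Proof.
move=> nw l0; have [w0 mw iw] := nw.
rewrite lt_neqAle mean_ge0 ?andbT//; [|by move=> x; exact: ltW|exact: ltW].
apply/negP => /eqP m0; have := integral_mean a nw l0.
rewrite -m0 mul0r integral_mkcond => h.
have [|N [mN N0 hN]] := integral_eq0_ae (measurable_restrictE a l mw) _ h.
  by apply: erestrict_ge0 => x _; rewrite lee_fin ltW.
have : leb (cube a l) <= leb N.
  apply: le_measure; rewrite ?inE//; first exact: measurable_cube.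
  move=> x ax; apply: hN => /=; rewrite patchE mem_set// => -[] /eqP.
  by rewrite gt_eqF.
by rewrite N0 leb_cube ?(ltW l0)// lee_fin leNgt exprn_gt0.
Qed.

Lemma mean_le w w' a l (c : R) : nice w -> nice w' -> (0 < l)%R -> (0 <= c)%R ->
  (\forall x \ae leb, cube a l x -> (w x <= c * w' x)%R) ->
  (mean w a l <= c * mean w' a l)%R.
Proof.
move=> nw nw' l0 c0 h; have [w0 mw iw] := nw; have [w'0 mw' iw'] := nw'.
suff : \int[leb]_(x in cube a l) (w x)%:E <=
    c%:E * \int[leb]_(x in cube a l) (w' x)%:E.
  by rewrite !integral_mean// -EFinM lee_fin mulrA ler_pM2r// exprn_gt0.
rewrite -integral_cubeZl//; last by move=> x; exact: ltW.
apply: ae_le_integral_in.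
- by move=> x; rewrite lee_fin ltW.
- by move=> x; rewrite mule_ge0// lee_fin ltW.
- by apply: filterS h => x h ax; rewrite -EFinM lee_fin h.
Qed.

Lemma integral_cube_cst (c : R) a l : (0 <= l)%R ->
  \int[leb]_(x in cube a l) (cst c x)%:E = (c * l ^+ n)%:E.
Proof.
move=> l0; rewrite EFinM -(leb_cube a l0).
exact: (integral_cst leb (measurable_cube a l) c%:E).
Qed.

Lemma nice_cst (c : R) : (0 < c)%R -> nice (cst c).
Proof.
move=> c0; split => //; move=> a l l0.
by rewrite integral_cube_cst ?ltry// ltW.
Qed.

Lemma mean_cst (c : R) a l : (0 < l)%R -> mean (cst c) a l = c.
Proof.
move=> l0; rewrite /mean -lock integral_cube_cst ?(ltW l0)//=.
by rewrite mulfK// gt_eqF// exprn_gt0.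
Qed.

Lemma nice_le w : (forall x, (0 < w x)%R) -> measurable_fun setT w ->
  (forall a l, (0 < l)%R -> exists2 w', nice w' & exists2 c : R, (0 <= c)%R &
    \forall x \ae leb, cube a l x -> (w x <= c * w' x)%R) -> nice w.
Proof.
move=> w0 mw h; split=> // a l l0; have [w' nw' [c c0 wc]] := h a l l0.
have [w'0 mw' iw'] := nw'.
apply: (@le_lt_trans _ _ (\int[leb]_(x in cube a l) (c%:E * (w' x)%:E))).
  apply: ae_le_integral_in.
  - by move=> x; rewrite lee_fin ltW.
  - by move=> x; rewrite mule_ge0// lee_fin ltW.
  - by apply: filterS wc => x h' ax; rewrite -EFinM lee_fin h'.
rewrite integral_cubeZl//; last by move=> x; exact: ltW.
by rewrite integral_mean// -EFinM ltry.
Qed.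

Lemma nice_bounded w : (forall x, (0 < w x)%R) -> measurable_fun setT w ->
  (forall a l, (0 < l)%R -> exists2 c : R, (0 <= c)%R &
    \forall x \ae leb, cube a l x -> (w x <= c)%R) -> nice w.
Proof.
move=> w0 mw h; apply: nice_le => // a l l0; exists (cst 1%R).
  exact: nice_cst.
have [c c0 hc] := h a l l0; exists c => //.
by apply: filterS hc => x hc ax; rewrite mulr1 hc.
Qed.

Lemma measurable_fun_powR w t : measurable_fun setT w ->
  measurable_fun setT (fun x => w x `^ t)%R.
Proof. exact: measurableT_comp (measurable_powR _). Qed.

Lemma mean_hoelder F G t : (0 < t < 1)%R -> nice F -> nice G ->
  nice (fun x => F x `^ t * G x `^ (1 - t))%R /\
  (forall a l, (0 < l)%R -> mean (fun x => F x `^ t * G x `^ (1 - t))%R a l <=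
    mean F a l `^ t * mean G a l `^ (1 - t))%R.
Proof.
move=> t01 nF nG; have [F0 mF iF] := nF; have [G0 mG iG] := nG.
have /andP[t0 t1] := t01.
have H0 x : (0 < F x `^ t * G x `^ (1 - t))%R by rewrite mulr_gt0 ?powR_gt0.
have mH : measurable_fun setT (fun x => F x `^ t * G x `^ (1 - t))%R.
  by apply: measurable_funM; exact: measurable_fun_powR.
have main a l : (0 < l)%R ->
    \int[leb]_(x in cube a l) (F x `^ t * G x `^ (1 - t))%:E <=
    ((mean F a l * l ^+ n) `^ t * (mean G a l * l ^+ n) `^ (1 - t))%:E.
  move=> l0; rewrite EFinM -!poweR_EFin -!integral_mean//.
  rewrite integral_mkcond [X in _ <= X `^ _ * _]integral_mkcond.
  rewrite [X in _ <= _ * X `^ _]integral_mkcond.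
  apply: le_trans (hoelder_geo leb t01 _ _ _ _); last 4 first.
  - exact: measurable_restrictE.
  - exact: measurable_restrictE.
  - by apply: erestrict_ge0 => x _; rewrite lee_fin ltW.
  - by apply: erestrict_ge0 => x _; rewrite lee_fin ltW.
  apply: le_integralT.
    by apply: erestrict_ge0 => x _; rewrite lee_fin ltW.
  move=> x; rewrite !patchE; case: ifPn => //= _.
  by rewrite ?lee_fin mulr_ge0 ?powR_ge0.
have nH : nice (fun x => F x `^ t * G x `^ (1 - t))%R.
  by split=> // a l l0; apply: le_lt_trans (main a l l0) _; exact: ltry.
split=> // a l l0; rewrite -(@ler_pM2r _ (l ^+ n)) ?exprn_gt0//.
rewrite -lee_fin -integral_mean//; apply: le_trans (main a l l0) _.
have ln0 : (0 < l ^+ n)%R by rewrite exprn_gt0.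
have mF0 := ltW (mean_gt0 a nF l0); have mG0 := ltW (mean_gt0 a nG l0).
rewrite lee_fin !powRM ?(ltW ln0)// mulrACA -powRDpos//.
by rewrite [(t + _)%R]addrC subrK powRr1// ltW.
Qed.

Lemma mean_powR F t : (0 < t <= 1)%R -> nice F ->
  nice (fun x => F x `^ t)%R /\
  (forall a l, (0 < l)%R -> mean (fun x => F x `^ t)%R a l <= mean F a l `^ t)%R.
Proof.
move=> /andP[t0]; rewrite le_eqVlt => /predU1P[->|t1] nF.
  have [F0 mF iF] := nF.
  have -> : (fun x => F x `^ 1)%R = F.
    by apply/funext => x; rewrite powRr1// ltW.
  by split=> // a l l0; rewrite powRr1// ltW// mean_gt0.
have [||nH hH] := @mean_hoelder F (cst 1%R) t _ nF.
- by rewrite t0.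
- exact: nice_cst.
have E : (fun x => F x `^ t * cst 1 x `^ (1 - t))%R = (fun x => F x `^ t)%R.
  by apply/funext => x; rewrite powR1 mulr1.
rewrite E in nH hH; split=> // a l l0.
by have := hH a l l0; rewrite mean_cst// powR1 mulr1.
Qed.

(** Jensen's inequality for a negative power, read off from Hoelder's inequality for
    [1 = F ^ t * (F ^ (-b)) ^ (1 - t)] with [t = b / (1 + b)]. *)
Lemma mean_powRN F (b : R) a l : (0 < b)%R -> nice F ->
  nice (fun x => F x `^ (- b))%R -> (0 < l)%R ->
  (mean F a l `^ (- b) <= mean (fun x => F x `^ (- b))%R a l)%R.
Proof.
move=> b0 nF nFb l0; have [F0 mF iF] := nF.
have [t [t01 tE tb]] : exists t : R,
    [/\ (0 < t < 1)%R, (1 - t = (1 + b)^-1)%R & (t * (1 + b) = b)%R].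
  have b1 : (0 < 1 + b)%R by rewrite addr_gt0.
  exists (b / (1 + b))%R; rewrite divfK ?gt_eqF// divr_gt0//=; split=> //.
    by rewrite ltr_pdivrMr// mul1r ltrDr.
  by field; rewrite gt_eqF.
have [_ /(_ a l l0)] := mean_hoelder t01 nF nFb.
have -> : (fun x => F x `^ t * (F x `^ (- b)) `^ (1 - t))%R = cst 1%R.
  apply/funext => x; rewrite -powRrM -powRDpos// /cst -[RHS](powRr0 (F x)).
  by congr (_ `^ _)%R; move: tb; lra.
have mF0 := mean_gt0 a nF l0; have mFb0 := mean_gt0 a nFb l0.
by rewrite mean_cst// tE; exact: powR_conj_le.
Qed.

(** The exceptional null set may depend on the cube: cubes are considered one at a time and the
    maximal function stays out of the definition. The constant is a parameter because all later
    bounds have to be uniform in it. *)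
Definition A1_weight (C : R) w : Prop := nice w /\
  forall a l, (0 < l)%R ->
    \forall x \ae leb, cube a l x -> (mean w a l <= C * w x)%R.

Lemma A1_weight_cst : A1_weight 1 (cst 1%R).
Proof.
split; first exact: nice_cst.
by move=> a l l0; apply: aeW => x _; rewrite mean_cst// mulr1.
Qed.

Lemma A1_weight_le (C C' : R) w : (C <= C')%R -> A1_weight C w -> A1_weight C' w.
Proof.
move=> CC' [nw hw]; split=> // a l l0; apply: filterS (hw a l l0) => x h ax.
apply: (le_trans (h ax)); rewrite ler_wpM2r//; have [w0 _ _] := nw.
exact: ltW.
Qed.

Section factored_weight.
Variables (A B : Rn R n -> R) (C t b : R).
Hypotheses (hA : A1_weight C A) (hB : A1_weight C B).
Hypotheses (C0 : (0 < C)%R) (t01 : (0 < t <= 1)%R) (b0 : (0 < b)%R).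

Let W x := (A x `^ t * B x `^ (- b))%R.

Let W0 x : (0 < W x)%R.
Proof. by case: hA hB => -[A0 _ _] _ [[B0 _ _] _]; rewrite mulr_gt0 ?powR_gt0. Qed.

Let mW : measurable_fun setT W.
Proof.
case: hA hB => -[_ mA _] _ [[_ mB _] _].
by apply: measurable_funM; exact: measurable_fun_powR.
Qed.

Let B_lower a l : (0 < l)%R -> \forall x \ae leb, cube a l x ->
  (B x `^ (- b) <= C `^ b * mean B a l `^ (- b))%R.
Proof.
move=> l0; have [nB hB1] := hB; apply: filterS (hB1 a l l0) => x h ax.
have mB0 := mean_gt0 a nB l0.
have -> : (C `^ b * mean B a l `^ (- b) = (mean B a l / C) `^ (- b))%R.
  rewrite powRM ?(ltW mB0) ?invr_ge0 ?(ltW C0)// powRV ?(ltW C0)// opprK.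
  by rewrite mulrC.
apply: ge_powRN; [exact: ltW|by rewrite divr_gt0|].
by rewrite ler_pdivrMr// mulrC h.
Qed.

Lemma nice_factored : nice W.
Proof.
have [nA _] := hA; have [nB _] := hB; have [A0 mA iA] := nA.
have [nAt _] := mean_powR t01 nA.
apply: nice_le => // a l l0; exists (fun x => A x `^ t)%R => //.
exists (C `^ b * mean B a l `^ (- b))%R; first by rewrite mulr_ge0 ?powR_ge0.
apply: filterS (B_lower a l0) => x h ax.
by rewrite /W mulrC ler_wpM2r ?powR_ge0// h.
Qed.

(** The A_1 condition bounds [B] from below by a multiple of its mean, so that the negative power
    comes out of the mean. Together with [mean_factored_ge] this makes the mean of [W] comparable to
    the same powers of the means of [A] and [B]. *)
Lemma mean_factored_le a l : (0 < l)%R ->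
  (mean W a l <= C `^ b * (mean A a l `^ t * mean B a l `^ (- b)))%R.
Proof.
move=> l0; have [nA _] := hA; have [nB _] := hB; have [A0 mA iA] := nA.
have [nAt hAt] := mean_powR t01 nA.
apply: (@le_trans _ _ ((C `^ b * mean B a l `^ (- b)) *
    mean (fun x => A x `^ t) a l))%R.
  apply: mean_le => //; [exact: nice_factored|by rewrite mulr_ge0 ?powR_ge0|].
  apply: filterS (B_lower a l0) => x h ax.
  by rewrite /W mulrC ler_wpM2r ?powR_ge0// h.
rewrite -mulrA ler_wpM2l ?powR_ge0// mulrC ler_wpM2r ?powR_ge0//.
exact: hAt.
Qed.

(** Here the A_1 condition is used for [A], and Jensen's inequality bounds the mean of the negative
    power of [B] from below. *)
Lemma mean_factored_ge a l : (0 < l)%R ->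
  (mean A a l `^ t * mean B a l `^ (- b) <= C `^ t * mean W a l)%R.
Proof.
move=> l0; have [nA hA1] := hA; have [nB hB1] := hB; have [A0 mA iA] := nA.
have [B0 mB iB] := nB; have /andP[t0 t1] := t01.
have mA0 := mean_gt0 a nA l0.
have nBb : nice (fun x => B x `^ (- b))%R.
  apply: nice_bounded; [by move=> x; rewrite powR_gt0|exact: measurable_fun_powR|].
  move=> a' l' l'0; exists (C `^ b * mean B a' l' `^ (- b))%R.
    by rewrite mulr_ge0 ?powR_ge0.
  exact: B_lower.
apply: (@le_trans _ _ (mean A a l `^ t * mean (fun x => B x `^ (- b)) a l))%R.
  by rewrite ler_wpM2l ?powR_ge0// mean_powRN.
have At0 : (0 < mean A a l `^ t)%R by rewrite powR_gt0.
rewrite -ler_pdivlMl// mulrA.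
apply: mean_le => //; [exact: nice_factored|by rewrite mulr_ge0 ?invr_ge0 ?powR_ge0|].
apply: filterS (hA1 a l l0) => x h ax.
rewrite /W mulrA -[leLHS]mul1r ler_wpM2r ?powR_ge0// -mulrA ler_pdivlMl// mulr1.
by rewrite -powRM ?(ltW C0) ?(ltW (A0 x))// le_powR ?(ltW t0) ?(ltW mA0)// h.
Qed.

End factored_weight.

Definition Ap_weight (p K : R) w : Prop :=
  [/\ nice w, nice (fun x => w x `^ (- (p - 1)^-1))%R &
      forall a l, (0 < l)%R -> (mean w a l *
        mean (fun x => w x `^ (- (p - 1)^-1)) a l `^ (p - 1) <= K)%R].

(** The easy half of the factorization of A_p weights: for [p = 1 + b] the dual weight is
    [B * A ^ (- (t / b))], again of factored form, so that [mean_factored_le] bounds both means and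
    the powers of the means cancel. *)
Lemma Ap_factored (A B : Rn R n -> R) (C t b : R) :
  A1_weight C A -> A1_weight C B -> (0 < C)%R -> (0 < t <= 1)%R -> (0 < b)%R ->
  Ap_weight (1 + b) (C `^ b * C `^ t) (fun x => A x `^ t * B x `^ (- b))%R.
Proof.
move=> hA hB C0 t01 b0; have [nA hA1] := hA; have [nB hB1] := hB.
have [A0 mA iA] := nA; have [B0 mB iB] := nB; have /andP[t0 t1] := t01.
have E : (fun x => (A x `^ t * B x `^ (- b)) `^ (- (1 + b - 1)^-1))%R =
    (fun x => B x `^ 1 * A x `^ (- (t / b)))%R.
  apply/funext => x; rewrite powRM ?powR_ge0// -!powRrM [RHS]mulrC.
  have -> : (1 + b - 1 = b)%R by ring.
  by congr (_ `^ _ * _ `^ _)%R; field; rewrite gt_eqF.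
have tb0 : (0 < t / b)%R by rewrite divr_gt0.
have i1 : (0 < (1 : R) <= 1)%R by rewrite ltr01 lexx.
split; first exact: (nice_factored hA hB).
  by rewrite E; apply: (nice_factored hB hA).
move=> a l l0; rewrite E.
have -> : (1 + b - 1 = b)%R by ring.
have mA0 := mean_gt0 a nA l0; have mB0 := mean_gt0 a nB l0.
have h1 := mean_factored_le hA hB C0 t01 b0 a l0.
have h2 := mean_factored_le hB hA C0 i1 tb0 a l0.
have s0 : (0 <= mean (fun x => B x `^ 1 * A x `^ (- (t / b)))%R a l)%R.
  by apply: mean_ge0 => [x|]; rewrite ?mulr_ge0 ?powR_ge0// ltW.
have h2' := le_powR (ltW b0) s0 h2.
apply: le_trans (ler_pM _ (powR_ge0 _ _) h1 h2') _.
  by apply: mean_ge0 => [x|]; rewrite ?mulr_ge0 ?powR_ge0// ltW.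
rewrite !powRM ?powR_ge0 ?mulr_ge0 ?powR_ge0// -!powRrM mul1r mulNr divfK ?gt_eqF//.
rewrite mulrACA [X in (_ * X)%R](_ : _ = 1%R) ?mulr1//.
rewrite !powRN; field.
by rewrite !gt_eqF ?powR_gt0.
Qed.

(** The A_p condition on the tripled cube bounds the mean of [w] there by a negative power of the
    mean of [s], which drops by at most [3 ^+ n] from the cube to its triple; Jensen's inequality
    returns to [w] on the cube. A general [q] lets [w] and [s] exchange roles. *)
Lemma Ap_doubling (w s : Rn R n -> R) (q K : R) a l : nice w -> nice s ->
  (0 < q)%R -> (forall x, w x = s x `^ (- q))%R -> (0 < l)%R ->
  (forall a l, (0 < l)%R -> mean w a l * mean s a l `^ q <= K)%R ->
  \int[leb]_(x in cube (shift_tuple a (- l)) (3 * l)) (w x)%:E <=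
  (K * (3 ^+ n) `^ q * 3 ^+ n * (mean w a l * l ^+ n))%:E.
Proof.
move=> nw ns q0 wE l0 hK; have [s0 ms is_] := ns.
have l30 : (0 < 3 * l)%R by rewrite mulr_gt0.
set a3 := shift_tuple a _.
have ln0 : (0 < l ^+ n)%R by rewrite exprn_gt0.
have sub : cube a l `<=` cube a3 (3 * l).
  move=> x ax i; have := ax i; rewrite tnth_mktuple => /andP[]; lra.
rewrite integral_mean// lee_fin exprMn.
have msE : (mean s a l <= 3 ^+ n * mean s a3 (3 * l))%R.
  rewrite -(@ler_pM2r _ (l ^+ n))// -lee_fin -integral_mean//.
  apply: (@le_trans _ _ (\int[leb]_(x in cube a3 (3 * l)) (s x)%:E)).
    by apply: le_integral_subset => // x; rewrite lee_fin ltW.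
  by rewrite integral_mean// lee_fin exprMn mulrCA mulrA.
have m30 := mean_gt0 a3 ns l30; have m0 := mean_gt0 a ns l0.
have K0 : (0 <= K)%R.
  by rewrite (le_trans _ (hK a l l0))// mulr_ge0 ?powR_ge0// ltW// mean_gt0.
have wE' : w = (fun x => s x `^ (- q))%R by exact/funext.
have hw : (mean s a l `^ (- q) <= mean w a l)%R.
  by rewrite wE'; apply: mean_powRN => //; rewrite -wE'.
have h3 : (mean w a3 (3 * l) <= K * mean s a3 (3 * l) `^ (- q))%R.
  by rewrite powRN ler_pdivlMr ?powR_gt0// hK.
rewrite [leRHS](_ : _ = K * ((3 ^+ n) `^ q * mean w a l) * (3 ^+ n * l ^+ n))%R;
  last by ring.
rewrite ler_wpM2r ?mulr_ge0 ?exprn_ge0 ?(ltW l0)//.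
apply: (le_trans h3); rewrite ler_wpM2l//.
apply: (@le_trans _ _ ((3 ^+ n) `^ q * mean s a l `^ (- q)))%R; last first.
  by rewrite ler_wpM2l ?powR_ge0.
rewrite -{1}[(mean s a3 _)%R](@mulKf _ (3 ^+ n)%R); last first.
  by rewrite gt_eqF// exprn_gt0.
rewrite powRM ?invr_ge0 ?exprn_ge0 ?mulr_ge0 ?exprn_ge0 ?(ltW m30)//.
rewrite powRV ?exprn_ge0// opprK ler_wpM2l ?powR_ge0//.
by apply: ge_powRN => //; exact: ltW.
Qed.

Theorem muckenhoupt (p K : R) : (1 < p)%R -> exists2 C : R, (0 <= C)%R &
  forall w, Ap_weight p K w ->
  forall f : Rn R n -> \bar R, measurable_fun setT f -> (forall x, 0 <= f x) ->
  \int[leb]_x (maximal f x `^ p * (w x)%:E) <=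
  C%:E * \int[leb]_x (f x `^ p * (w x)%:E).
Proof.
move=> p1; have q0 : (0 < p - 1)%R by rewrite subr_gt0.
have qV0 : (0 < (p - 1)^-1)%R by rewrite invr_gt0.
pose K' := Num.max K 0%R.
have K'0 : (0 <= K')%R by rewrite le_max lexx orbT.
have KK' : (K <= K')%R by rewrite le_max lexx.
(* Doubling constants of [w] and of the dual weight, which satisfies the dual A_p condition with
   exponent [(p - 1)^-1] and the corresponding power of [K']. *)
pose D1 := (K' * (3 ^+ n) `^ (p - 1) * 3 ^+ n)%R.
pose D2 := (K' `^ (p - 1)^-1 * (3 ^+ n) `^ (p - 1)^-1 * 3 ^+ n)%R.
have D10 : (0 <= D1)%R by rewrite !mulr_ge0 ?powR_ge0 ?exprn_ge0.
have D20 : (0 <= D2)%R by rewrite !mulr_ge0 ?powR_ge0 ?exprn_ge0.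
pose D := (D1 + D2)%R; have D0 : (0 <= D)%R by rewrite addr_ge0.
have p'1 : (1 < p / (p - 1))%R by rewrite ltr_pdivlMr// mul1r gtrBl.
exists (K' `^ (p / (p - 1)) *
    (strong_const (p / (p - 1)) D * strong_const p D))%R.
  by apply: mulr_ge0; rewrite ?powR_ge0//; apply: mulr_ge0; exact: strong_const_ge0.
move=> w [nw ns hK] f mf f0; have [w0 mw iw] := nw.
pose s := (fun x => w x `^ (- (p - 1)^-1))%R; rewrite -/s in ns hK.
have [s0 ms is_] := ns.
have hK' a l : (0 < l)%R -> (mean w a l * mean s a l `^ (p - 1) <= K')%R.
  by move=> l0; exact: le_trans (hK a l l0) KK'.
have wE x : (w x = s x `^ (- (p - 1)))%R.
  by rewrite /s -powRrM mulrNN mulVf ?gt_eqF// powRr1 ?ltW.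
have hK2 a l : (0 < l)%R ->
    (mean s a l * mean w a l `^ (p - 1)^-1 <= K' `^ (p - 1)^-1)%R.
  move=> l0; have m0 := mean_gt0 a nw l0; have m1 := mean_gt0 a ns l0.
  have ms0 : (0 <= mean w a l * mean s a l `^ (p - 1))%R.
    by rewrite mulr_ge0 ?powR_ge0// ltW.
  have := le_powR (ltW qV0) ms0 (hK' a l l0).
  rewrite (@powRM _ (mean w a l)); [|exact: ltW|exact: powR_ge0].
  by rewrite -(powRrM (mean s a l)) mulfV ?lt0r_neq0 ?(powRr1 (ltW m1)) 1?mulrC.
rewrite (_ : (fun x => maximal f x `^ p * (w x)%:E) = (fun x =>
    maxop leb (@rcube R n) (fun k => rside R n k ^+ n)%R f x `^ p * (w x)%:E)).
  apply: (@muckenhoupt_bound _ _ _ leb (@rcube R n) (@rcube3 R n) _ _ _ w s _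
    (fun k => mean w (rcorner R n k) (rside R n k) * rside R n k ^+ n)%R
    (fun k => mean s (rcorner R n k) (rside R n k) * rside R n k ^+ n)%R)
    => //; try (move=> k; have k0 := rside_gt0 R n k;
      have kn0 : (0 < rside R n k ^+ n)%R by rewrite exprn_gt0).
  - exact: measurable_rcube.
  - exact: measurable_rcube3.
  - exact: vitali_rcube.
  - by [].
  - by rewrite mulr_gt0// mean_gt0.
  - by rewrite mulr_gt0// mean_gt0.
  - exact: leb_rcube.
  - exact: integral_mean.
  - exact: integral_mean.
  - apply: le_trans (Ap_doubling _ nw ns q0 wE k0 hK') _.
    by rewrite lee_fin ler_wpM2r ?lerDl// mulr_ge0 ?ltW// mean_gt0.
  - apply: le_trans (Ap_doubling _ ns nw qV0 _ k0 hK2) _ => //.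
    by rewrite lee_fin ler_wpM2r ?lerDr// mulr_ge0 ?ltW// mean_gt0.
  - have m1 := mean_gt0 (rcorner R n k) ns k0.
    rewrite powRM ?(ltW m1) ?(ltW kn0)// mulrACA.
    rewrite mulr_powRB1 ?(ltW kn0)// ?(lt_trans ltr01)//.
    by rewrite ler_wpM2r ?powR_ge0// hK'.
by apply/funext => x; rewrite maximal_maxop.
Qed.

End means.

(** * The Rubio de Francia algorithm *)

Section maximal_function.
Context (R : realType) (n : nat).
Implicit Types (a x : Rn R n) (l : R) (f h : Rn R n -> \bar R).
Local Notation leb := (lebesgue_Rn R n).

Let rn0 k : (0 < rside R n k ^+ n)%R.
Proof. by rewrite exprn_gt0// rside_gt0. Qed.

Lemma measurable_maximal f : (forall x, 0 <= f x) ->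
  measurable_fun setT (maximal f).
Proof.
move=> f0; rewrite (_ : maximal f = maxop leb (@rcube R n)
  (fun k => rside R n k ^+ n)%R f); first by apply: measurable_maxop; exact: measurable_rcube.
by apply/funext => x; rewrite maximal_maxop.
Qed.

Lemma maximal_ge0 f x : (forall x, 0 <= f x) -> 0 <= maximal f x.
Proof. by move=> f0; rewrite maximal_maxop//; exact: maxop_ge0. Qed.

Lemma maximal_ge f a l x : (forall x, 0 <= f x) -> (0 < l)%R -> cube a l x ->
  \int[leb]_(y in cube a l) f y <= (l ^+ n)%:E * maximal f x.
Proof.
move=> f0 l0 ax; rewrite -lee_pdivrMl ?exprn_gt0//.
apply: ereal_sup_ubound; exists (cube a l); first by split=> //; exists a, l.
rewrite /avg leb_cube ?(ltW l0)// muleC; congr (_ * _).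
by rewrite inver gt_eqF// exprn_gt0.
Qed.

Lemma maximal_le f x (K : \bar R) : (forall x, 0 <= f x) -> 0 <= K ->
  (forall a l, (0 < l)%R -> cube a l x ->
    \int[leb]_(y in cube a l) f y <= (l ^+ n)%:E * K) ->
  maximal f x <= K.
Proof.
move=> f0 K0 h; rewrite maximal_maxop//; apply: maxop_le => // k kx.
by rewrite lee_pdivrMl//; apply: h => //; exact: rside_gt0.
Qed.

Definition centered_cube x (N : nat) := cube (shift_tuple x (- N.+1%:R)) (2 * N.+1%:R).

Lemma centered_cubeP x y N :
  centered_cube x N y <-> forall i, (`|tnth y i - tnth x i| <= N.+1%:R)%R.
Proof.
by split=> h i; have := h i; rewrite tnth_mktuple ler_norml => /andP[h1 h2];
  apply/andP; split; lra.
Qed.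

Lemma bigcup_centered_cube x : \bigcup_N centered_cube x N = setT.
Proof.
apply/seteqP; split=> // y _.
pose M := (\sum_(i < n) `|tnth y i - tnth x i|)%R.
have M0 : (0 <= M)%R by apply: sumr_ge0.
exists (Num.bound M) => //; apply/centered_cubeP => i.
apply: (@le_trans _ _ M).
  by rewrite /M (bigD1 i)//= lerDl; apply: sumr_ge0.
apply: (le_trans (ltW (archi_boundP M0))).
by rewrite ler_nat.
Qed.

Lemma nd_centered_cube x : nondecreasing_seq (centered_cube x).
Proof.
move=> i j ij; apply/subsetPset => y /centered_cubeP h; apply/centered_cubeP => k.
by apply: le_trans (h k) _; rewrite ler_nat ltnS.
Qed.

(** The cubes centred at [x] exhaust the space, and [f] has integral zero over each of them. This
    makes the majorants of the Rubio de Francia algorithm positive everywhere. *)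
Lemma maximal_eq0 f x : measurable_fun setT f -> (forall y, 0 <= f y) ->
  maximal f x = 0 -> \int[leb]_y f y = 0.
Proof.
move=> mf f0 Mx; apply/eqP; rewrite eq_le integral_ge0// andbT.
rewrite -(bigcup_centered_cube x); apply: integral_bigcup_ub => //.
- exact: nd_centered_cube.
- by move=> N; exact: measurable_cube.
move=> N; have N0 : (0 < 2 * N.+1%:R :> R)%R by rewrite mulr_gt0.
rewrite -[leRHS](mule0 ((2 * N.+1%:R) ^+ n)%:E) -Mx.
apply: maximal_ge => //; apply/centered_cubeP => i.
by rewrite subrr normr0.
Qed.

End maximal_function.

Section dyadic_convexity.
Context (R : realType).

Lemma convex_half_powR (p a b : R) : (1 <= p)%R -> (0 <= a)%R -> (0 <= b)%R ->
  ((2^-1 * a + 2^-1 * b) `^ p <= 2^-1 * a `^ p + 2^-1 * b `^ p)%R.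
Proof.
move=> p1 a0 b0; rewrite {2 4}(_ : 2^-1 = 1 - 2^-1)%R; last first.
  by rewrite {2}(splitr 1%R) div1r addrK.
by apply: (convex_powR p1 (Itv01 _ _)) => //=;
  rewrite ?inE/= ?in_itv/= ?andbT ?invr_ge0// invf_le1 ?ler1n.
Qed.

Lemma convex_half (p : R) (a b : \bar R) : (1 <= p)%R -> 0 <= a -> 0 <= b ->
  ((2^-1)%:E * a + (2^-1)%:E * b) `^ p <=
  (2^-1)%:E * a `^ p + (2^-1)%:E * b `^ p.
Proof.
move=> p1; have pN : (p != 0)%R by rewrite gt_eqF// (lt_le_trans _ p1).
have h0 : 0 < (2^-1)%:E :> \bar R by rewrite lte_fin invr_gt0.
have hp0 (c : \bar R) : (2^-1)%:E * c `^ p != -oo.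
  by rewrite gt_eqF// (lt_le_trans (ltNyr 0))// mule_ge0 ?poweR_ge0// ltW.
case: a => [a| |]//; last first.
  move=> _ b0; rewrite [leRHS](_ : _ = +oo) ?leey//.
  by rewrite poweRyr// gt0_muley// addye.
case: b => [b| |]//; last first.
  move=> a0 _; rewrite [leRHS](_ : _ = +oo) ?leey//.
  by rewrite poweRyr// gt0_muley// addey.
rewrite !lee_fin => a0 b0.
by have := convex_half_powR p1 a0 b0.
Qed.

(** Repeated halving: the sum is the midpoint of its first entry and of a sum of the same form. This
    convexity replaces Minkowski's inequality for the series of the algorithm. *)
Lemma convex_dyadic_sum (p : R) (b : nat -> \bar R) N : (1 <= p)%R ->
  (forall k, 0 <= b k) ->
  (\sum_(k < N) (2^-1 ^+ k.+1)%:E * b k) `^ p <=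
  \sum_(k < N) (2^-1 ^+ k.+1)%:E * b k `^ p.
Proof.
move=> p1; have p0 : (0 < p)%R by rewrite (lt_le_trans _ p1).
elim: N b => [|N IH] b b0.
  by rewrite !big_ord0 poweR0r// gt_eqF.
have c0 k : 0 <= (2^-1 ^+ k)%:E :> \bar R by rewrite lee_fin exprn_ge0.
have E (c : nat -> \bar R) : (forall k, 0 <= c k) ->
    \sum_(k < N.+1) (2^-1 ^+ k.+1)%:E * c k =
    (2^-1)%:E * c 0%N + (2^-1)%:E * \sum_(k < N) (2^-1 ^+ k.+1)%:E * c k.+1.
  move=> c0'; rewrite big_ord_recl/= expr1; congr (_ + _).
  rewrite ge0_sume_distrr; last by move=> i _; rewrite mule_ge0.
  by apply: eq_bigr => i _; rewrite muleA -EFinM -exprS.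
rewrite (E b b0) (E (fun k => b k `^ p)); last first.
  by move=> k; exact: poweR_ge0.
apply: le_trans (convex_half p1 _ _) _ => //.
  by apply: sume_ge0 => i _; rewrite mule_ge0.
apply: leeD2l; apply: lee_wpmul2l => //.
exact: (IH (fun k => b k.+1)).
Qed.

Lemma convex_dyadic_series (p : R) (b : nat -> \bar R) : (1 <= p)%R ->
  (forall k, 0 <= b k) ->
  (\sum_(0 <= k <oo) (2^-1 ^+ k.+1)%:E * b k) `^ p <=
  \sum_(0 <= k <oo) (2^-1 ^+ k.+1)%:E * b k `^ p.
Proof.
move=> p1 b0; have p0 : (0 < p)%R by rewrite (lt_le_trans _ p1).
have c0 k : 0 <= (2^-1 ^+ k)%:E :> \bar R by rewrite lee_fin exprn_ge0.
apply: le_poweR_rootl => //.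
- by apply: nneseries_ge0 => k _ _; rewrite mule_ge0.
- by apply: nneseries_ge0 => k _ _; rewrite mule_ge0 ?poweR_ge0.
apply: lime_le; first by apply: is_cvg_nneseries => k _ _; rewrite mule_ge0.
apply: nearW => N; rewrite big_mkord; apply: le_poweR_rootr => //.
- by apply: sume_ge0 => i _; rewrite mule_ge0.
- by apply: nneseries_ge0 => k _ _; rewrite mule_ge0 ?poweR_ge0.
apply: le_trans (convex_dyadic_sum N p1 b0) _.
rewrite -(big_mkord xpredT (fun k => (2^-1 ^+ k.+1)%:E * b k `^ p)).
by apply: nneseries_lim_ge => k _ _; rewrite mule_ge0 ?poweR_ge0.
Qed.

Lemma dyadic_series_le (I : \bar R) (u : nat -> \bar R) : 0 <= I ->
  (forall k, 0 <= u k) -> (forall k, u k <= I) ->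
  \sum_(0 <= k <oo) (2^-1 ^+ k.+1)%:E * u k <= I.
Proof.
move=> I0 u0 uI.
have c0 k : 0 <= (2^-1 ^+ k)%:E :> \bar R by rewrite lee_fin exprn_ge0.
apply: lime_le; first by apply: is_cvg_nneseries => k _ _; rewrite mule_ge0.
apply: nearW => N; apply: (@le_trans _ _ (\sum_(0 <= k < N) (2^-1 ^+ k.+1)%:E * I)).
  by apply: lee_sum => k _; apply: lee_wpmul2l.
rewrite -ge0_sume_distrl// sumEFin -[leRHS]mul1e; apply: lee_wpmul2r => //; rewrite lee_fin.
suff -> : (\sum_(0 <= k < N) 2^-1 ^+ k.+1 = 1 - 2^-1 ^+ N :> R)%R.
  by rewrite gerBl exprn_ge0.
elim: N => [|N IH]; first by rewrite big_geq// expr0 subrr.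
by rewrite big_nat_recr//= IH exprS; field.
Qed.

End dyadic_convexity.

Section rubio_de_francia.
Context (R : realType) (n : nat).
Local Notation leb := (lebesgue_Rn R n).
Implicit Types (p K : R) (w : Rn R n -> R) (f h : Rn R n -> \bar R).

(** The power of [K] makes [K] itself a bound for the operator norm, so that one [K] can serve
    several exponents and weights. *)
Definition maximal_bounded p K w : Prop :=
  forall f, measurable_fun setT f -> (forall x, 0 <= f x) ->
  \int[leb]_x (maximal f x `^ p * (w x)%:E) <=
  (K `^ p)%:E * \int[leb]_x (f x `^ p * (w x)%:E).

Definition rdf_iter K h (k : nat) : Rn R n -> \bar R :=
  iter k (fun f x => (K^-1)%:E * maximal f x) h.

Definition rdf_series K h x := \sum_(0 <= k <oo) (2^-1 ^+ k)%:E * rdf_iter K h k x.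

Variables (K : R) (h : Rn R n -> \bar R).
Hypotheses (K0 : (0 < K)%R) (mh : measurable_fun setT h) (h0 : forall x, 0 <= h x).

Let c0 k : 0 <= (2^-1 ^+ k)%:E :> \bar R.
Proof. by rewrite lee_fin exprn_ge0. Qed.

Let KV0 : 0 <= (K^-1)%:E.
Proof. by rewrite lee_fin invr_ge0 ltW. Qed.

Lemma rdf_iter_ge0 k x : 0 <= rdf_iter K h k x.
Proof.
by elim: k x => [|k IH] x //=; rewrite mule_ge0// maximal_ge0.
Qed.

Lemma measurable_rdf_iter k : measurable_fun setT (rdf_iter K h k).
Proof.
elim: k => [//|k IH]; apply: measurable_funeM; apply: measurable_maximal.
exact: rdf_iter_ge0.
Qed.

Let term_ge0 k x : 0 <= (2^-1 ^+ k)%:E * rdf_iter K h k x.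
Proof. by rewrite mule_ge0// rdf_iter_ge0. Qed.

Lemma rdf_series_ge0 x : 0 <= rdf_series K h x.
Proof. exact: nneseries_ge0. Qed.

Lemma measurable_rdf_series : measurable_fun setT (rdf_series K h).
Proof.
apply: ge0_emeasurable_sum => // k _.
by apply: measurable_funeM; exact: measurable_rdf_iter.
Qed.

Lemma le_rdf_series x : h x <= rdf_series K h x.
Proof.
apply: le_trans (le_nneseries_term 0 (fun k => term_ge0 k x)).
by rewrite expr0 mul1e.
Qed.

(** Monotone convergence on each cube gives countable subadditivity, and the maximal operator turns
    the term of index [k] into [2 * K] times the term of index [k + 1]. *)
Lemma maximal_rdf_series x :
  maximal (rdf_series K h) x <= (2 * K)%:E * rdf_series K h x.
Proof.
have rs0 := rdf_series_ge0.
have KK0 : (0 <= 2 * K)%R by rewrite mulr_ge0// ltW.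
apply: maximal_le => // [|a l l0 ax]; first by rewrite mule_ge0.
rewrite integral_nneseries//; last 2 first.
- exact: measurable_cube.
- by move=> k; apply: measurable_funTS; apply: measurable_funeM; exact: measurable_rdf_iter.
apply: (@le_trans _ _ (\sum_(0 <= k <oo) (l ^+ n * (2 * K))%:E *
    ((2^-1 ^+ k.+1)%:E * rdf_iter K h k.+1 x))).
  apply: lee_nneseries => [k _ _|k _]; first by apply: integral_ge0 => y _.
  rewrite ge0_integralZl_EFin//; last 3 first.
  - exact: measurable_cube.
  - by move=> y _; exact: rdf_iter_ge0.
  - by apply: measurable_funTS; exact: measurable_rdf_iter.
  apply: (@le_trans _ _ ((2^-1 ^+ k)%:E * ((l ^+ n)%:E * maximal (rdf_iter K h k) x))).
    by apply: lee_wpmul2l => //; apply: maximal_ge => //; exact: rdf_iter_ge0.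
  rewrite /= !muleA; apply: lee_wpmul2r.
    by apply: maximal_ge0; exact: rdf_iter_ge0.
  rewrite -!EFinM lee_fin; apply: eq_le_refl; rewrite exprS; field.
  by rewrite gt_eqF.
rewrite nneseriesZl; last by move=> k _.
rewrite EFinM -muleA; apply: lee_wpmul2l; first by rewrite lee_fin exprn_ge0// ltW.
apply: lee_wpmul2l => //.
apply: lime_le; first by apply: is_cvg_nneseries.
apply: nearW => N; apply: le_trans (nneseries_lim_ge N.+1 _) => //.
by rewrite big_nat_recl// leeDr.
Qed.

Lemma rdf_iter_norm p w k : (0 < p)%R -> measurable_fun setT w ->
  (forall x, (0 <= w x)%R) -> maximal_bounded p K w ->
  \int[leb]_x (rdf_iter K h k x `^ p * (w x)%:E) <=
  \int[leb]_x (h x `^ p * (w x)%:E).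
Proof.
move=> p0 mw w0 hK; elim: k => [//|k]; apply: le_trans.
have mx0 x : 0 <= maximal (rdf_iter K h k) x.
  by apply: maximal_ge0; exact: rdf_iter_ge0.
rewrite (_ : (fun x => rdf_iter K h k.+1 x `^ p * (w x)%:E) = (fun x =>
    (K^-1 `^ p)%:E * (maximal (rdf_iter K h k) x `^ p * (w x)%:E))); last first.
  by apply/funext => x; rewrite /= poweRM// muleA.
rewrite ge0_integralZl_EFin ?powR_ge0//; last 2 first.
- by move=> x _; rewrite mule_ge0 ?poweR_ge0// lee_fin.
- apply: emeasurable_funM; last exact/measurable_EFinP.
  apply: measurableT_comp (measurable_poweR _) _; apply: measurable_maximal.
  exact: rdf_iter_ge0.
apply: (@le_trans _ _ ((K^-1 `^ p)%:E * ((K `^ p)%:E *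
    \int[leb]_x (rdf_iter K h k x `^ p * (w x)%:E)))).
  apply: lee_wpmul2l; first by rewrite lee_fin powR_ge0.
  by apply: hK; [exact: measurable_rdf_iter|exact: rdf_iter_ge0].
rewrite muleA -EFinM -powRM ?invr_ge0 ?(ltW K0)// mulVf ?gt_eqF// powR1 mul1e.
exact: lexx.
Qed.

Lemma rdf_series_norm p w : (1 <= p)%R -> measurable_fun setT w ->
  (forall x, (0 <= w x)%R) -> maximal_bounded p K w ->
  \int[leb]_x (rdf_series K h x `^ p * (w x)%:E) <=
  (2 `^ p)%:E * \int[leb]_x (h x `^ p * (w x)%:E).
Proof.
move=> p1 mw w0 hK; have p0 : (0 < p)%R by rewrite (lt_le_trans _ p1).
have w0' x : 0 <= (w x)%:E by rewrite lee_fin.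
pose F k x := (2^-1 ^+ k.+1)%:E * (rdf_iter K h k x `^ p * (w x)%:E).
have F0 k x : 0 <= F k x by rewrite mule_ge0// mule_ge0// poweR_ge0.
have mFk k : measurable_fun setT (fun x => rdf_iter K h k x `^ p * (w x)%:E).
  apply: emeasurable_funM; last exact/measurable_EFinP.
  by apply: measurableT_comp (measurable_poweR _) _; exact: measurable_rdf_iter.
have mF k : measurable_fun setT (F k) by exact: measurable_funeM.
apply: (@le_trans _ _ (\int[leb]_x ((2 `^ p)%:E * \sum_(0 <= k <oo) F k x))).
  apply: le_integralT => x; first by rewrite mule_ge0// poweR_ge0.
  (* The coefficients of the series have sum 2; halving them makes convexity applicable and costs
     the factor [2 ^ p]. *)
  have -> : rdf_series K h x =
      2%:E * \sum_(0 <= k <oo) (2^-1 ^+ k.+1)%:E * rdf_iter K h k x.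
    rewrite -nneseriesZl; last by move=> k _; rewrite mule_ge0// rdf_iter_ge0.
    apply: eq_eseriesr => k _; rewrite muleA -EFinM exprS mulrA.
    by rewrite mulfV ?mul1r.
  rewrite poweRM//; last first.
    by apply: nneseries_ge0 => k _ _; rewrite mule_ge0// rdf_iter_ge0.
  rewrite -muleA; apply: lee_wpmul2l; first by rewrite lee_fin powR_ge0.
  rewrite [leRHS](_ : _ = (\sum_(0 <= k <oo) (2^-1 ^+ k.+1)%:E *
      rdf_iter K h k x `^ p) * (w x)%:E).
    apply: lee_wpmul2r => //; apply: convex_dyadic_series => // k.
    exact: rdf_iter_ge0.
  rewrite -ge0_nneseriesZr//; last by move=> k; rewrite mule_ge0// poweR_ge0.
  by apply: eq_eseriesr => k _; rewrite /F muleA.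
rewrite ge0_integralZl_EFin ?powR_ge0//; last 2 first.
- by move=> x _; exact: nneseries_ge0.
- exact: ge0_emeasurable_sum.
apply: lee_wpmul2l; first by rewrite lee_fin powR_ge0.
rewrite integral_nneseries// (eq_eseriesr (g := fun k => (2^-1 ^+ k.+1)%:E *
  \int[leb]_x (rdf_iter K h k x `^ p * (w x)%:E))).
  apply: dyadic_series_le.
  - by apply: integral_ge0 => x _; rewrite mule_ge0// poweR_ge0.
  - by move=> k; apply: integral_ge0 => x _; rewrite mule_ge0// poweR_ge0.
  - by move=> k; exact: rdf_iter_norm.
move=> k _; rewrite ge0_integralZl_EFin// ?exprn_ge0//.
by move=> x _; rewrite mule_ge0// poweR_ge0.
Qed.

Lemma integral_lty_ae f : measurable_fun setT f -> (forall x, 0 <= f x) ->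
  \int[leb]_x f x < +oo -> \forall x \ae leb, f x < +oo.
Proof.
move=> mf f0 fy; have : leb.-integrable setT f.
  apply/integrableP; split=> //.
  by rewrite (eq_integral f)// => x _; rewrite gee0_abs.
move=> /(integrable_ae measurableT); apply: filterS => x /(_ Logic.I).
by rewrite ge0_fin_numE.
Qed.

(** The series depends on [K] and [h] but not on an exponent or a weight, so one majorant serves
    both norms. That the first norm of [h] is positive and finite makes the majorant positive
    everywhere and finite almost everywhere. *)
Theorem rubio_de_francia (p1 p2 : R) w1 w2 : (1 <= p1)%R -> (1 <= p2)%R ->
  measurable_fun setT w1 -> measurable_fun setT w2 ->
  (forall x, (0 < w1 x)%R) -> (forall x, (0 < w2 x)%R) ->
  maximal_bounded p1 K w1 -> maximal_bounded p2 K w2 ->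
  0 < \int[leb]_x (h x `^ p1 * (w1 x)%:E) < +oo ->
  exists X : Rn R n -> R, [/\ A1_weight (2 * K) X,
    \forall x \ae leb, h x <= (X x)%:E,
    \int[leb]_x ((X x)%:E `^ p1 * (w1 x)%:E) <=
      (2 `^ p1)%:E * \int[leb]_x (h x `^ p1 * (w1 x)%:E) &
    \int[leb]_x ((X x)%:E `^ p2 * (w2 x)%:E) <=
      (2 `^ p2)%:E * \int[leb]_x (h x `^ p2 * (w2 x)%:E)].
Proof.
move=> p11 p21 mw1 mw2 w10 w20 b1 b2 /andP[hpos hfin].
have p1pos : (0 < p1)%R by rewrite (lt_le_trans _ p11).
pose X0 : Rn R n -> \bar R := rdf_series K h; have X00 := rdf_series_ge0; rewrite -/X0 in X00.
have mX0 : measurable_fun setT X0 by exact: measurable_rdf_series.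
have w10' x : (0 <= w1 x)%R by exact: ltW.
have w20' x : (0 <= w2 x)%R by exact: ltW.
have N1 := rdf_series_norm p11 mw1 w10' b1.
have N2 := rdf_series_norm p21 mw2 w20' b2.
have X0fin : \forall x \ae leb, X0 x < +oo.
  have I : \int[leb]_x (X0 x `^ p1 * (w1 x)%:E) < +oo.
    by apply: (le_lt_trans N1); apply: lte_mul_pinfty => //; rewrite ?lee_fin ?powR_ge0.
  have : \forall x \ae leb, X0 x `^ p1 * (w1 x)%:E < +oo.
    apply: integral_lty_ae I => //.
      apply: emeasurable_funM; last exact/measurable_EFinP.
      exact: measurableT_comp (measurable_poweR _) mX0.
    by move=> x; rewrite mule_ge0 ?poweR_ge0// lee_fin.
  apply: filterS => x; rewrite !ltey; apply: contra => /eqP ->.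
  by rewrite (poweRyr (lt0r_neq0 p1pos)) gt0_mulye// lte_fin.
(* By the A_1 bound a zero of [X0] is a zero of its maximal function; then [X0], and [h] below it,
   would vanish almost everywhere. *)
have X0pos x : 0 < X0 x.
  rewrite lt0e X00 andbT; apply/negP => /eqP Xx0.
  have Mx : maximal X0 x = 0.
    apply/eqP; rewrite eq_le maximal_ge0// andbT.
    by rewrite (le_trans (maximal_rdf_series x))// -/X0 Xx0 mule0.
  have /integral_eq0_ae hX := maximal_eq0 mX0 X00 Mx.
  suff : \int[leb]_x (h x `^ p1 * (w1 x)%:E) <= 0 by rewrite leNgt hpos.
  rewrite -(integral0 leb setT); apply: ae_le_integral => //.
    by move=> y; rewrite mule_ge0 ?poweR_ge0// lee_fin.
  apply: filterS (hX mX0 X00) => y Xy; have hy : h y = 0.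
    by apply/eqP; rewrite eq_le h0 andbT -Xy; exact: le_rdf_series.
  by rewrite hy poweR0r ?gt_eqF// mul0e.
(* On this null set [fine] gives 0 and the indicator raises the value to 1, so that [X] is real and
   positive everywhere. *)
pose S := X0 @^-1` [set +oo].
pose X x := (fine (X0 x) + \1_S x)%R.
have XE : \forall x \ae leb, (X x)%:E = X0 x.
  apply: filterS X0fin => x Xx; rewrite /X indicE memNset; last first.
    by move=> /= E; rewrite E in Xx.
  by rewrite addr0 fineK// ge0_fin_numE.
have Xpos x : (0 < X x)%R.
  rewrite /X indicE; have [E|E] := eqVneq (X0 x) +oo.
    by rewrite mem_set// E /= add0r.
  by rewrite ltr_pwDl ?fine_gt0 ?X0pos ?ltey.
have mX : measurable_fun setT X.
  apply: measurable_funD.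
    by apply: (measurableT_comp _ mX0); exact: fine_measurable.
  apply: measurable_indic.
  by rewrite -[X in measurable X]setTI; exact: (mX0 measurableT [set +oo]).
have intXE (A : set (Rn R n)) :
    \int[leb]_(x in A) (X x)%:E = \int[leb]_(x in A) X0 x.
  rewrite integral_mkcond [RHS]integral_mkcond; apply: ae_eq_integralT.
  - by apply: erestrict_ge0 => x _; rewrite lee_fin ltW.
  - exact: erestrict_ge0.
  - by apply: filterS XE => x E; rewrite !patchE E.
have intMX a l x : (0 < l)%R -> cube a l x ->
    \int[leb]_(y in cube a l) X0 y <= (l ^+ n)%:E * ((2 * K)%:E * X0 x).
  move=> l0 ax; apply: le_trans (maximal_ge X00 l0 ax) _.
  apply: lee_wpmul2l; first by rewrite lee_fin exprn_ge0// ltW.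
  exact: maximal_rdf_series.
have nX : nice X.
  split=> // a l l0; rewrite intXE.
  (* A cube is not a null set, hence contains a point where the series is finite; the A_1 bound at
     this point makes the integral over the cube finite. *)
  have [x ax Xx] : exists2 x, cube a l x & X0 x < +oo.
    apply: contrapT => /forall2NP H; have [N [mN N0 XN]] := X0fin.
    have : leb (cube a l) <= leb N.
      apply: le_measure; rewrite ?inE//; first exact: measurable_cube.
      by move=> x ax; apply: XN; have [] := H x.
    by rewrite N0 leb_cube ?(ltW l0)// lee_fin leNgt exprn_gt0.
  apply: le_lt_trans (intMX a l x l0 ax) _.
  rewrite lte_mul_pinfty ?lee_fin ?exprn_ge0 ?(ltW l0)//.
  by rewrite lte_mul_pinfty ?lee_fin ?mulr_ge0 ?(ltW K0).
have normE p w : (forall x, (0 <= w x)%R) ->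
    \int[leb]_x ((X x)%:E `^ p * (w x)%:E) = \int[leb]_x (X0 x `^ p * (w x)%:E).
  move=> w0; apply: ae_eq_integralT.
  - by move=> x; rewrite mule_ge0 ?poweR_ge0// lee_fin.
  - by move=> x; rewrite mule_ge0 ?poweR_ge0// lee_fin.
  - by apply: filterS XE => x ->.
exists X; split.
- split=> // a l l0; apply: filterS XE => x E ax.
  have := intMX a l x l0 ax; rewrite -intXE integral_mean// -E -!EFinM lee_fin.
  by rewrite [leLHS]mulrC ler_pM2l// exprn_gt0.
- by apply: filterS XE => x ->; exact: le_rdf_series.
- by rewrite normE.
- by rewrite normE.
Qed.

End rubio_de_francia.

(** * Dyadic cubes *)

Section dyadic_cubes.
Context (R : realType) (n : nat).
Local Notation leb := (lebesgue_Rn R n).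
Variables (a : Rn R n) (l : R).
Hypothesis l0 : (0 < l)%R.
Implicit Types (x y : Rn R n) (k j : nat) (E A : set (Rn R n)).

Definition dside k : R := (l / 2 ^+ k)%R.

Definition dcoord k (i : 'I_n) y : R := ((tnth y i - tnth a i) / dside k)%R.

(** The integer coordinates of the half-open cell of generation [k] containing [y]. Dyadic cubes are
    the fibres of this map, so that two of the same generation are equal or disjoint by
    construction. *)
Definition didx k y : n.-tuple int := [tuple Num.floor (dcoord k i y) | i < n].

Definition dcube k x : set (Rn R n) := [set y | didx k y = didx k x].

Definition dcorner k x : Rn R n :=
  [tuple (tnth a i + dside k * (tnth (didx k x) i)%:~R)%R | i < n].

Lemma dside_gt0 k : (0 < dside k)%R.
Proof. by rewrite divr_gt0// exprn_gt0. Qed.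

Lemma dcoordS k i y : dcoord k.+1 i y = (2 * dcoord k i y)%R.
Proof.
rewrite /dcoord /dside exprS; field.
by rewrite !gt_eqF// exprn_gt0.
Qed.

Lemma didxP k x y : didx k y = didx k x <->
  forall i, Num.floor (dcoord k i y) = Num.floor (dcoord k i x).
Proof.
split=> [h i|h]; last by apply: eq_from_tnth => i; rewrite !tnth_mktuple.
by have := congr1 (fun t => tnth t i) h; rewrite !tnth_mktuple.
Qed.

Lemma floor_half (s t : R) : Num.floor (2 * s)%R = Num.floor (2 * t)%R ->
  (Num.floor s <= Num.floor t)%R.
Proof.
move=> st; rewrite floor_ge_int.
have : (2 * Num.floor s <= Num.floor (2 * t)%R)%R.
  by rewrite -st floor_ge_int intrM; have := floor_le s; lra.
by rewrite floor_ge_int intrM; lra.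
Qed.

Lemma didxS k x y : didx k.+1 y = didx k.+1 x -> didx k y = didx k x.
Proof.
move=> /didxP h; apply/didxP => i; have := h i; rewrite !dcoordS => hi.
by apply/eqP; rewrite eq_le !floor_half.
Qed.

Lemma didx_le k j x y : (k <= j)%N -> didx j y = didx j x -> didx k y = didx k x.
Proof.
move=> /subnK <-; elim: (j - k)%N => [//|m IH] /didxS.
by rewrite -/addn; exact: IH.
Qed.

Lemma dcube_sub k j x : (k <= j)%N -> dcube j x `<=` dcube k x.
Proof. by move=> kj y; exact: didx_le. Qed.

Lemma dcubeE k x : dcube k x = [set y | forall i,
  `[tnth (dcorner k x) i, (tnth (dcorner k x) i + dside k)%R[%classic (tnth y i)].
Proof.
have s0 := dside_gt0 k.
have E i y : (tnth y i \in
    `[tnth (dcorner k x) i, (tnth (dcorner k x) i + dside k)%R[) =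
    (Num.floor (dcoord k i y) == Num.floor (dcoord k i x)).
  rewrite floor_eq in_itv/= !tnth_mktuple /dcoord; set z := Num.floor _.
  rewrite ler_pdivlMr// ltr_pdivrMr// lerBrDl ltrBlDl intrD mulrDl mul1r.
  by rewrite [(dside k * _)%R]mulrC addrA.
apply/seteqP; split=> y /=.
  by move=> /didxP h i; rewrite E; apply/eqP.
by move=> h; apply/didxP => i; apply/eqP; rewrite -E; exact: h.
Qed.

Lemma measurable_dcube k x : measurable (dcube k x).
Proof.
rewrite dcubeE; apply: (measurable_box (A := fun i =>
  `[tnth (dcorner k x) i, (tnth (dcorner k x) i + dside k)%R[%classic)) => i.
exact: measurable_itv.
Qed.

Lemma leb_dcube k x : leb (dcube k x) = (dside k ^+ n)%:E.
Proof.
rewrite dcubeE (lebesgue_Rn_box (A := fun i =>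
  `[tnth (dcorner k x) i, (tnth (dcorner k x) i + dside k)%R[%classic)); last first.
  by move=> i; exact: measurable_itv.
rewrite (eq_bigr (fun=> (dside k)%:E)) => [|i _].
  by rewrite prodEFin prodr_const card_ord.
rewrite lebesgue_measure_itv/= lte_fin ltrDl dside_gt0.
by rewrite EFinD addeAC -EFinB subrr add0e.
Qed.

Lemma dcube_sub_cube k x : dcube k x `<=` cube (dcorner k x) (dside k).
Proof.
by rewrite dcubeE => y h i; have /= := h i; rewrite in_itv/= => /andP[-> /ltW].
Qed.

Lemma cube_sub_dcube0 m : (m < l)%R -> cube a m `<=` dcube 0 a.
Proof.
move=> ml y /= ya; apply/didxP => i; rewrite /dcoord subrr mul0r floor0.
apply/eqP; rewrite floor_eq /dside expr0 divr1 add0r.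
have /andP[h1 h2] := ya i.
rewrite ler_pdivlMr// ltr_pdivrMr// mul0r mul1r subr_ge0 h1/=.
by rewrite ltrBlDl; apply: le_lt_trans h2 _; rewrite ltrD2l.
Qed.

(** In other words, [A] is a union of dyadic cubes of generation [k]. *)
Definition saturated k A : Prop :=
  forall x y, didx k y = didx k x -> A x -> A y.

Lemma saturated_dcube k j x : (k <= j)%N -> saturated j (dcube k x).
Proof. by move=> kj y z /(didx_le kj) zy; rewrite /dcube/= zy. Qed.

Lemma saturated_le k j A : (k <= j)%N -> saturated k A -> saturated j A.
Proof. by move=> kj sA x y /(didx_le kj); exact: sA. Qed.

Lemma saturatedI k A E : saturated k A -> saturated k E -> saturated k (A `&` E).
Proof. by move=> sA sE x y xy [Ax Ex]; split; [exact: sA Ax|exact: sE Ex]. Qed.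

Lemma saturatedU k A E : saturated k A -> saturated k E -> saturated k (A `|` E).
Proof. by move=> sA sE x y xy [Ax|Ex]; [left; exact: sA Ax|right; exact: sE Ex]. Qed.

Lemma saturatedC k A : saturated k A -> saturated k (~` A).
Proof. by move=> sA x y xy Ax Ay; apply: Ax; exact: sA (esym xy) Ay. Qed.

Definition saturated_piece k A (i : nat) : set (Rn R n) :=
  [set y | A y /\ pickle (didx k y) = i].

Lemma saturated_pieceE k A i : saturated k A ->
  saturated_piece k A i = set0 \/
  exists2 x, A x & saturated_piece k A i = dcube k x.
Proof.
move=> sA; have [[x [Ax ix]]|] := pselect (exists x, saturated_piece k A i x).
  right; exists x => //; apply/seteqP; split=> y /=.
    by case=> Ay; rewrite -ix => /(pcan_inj pickleK).
  by move=> yx; split; [exact: sA yx Ax|rewrite yx].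
by move=> h; left; apply/seteqP; split=> // y Ay; apply: h; exists y.
Qed.

Lemma measurable_saturated_piece k A i : saturated k A ->
  measurable (saturated_piece k A i).
Proof.
move=> sA; have [->//|[x _ ->]] := saturated_pieceE i sA.
exact: measurable_dcube.
Qed.

Lemma bigcup_saturated_piece k A : \bigcup_i saturated_piece k A i = A.
Proof.
apply/seteqP; split=> x; first by case=> i _ [].
by move=> Ax; exists (pickle (didx k x)).
Qed.

Lemma trivIset_saturated_piece k A : trivIset setT (saturated_piece k A).
Proof. by move=> i j _ _ [x [[_ <-] [_ <-]]]. Qed.

Lemma measurable_saturated k A : saturated k A -> measurable A.
Proof.
move=> sA; rewrite -(bigcup_saturated_piece k A).
by apply: bigcup_measurable => i _; exact: measurable_saturated_piece.
Qed.

Lemma saturated_integral_le k A (f g : Rn R n -> \bar R) (c : R) :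
  saturated k A -> measurable_fun setT f -> measurable_fun setT g ->
  (forall x, 0 <= f x) -> (forall x, 0 <= g x) -> (0 <= c)%R ->
  (forall x, A x -> \int[leb]_(y in dcube k x) f y <=
                    c%:E * \int[leb]_(y in dcube k x) g y) ->
  \int[leb]_(y in A) f y <= c%:E * \int[leb]_(y in A) g y.
Proof.
move=> sA mf mg f0 g0 c0 h; rewrite -(bigcup_saturated_piece k A).
have mp i : measurable (saturated_piece k A i) by exact: measurable_saturated_piece.
rewrite !ge0_integral_bigcup//; try exact: trivIset_saturated_piece; last 2 first.
- exact: measurable_funTS.
- exact: measurable_funTS.
rewrite -nneseriesZl; last by move=> i _; exact: integral_ge0.
apply: lee_nneseries => [i _ _|i _]; first exact: integral_ge0.
have [->|[x Ax ->]] := saturated_pieceE i sA; last exact: h.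
by rewrite !integral_set0 mule0.
Qed.

Let P := dcube 0 a.

Let Poo : leb P < +oo.
Proof. by rewrite leb_dcube ltry. Qed.

Let mP : measurable P.
Proof. exact: measurable_dcube. Qed.

Definition symdiff E A := (E `\` A) `|` (A `\` E).

(** These sets form a sigma-algebra containing the half-spaces, hence all Borel sets. Only the part
    in [P] is approximated, because its finite measure is what allows a countable union to be cut
    off. *)
Definition approximable E : Prop := measurable E /\
  forall d : R, (0 < d)%R -> exists k A,
    saturated k A /\ leb (symdiff E A `&` P) <= d%:E.

Let measurable_symdiff E A : measurable E -> measurable A ->
  measurable (symdiff E A `&` P).
Proof.
move=> mE mA; apply: measurableI => //.
by apply: measurableU; exact: measurableD.
Qed.

Lemma approximable_saturated k A : saturated k A -> approximable A.
Proof.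
move=> sA; split; first exact: measurable_saturated sA.
move=> d d0; exists k, A; split=> //.
by rewrite /symdiff setDv setU0 set0I measure0 lee_fin ltW.
Qed.

Lemma approximableC E : approximable E -> approximable (~` E).
Proof.
move=> [mE hE]; split; first exact: measurableC.
move=> d d0; have [k [A [sA hA]]] := hE d d0.
exists k, (~` A); split; first exact: saturatedC.
suff -> : symdiff (~` E) (~` A) = symdiff E A by [].
by rewrite /symdiff !setDE !setCK setUC [A `&` _]setIC [E `&` _]setIC.
Qed.

Lemma approximableU E F : approximable E -> approximable F ->
  approximable (E `|` F).
Proof.
move=> [mE hE] [mF hF]; split; first exact: measurableU.
move=> d d0; have d20 : (0 < d / 2)%R by rewrite divr_gt0.
have [k [A [sA hA]]] := hE _ d20; have [j [B [sB hB]]] := hF _ d20.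
have mA := measurable_saturated sA; have mB := measurable_saturated sB.
exists (maxn k j), (A `|` B); split.
  by apply: saturatedU; [apply: saturated_le sA; exact: leq_maxl|
    apply: saturated_le sB; exact: leq_maxr].
apply: (@le_trans _ _ (leb ((symdiff E A `&` P) `|` (symdiff F B `&` P)))).
  apply: le_measure; rewrite ?inE.
  - by apply: measurable_symdiff; exact: measurableU.
  - by apply: measurableU; exact: measurable_symdiff.
  move=> x [[[[Ex|Fx] nx]|[[Ax|Bx] nx]] Px].
  - by left; split=> //; left; split=> // Ax; apply: nx; left.
  - by right; split=> //; left; split=> // Bx; apply: nx; right.
  - by left; split=> //; right; split=> // Ex; apply: nx; left.
  - by right; split=> //; right; split=> // Fx; apply: nx; right.
rewrite (_ : d%:E = (d / 2)%:E + (d / 2)%:E); last by rewrite -EFinD -splitr.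
apply: le_trans (measureU2 _ _ _) _; [exact: measurable_symdiff| |exact: leeD].
exact: measurable_symdiff.
Qed.

Lemma approximable_bigcup (E : nat -> set (Rn R n)) :
  (forall i, approximable (E i)) -> approximable (\bigcup_i E i).
Proof.
move=> hE; have mE i : measurable (E i) by have [] := hE i.
have mU : measurable (\bigcup_i E i) by exact: bigcup_measurable.
split=> // d d0; have d20 : (0 < d / 2)%R by rewrite divr_gt0.
pose F N := \big[setU/set0]_(i < N) E i.
have hF N : approximable (F N).
  rewrite /F; elim/big_ind : _ => //; last exact: approximableU.
  by apply: (@approximable_saturated 0) => x y _.
have mF N : measurable (F N) by have [] := hF N.
pose G N := ((\bigcup_i E i) `\` F N) `&` P.
have mG N : measurable (G N) by apply: measurableI => //; exact: measurableD.
have [N hN] : exists N, leb (G N) <= (d / 2)%:E.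
  apply: contrapT => /forallNP H.
  have GE : \bigcap_N G N = set0.
    apply/seteqP; split=> // x Gx; have [[[i _ Eix] _] _] := Gx 0%N Logic.I.
    have [[_ nF] _] := Gx i.+1 Logic.I; apply: nF.
    by rewrite /F big_ord_recr/=; right.
  have G0 : leb (G 0%N) < +oo.
    by apply: le_lt_trans Poo; apply: le_measure; rewrite ?inE// => x [].
  have ndG : nonincreasing_seq G.
    move=> i j ij; apply/subsetPset => x [[Ux nF] Px]; split=> //; split=> //.
    move=> Fx; apply: nF; move: Fx; rewrite /F -!bigcup_mkord => -[k /= ki Ekx].
    by exists k => //=; exact: leq_trans ij.
  have cG : leb \o G @ \oo --> leb (\bigcap_N G N).
    by apply: nonincreasing_cvg_mu => //; rewrite GE.
  have : (d / 2)%:E <= limn (leb \o G).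
    apply: lime_ge; first by apply/cvg_ex; eexists; exact: cG.
    by apply: nearW => N; rewrite /= ltW// ltNge; apply/negP/H.
  by rewrite (cvg_lim _ cG)// GE measure0 lee_fin leNgt d20.
have [k [A [sA hA]]] := (hF N).2 _ d20.
have mA := measurable_saturated sA.
exists k, A; split=> //.
apply: (@le_trans _ _ (leb (G N `|` (symdiff (F N) A `&` P)))).
  apply: le_measure; rewrite ?inE.
  - exact: measurable_symdiff.
  - by apply: measurableU => //; exact: measurable_symdiff.
  move=> x [[[Ux nA]|[Ax nU]] Px].
  - have [Fx|nF] := pselect (F N x).
      by right; split=> //; left.
    by left; split.
  - right; split=> //; right; split=> // Fx; apply: nU; move: Fx.
    by rewrite /F -bigcup_mkord => -[i _ Eix]; exists i.
rewrite (_ : d%:E = (d / 2)%:E + (d / 2)%:E); last by rewrite -EFinD -splitr.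
apply: le_trans (measureU2 _ _ _) _; [exact: mG| |exact: leeD].
exact: measurable_symdiff.
Qed.

(** Two distinct reals have different floors once the dyadic scale is finer than their distance, so
    the half-space is a countable union of saturated sets. *)
Lemma approximable_ray (i : 'I_n) (c : R) :
  approximable [set x : Rn R n | (c < tnth x i)%R].
Proof.
rewrite [X in approximable X](_ : _ = \bigcup_k [set x : Rn R n |
    (Num.floor ((c - tnth a i) / dside k) < Num.floor (dcoord k i x))%R]).
  apply: approximable_bigcup => k; apply: (@approximable_saturated k).
  by move=> x y /didxP xy /=; rewrite xy.
apply/seteqP; split=> x /=; last first.
  move=> [k _ /=]; rewrite ltNge => h; rewrite ltNge; apply: contra h => xc.
  apply: le_floor; rewrite /dcoord ler_pM2r ?invr_gt0 ?dside_gt0//.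
  by rewrite lerD2r.
move=> cx; have e0 : (0 < (tnth x i - c) / l)%R by rewrite divr_gt0// subr_gt0.
have [k hk] := exists_pow2_ge 1%R e0; exists k => //=.
have E : (dcoord k i x = (c - tnth a i) / dside k + (tnth x i - c) / l * 2 ^+ k)%R.
  rewrite /dcoord /dside; field.
  by rewrite !gt_eqF// exprn_gt0.
rewrite -lezD1 floor_ge_int intrD E.
by apply: lerD => //; exact: floor_le.
Qed.

Lemma measurable_approximable E : measurable E -> approximable E.
Proof.
apply: (smallest_sub (C := sigma_algebra setT)).
  split.
  - by apply: (@approximable_saturated 0).
  - by move=> A hA; rewrite setTD; exact: approximableC.
  - exact: approximable_bigcup.
(* The product sigma-algebra is generated by preimages under the coordinates, and the Borel sets of
   the line in turn by open rays. *)
move=> B; elim/big_ind : _ => [//|C D hC hD [/hC|/hD]//|i _] [C mC <-].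
rewrite setTI; move: C mC; rewrite RGenOInfty.measurableE.
apply: (smallest_sub (C := sigma_algebra setT)).
  split.
  - by rewrite /= preimage_set0; apply: (@approximable_saturated 0).
  - by move=> A /= hA; rewrite setTD preimage_setC; exact: approximableC.
  - by move=> A /= hA; rewrite preimage_bigcup; exact: approximable_bigcup.
move=> _ [c ->] /=; rewrite (_ : _ @^-1` _ = [set x | (c < tnth x i)%R]).
  exact: approximable_ray.
by apply/seteqP; split=> x /=; rewrite in_itv/= andbT.
Qed.

End dyadic_cubes.

(** * The reverse Hoelder inequality for A_1 weights *)

(** [c / (1 - q)] is the fixed point of the map sending [x] to [c + q * x], and [q ^+ m * D] the
    distance left after [m] iterations. *)
Lemma fixed_point_bound (R : realType) (X c q D Y : R) : (0 <= q < 1)%R -> (0 <= Y)%R ->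
  (forall m, X <= (c / (1 - q) + q ^+ m * D) * Y)%R -> (X <= c / (1 - q) * Y)%R.
Proof.
move=> /andP[q0 q1] Y0 h.
have c1 : (q ^+ m)%R @[m --> \oo] --> (0 : R)%R by apply: cvg_expr; rewrite ger0_norm.
have c2 : ((c / (1 - q) + q ^+ m * D) * Y)%R @[m --> \oo] -->
    ((c / (1 - q) + 0 * D) * Y)%R.
  apply: cvgMl; apply: cvgD; first exact: cvg_cst.
  exact: cvgMl.
rewrite mul0r addr0 in c2; rewrite -(cvg_lim _ c2)//.
apply: limr_ge; first by apply/cvg_ex; eexists; exact: c2.
exact: nearW.
Qed.

Section reverse_hoelder_dyadic.
Context (R : realType) (n : nat).
Local Notation leb := (lebesgue_Rn R n).
Variables (a : Rn R n) (l C : R) (u : Rn R n -> R).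
Hypotheses (l0 : (0 < l)%R) (C1 : (1 <= C)%R) (hu : A1_weight C u).
Implicit Types (x y : Rn R n) (k j : nat).

Local Notation D := (dcube a l).
Local Notation s k := (dside l k ^+ n)%R.

Let C0 : (0 < C)%R. Proof. exact: lt_le_trans C1. Qed.
Let u0 x : (0 < u x)%R. Proof. by have [[]] := hu. Qed.
Let u0E x : 0 <= (u x)%:E. Proof. by rewrite lee_fin ltW. Qed.
Let mu_ : measurable_fun setT u. Proof. by have [[]] := hu. Qed.
Let muE : measurable_fun setT (EFin \o u). Proof. exact/measurable_EFinP. Qed.
Let s0 k : (0 < s k)%R. Proof. by rewrite exprn_gt0// dside_gt0. Qed.

Definition dmean k x : R := locked (fine (\int[leb]_(y in D k x) (u y)%:E) / s k)%R.

Let intD_lty k x : \int[leb]_(y in D k x) (u y)%:E < +oo.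
Proof.
have [[_ _ iu] _] := hu.
apply: le_lt_trans (iu (dcorner a l k x) (dside l k) (dside_gt0 l0 k)).
by apply: le_integral_subset => //; exact: dcube_sub_cube.
Qed.

Lemma integral_dcube k x : \int[leb]_(y in D k x) (u y)%:E = (dmean k x * s k)%:E.
Proof.
rewrite /dmean -lock divfK ?gt_eqF// fineK// ge0_fin_numE//.
by apply: integral_ge0 => y _.
Qed.

Lemma dmean_le_mean k x : (dmean k x <= mean u (dcorner a l k x) (dside l k))%R.
Proof.
rewrite -(@ler_pM2r _ (s k))// -lee_fin -integral_dcube.
rewrite -integral_mean//; [|by have [] := hu|exact: dside_gt0].
by apply: le_integral_subset => //; exact: dcube_sub_cube.
Qed.

Lemma dmean_le_ae k x :
  \forall y \ae leb, D k x y -> (dmean k x <= C * u y)%R.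
Proof.
have [_ h] := hu; apply: filterS (h (dcorner a l k x) _ (dside_gt0 l0 k)) => y hy Dy.
by apply: le_trans (dmean_le_mean k x) _; apply: hy; exact: dcube_sub_cube.
Qed.

Lemma dcube_eq k x y : D k x y -> D k y = D k x.
Proof. by rewrite /dcube/= => ->. Qed.

Lemma dmean_eq k x y : D k x y -> dmean k y = dmean k x.
Proof. by move=> xy; rewrite /dmean (dcube_eq xy). Qed.

Lemma dsideS k : (s k = 2 ^+ n * s k.+1)%R.
Proof. by rewrite -exprMn /dside exprS; congr (_ ^+ _)%R; field; rewrite gt_eqF// exprn_gt0. Qed.

Lemma dmeanS_le k x : (dmean k.+1 x <= 2 ^+ n * dmean k x)%R.
Proof.
rewrite -(@ler_pM2r _ (s k.+1))// -mulrA mulrCA -dsideS -lee_fin -!integral_dcube.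
by apply: le_integral_subset => //; exact: dcube_sub.
Qed.

(** An A_1 weight is essentially bounded below on a cube by a multiple of its mean. This gives the
    iteration in [truncated_reverse_hoelder] a finite constant to start from. *)
Lemma dmean_lower : exists2 c : R, (0 < c)%R &
  forall k x, D 0 a x -> (c <= dmean k x)%R.
Proof.
have [nu h] := hu; have l1 := dside_gt0 l0 0.
have m0 := mean_gt0 (dcorner a l 0 a) nu l1.
exists (mean u (dcorner a l 0 a) (dside l 0) / C)%R; first by rewrite divr_gt0.
set c := (_ / C)%R => k x ax.
rewrite -(@ler_pM2r _ (s k))// -lee_fin -integral_dcube EFinM -(leb_dcube a l0 k x).
have -> : c%:E * leb (D k x) = \int[leb]_(y in D k x) (cst c%:E y).
  by rewrite integral_cst//; exact: measurable_dcube.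
apply: ae_le_integral_in => //.
  by move=> y; rewrite lee_fin ltW// divr_gt0.
apply: filterS (h (dcorner a l 0 a) _ l1) => y hy xy.
rewrite lee_fin ler_pdivrMr// mulrC hy//.
apply: dcube_sub_cube => //; have := dcube_sub l0 (leq0n k) xy.
by rewrite /dcube /= => ->.
Qed.

(* If all the dyadic averages around the points of [E] are at most [t], then so
   is [u] almost everywhere on [E]: this replaces Lebesgue's differentiation
   theorem. *)
Lemma dyadic_differentiation k x (E : set (Rn R n)) (t : R) : D 0 a x ->
  measurable E -> E `<=` D k x -> (0 <= t)%R ->
  (forall y j, E y -> (k <= j)%N -> (dmean j y <= t)%R) ->
  \forall y \ae leb, E y -> (u y <= t)%R.
Proof.
move=> ax mE EP t0 hE.
have xE y : E y -> D 0 a y.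
  by move=> /EP /(dcube_sub l0 (leq0n k)); rewrite /dcube/= => ->.
pose ET (T : nat) := E `&` [set y | (t < u y <= T%:R)%R].
have mET T : measurable (ET T).
  apply: measurableI => //; rewrite -[X in measurable X]setTI.
  exact: (mu_ measurableT (measurable_itv `]t, T%:R])).
have key T : \int[leb]_(y in ET T) (u y)%:E <= t%:E * leb (ET T).
  apply/lee_addgt0Pr => e e0.
  (* Since [u] is at most [T] on [ET T], approximating this set up to measure [d] costs at most
     [(t + T) * d], which is at most [e]. *)
  pose d := (e / (t + T%:R + 1))%R.
  have tT0 : (0 < t + T%:R + 1)%R by rewrite ltr_wpDl// addr_ge0.
  have d0 : (0 < d)%R by rewrite divr_gt0.
  have [_ /(_ d d0) [j [A [sA hA]]]] := measurable_approximable a l0 (mET T).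
  (* The approximating set is cut down to the cells of generation [i] inside [D k x] with average at
     most [t]. Nothing of [ET T] is lost, all its points lying in such cells. *)
  pose i := maxn j k.
  pose A' := A `&` (D k x `&` [set y | (dmean i y <= t)%R]).
  have sA' : saturated a l i A'.
    apply: saturatedI; first by apply: saturated_le sA; rewrite ?leq_maxl.
    apply: saturatedI; first by apply: saturated_dcube => //; exact: leq_maxr.
    by move=> y z zy /=; rewrite (@dmean_eq i y z zy).
  have mA' := measurable_saturated l0 sA'.
  have mA := measurable_saturated l0 sA.
  pose S := symdiff (ET T) A `&` D 0 a.
  have mS : measurable S.
    apply: measurableI; last exact: measurable_dcube.
    by apply: measurableU; exact: measurableD.
  have sub1 : ET T `<=` A' `|` (S `&` ET T).
    move=> y ETy; have [Ey _] := ETy.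
    have [Ay|nA] := pselect (A y).
      by left; split=> //; split; [exact: EP|apply: hE => //; exact: leq_maxr].
    by right; split=> //; split; [left|exact: xE].
  have sub2 : A' `<=` ET T `|` S.
    move=> y [Ay [Dy _]]; have [?|nE] := pselect (ET T y); [by left|right].
    split; first by right.
    by have := dcube_sub l0 (leq0n k) Dy; rewrite /dcube/= => ->.
  have hS : leb S <= d%:E by [].
  apply: (@le_trans _ _ (\int[leb]_(y in A' `|` (S `&` ET T)) (u y)%:E)).
    exact: le_integral_subset.
  apply: le_trans (integral_setU_le _ _ _ muE _) _ => //; first exact: measurableI.
  apply: (@le_trans _ _ (t%:E * leb A' + T%:R%:E * leb S)).
    apply: leeD.
      have -> : leb A' = \int[leb]_(y in A') (cst 1 y) by rewrite integral_cst// mul1e.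
      apply: saturated_integral_le sA' _ _ _ _ _ _ => //.
      move=> y [_ [_ /= yt]]; rewrite integral_dcube integral_cst; last exact: measurable_dcube.
      by rewrite mul1e [X in _ <= _ * X](leb_dcube a l0 i y) -EFinM lee_fin ler_wpM2r// ltW.
    apply: (@le_trans _ _ (\int[leb]_(y in S `&` ET T) (cst T%:R%:E y))).
      apply: ae_le_integral_in => //; first by move=> y; rewrite lee_fin.
      by apply: aeW => y [_ [_ /= /andP[_]]].
    rewrite integral_cst; last exact: measurableI.
    apply: lee_wpmul2l; first by rewrite lee_fin.
    by apply: le_measure; rewrite ?inE//; exact: measurableI.
  apply: (@le_trans _ _ (t%:E * (leb (ET T) + d%:E) + T%:R%:E * d%:E)).
    apply: leeD; apply: lee_wpmul2l; rewrite ?lee_fin//.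
    apply: (@le_trans _ _ (leb (ET T `|` S))).
      by apply: le_measure; rewrite ?inE//; exact: measurableU.
    by apply: le_trans (measureU2 _ _ _) _ => //; exact: leeD2l.
  rewrite ge0_muleDr// ?lee_fin ?(ltW d0)// -addeA; apply: leeD2l.
  rewrite -[leLHS]/((t * d + T%:R * d)%R%:E) lee_fin -mulrDl.
  rewrite /d mulrCA -[leRHS]mulr1; apply: ler_wpM2l; first exact: ltW.
  by rewrite ler_pdivrMr// mul1r lerDl.
have null T : \forall y \ae leb, ~ ET T y.
  pose v y := (Num.max (u y - t) 0)%R.
  have v0 y : (0 <= v y)%R by rewrite le_max lexx orbT.
  have mv : measurable_fun setT v.
    by apply: measurable_maxr => //; apply: measurable_funB.
  have leT : leb (ET T) < +oo.
    apply: (@le_lt_trans _ _ (leb (D 0 a))); last by rewrite leb_dcube// ltry.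
    apply: le_measure; rewrite ?inE//; first exact: measurable_dcube.
    by move=> y [Ey _]; exact: xE.
  have tfin : t%:E * leb (ET T) \is a fin_num.
    by rewrite fin_numM// ge0_fin_numE.
  have h : \int[leb]_(y in ET T) (v y)%:E = 0.
    apply/eqP; rewrite eq_le; apply/andP; split; last first.
      by apply: integral_ge0 => y _; rewrite lee_fin.
    rewrite -(leeD2lE _ _ tfin) adde0; apply: le_trans (key T).
    rewrite -integral_cst// -ge0_integralD//; last 2 first.
    - by move=> y _; rewrite lee_fin.
    - by apply: measurable_funTS; exact/measurable_EFinP.
    apply: ae_le_integral_in => //.
      by move=> y; rewrite adde_ge0 ?lee_fin.
    apply: aeW => y [_ /= /andP[ty _]]; rewrite -EFinD lee_fin /v.
    by rewrite max_l ?subr_ge0 ?(ltW ty)// addrC subrK.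
  rewrite integral_mkcond in h.
  have := integral_eq0_ae _ _ h; case.
  - apply/(measurable_restrictT (EFin \o v)) => //.
    by apply: measurable_funTS; exact/measurable_EFinP.
  - by apply: erestrict_ge0 => y _; rewrite lee_fin.
  move=> N [mN N0 hN]; exists N; split=> // y /= /contrapT ETy; apply: hN => /=.
  rewrite patchE mem_set// => -[] /eqP; rewrite gt_eqF//.
  by case: ETy => _ /= /andP[ty _]; rewrite /v lt_max subr_gt0 ty.
have : leb.-negligible (\bigcup_T ET T).
  apply: negligible_bigcup => T; have := null T.
  by apply: negligibleS => y ETy /=; apply.
apply: negligibleS => y /= /not_implyP[Ey /negP]; rewrite -ltNge => ty.
exists (Num.bound (u y)) => //; split=> //=; rewrite ty/= ltW//.
by apply: archi_boundP; exact: ltW.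
Qed.

Variables (e q T : R).
Hypotheses (e0 : (0 < e)%R) (T0 : (0 < T)%R).
Hypothesis q01 : (0 <= q < 1)%R.
Hypothesis hq : ((2 ^+ n * 2) `^ e * (1 - (2 * C)^-1) <= q)%R.

(** The truncation at [T] makes all integrals finite, so that the estimate can be iterated; the
    final constant does not depend on [T]. *)
Let phi x : R := (u x * Num.min (u x) T `^ e)%R.

Let min0 x : (0 < Num.min (u x) T)%R. Proof. by rewrite lt_min u0. Qed.

Let phi0 x : (0 <= phi x)%R.
Proof. by rewrite mulr_ge0 ?powR_ge0// ltW. Qed.

Let mphi : measurable_fun setT phi.
Proof.
apply: measurable_funM => //; apply: measurable_fun_powR.
exact: measurable_minr.
Qed.

Let claim (c : R) := forall k x, D 0 a x ->
  \int[leb]_(y in D k x) (phi y)%:E <= (c * dmean k x `^ (1 + e) * s k)%:E.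

Let dmean_gt0 k x : (0 < dmean k x)%R.
Proof.
rewrite -(@ltr_pM2r _ (s k))// mul0r -lte_fin -integral_dcube.
have [m m0 hm] : exists2 m : R, (0 < m)%R & \forall y \ae leb, D k x y -> (m <= u y)%R.
  have [nu h] := hu; have k0 := dside_gt0 l0 k.
  have m0 := mean_gt0 (dcorner a l k x) nu k0.
  exists (mean u (dcorner a l k x) (dside l k) / C)%R; first by rewrite divr_gt0.
  apply: filterS (h (dcorner a l k x) _ k0) => y hy xy.
  by rewrite ler_pdivrMr// mulrC hy//; exact: dcube_sub_cube.
apply: (@lt_le_trans _ _ (\int[leb]_(y in D k x) (cst m%:E y))).
  rewrite integral_cst; last exact: measurable_dcube.
  by rewrite [X in _ < _ * X](leb_dcube a l0 k x) -EFinM lte_fin mulr_gt0.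
apply: ae_le_integral_in => //; first by move=> y; rewrite lee_fin ltW.
Qed.

Let powR1e (x : R) : (0 < x)%R -> (x `^ (1 + e) = x * x `^ e)%R.
Proof. by move=> x0; rewrite powRDpos// powRr1// ltW. Qed.

(* Stopping time: the maximal dyadic subcubes with average above twice the average
   of the cube carry at most the fraction [1 - 1/(2C)] of the mass of [u]. *)
Lemma stopping_step (c : R) : (0 <= c)%R -> claim c -> claim (2 `^ (1 + e) + q * c).
Proof.
move=> c0 hc k x ax.
set P := D k x; set p := dmean k x; have p0 : (0 < p)%R by exact: dmean_gt0.
have PD0 y : P y -> D 0 a y.
  by move=> /(dcube_sub l0 (leq0n k)); rewrite /dcube/= => ->.
have mP : measurable P by exact: measurable_dcube.
have lebP : leb P = (s k)%:E by exact: leb_dcube.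
(* The union of the stopping cubes of generation [j], where the average exceeds [2 * p] for the
   first time. *)
pose S j := [set y | [/\ P y, (k < j)%N, (2 * p < dmean j y)%R &
  forall i, (k <= i < j)%N -> (dmean i y <= 2 * p)%R]].
have sS j : saturated a l j (S j).
  move=> y z zy [Py kj hj hi]; split=> //.
  - by apply: (saturated_dcube _ _ zy) => //; exact: ltnW.
  - by rewrite (@dmean_eq j y z zy).
  - move=> i /andP[ki ij]; rewrite (@dmean_eq i y z); first by rewrite hi// ki.
    exact: dcube_sub (ltnW ij) _ zy.
have mS j : measurable (S j) by exact: measurable_saturated (sS j).
pose U := \bigcup_j S j.
have mU : measurable U by exact: bigcup_measurable.
have UP : U `<=` P by move=> y [j _ []].
have tS : trivIset setT S.
  move=> i j _ _ [y [[_ ki hi hi'] [_ kj hj hj']]].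
  case: (ltngtP i j) => // ij.
  - by have := hj' i; rewrite (ltnW ki) ij leNgt hi => /(_ isT).
  - by have := hi' j; rewrite (ltnW kj) ij leNgt hj => /(_ isT).
pose E := P `\` U; have mE : measurable E by exact: measurableD.
have hE y j : E y -> (k <= j)%N -> (dmean j y <= 2 * p)%R.
  move=> [Py nU] kj; rewrite leNgt; apply/negP => hj; apply: nU.
  have ex : exists j, (k <= j)%N && (2 * p < dmean j y)%R.
    by exists j; rewrite kj.
  have [m /andP[km hm] mmin] := ex_minnP ex; exists m => //; split=> //.
    rewrite ltn_neqAle km andbT; apply/eqP => kmE; move: hm.
    by rewrite -kmE (@dmean_eq k x y Py) -/p ltNge ler_peMl ?(ltW p0)// ler1n.
  move=> i /andP[ki im]; rewrite leNgt; apply/negP => hi.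
  by have := mmin i; rewrite ki hi leqNgt im => /(_ isT).
have p20 : (0 <= 2 * p)%R by rewrite mulr_ge0// ltW.
have uE : \forall y \ae leb, E y -> (u y <= 2 * p)%R.
  by apply: (dyadic_differentiation ax mE _ p20 hE) => y [].
have PE : P = E `|` U by rewrite /E setUC setDUK.
have disj : [disjoint E & U] by rewrite disj_set2E setIC setDIK eqxx.
have split_int (f : Rn R n -> R) : measurable_fun setT f -> (forall y, 0 <= f y)%R ->
    \int[leb]_(y in P) (f y)%:E =
    \int[leb]_(y in E) (f y)%:E + \int[leb]_(y in U) (f y)%:E.
  move=> mf f0; rewrite PE ge0_integral_setU//.
    by apply: measurable_funTS; exact/measurable_EFinP.
  by move=> y _; rewrite lee_fin.
have sumU (f g : Rn R n -> R) (r : R) : measurable_fun setT f -> measurable_fun setT g ->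
    (forall y, 0 <= f y)%R -> (forall y, 0 <= g y)%R -> (0 <= r)%R ->
    (forall j y, S j y -> \int[leb]_(z in D j y) (f z)%:E <=
      r%:E * \int[leb]_(z in D j y) (g z)%:E) ->
    \int[leb]_(y in U) (f y)%:E <= r%:E * \int[leb]_(y in U) (g y)%:E.
  move=> mf mg f0 g0 r0 h.
  have mf' : measurable_fun setT (EFin \o f) by exact/measurable_EFinP.
  have mg' : measurable_fun setT (EFin \o g) by exact/measurable_EFinP.
  rewrite !ge0_integral_bigcup//; try (by move=> y _; rewrite lee_fin);
    try exact: measurable_funTS.
  rewrite -nneseriesZl; last by move=> i _; apply: integral_ge0 => y _; rewrite lee_fin.
  apply: lee_nneseries => [i _ _|i _].
    by apply: integral_ge0 => y _; rewrite lee_fin.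
  apply: (saturated_integral_le (f := EFin \o f) (g := EFin \o g) l0 (sS i)) => //.
  by move=> y; exact: h.
have finE (A : set (Rn R n)) : A `<=` P -> \int[leb]_(y in A) (u y)%:E \is a fin_num.
  move=> AP; rewrite ge0_fin_numE; last exact: integral_ge0.
  by apply: le_lt_trans (intD_lty k x); exact: le_integral_subset.
have finL (A : set (Rn R n)) : measurable A -> A `<=` P -> leb A \is a fin_num.
  move=> mA AP; rewrite ge0_fin_numE//; apply: (@le_lt_trans _ _ (leb P)).
    by apply: le_measure; rewrite ?inE.
  by rewrite lebP ltry.
have EP : E `<=` P by move=> y [].
set IE := fine (\int[leb]_(y in E) (u y)%:E).
set IU := fine (\int[leb]_(y in U) (u y)%:E).
have IEE : \int[leb]_(y in E) (u y)%:E = IE%:E by rewrite fineK// finE.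
have IUE : \int[leb]_(y in U) (u y)%:E = IU%:E by rewrite fineK// finE.
set LE := fine (leb E); set LU := fine (leb U).
have LEE : leb E = LE%:E by rewrite fineK// finL.
have LUE : leb U = LU%:E by rewrite fineK// finL.
have hI : (IE + IU = p * s k)%R.
  have := integral_dcube k x; rewrite -/P split_int//.
  by rewrite IEE IUE => -[].
have cstE (A : set (Rn R n)) (r : R) : measurable A ->
    \int[leb]_(y in A) (cst r y)%:E = r%:E * leb A.
  by move=> mA; exact: (integral_cst leb mA r%:E).
have hL : (LE + LU = s k)%R.
  have := split_int (cst 1%R) (measurable_cst _) (fun=> ler01).
  by rewrite !cstE// !mul1e lebP LEE LUE => -[].
have LE0 : (0 <= LE)%R by rewrite fine_ge0.
have LU0 : (0 <= LU)%R by rewrite fine_ge0.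
have IU0 : (0 <= IU)%R by rewrite fine_ge0// integral_ge0.
have hU : (2 * p * LU <= IU)%R.
  rewrite -lee_fin EFinM -LUE -cstE// -IUE -[leRHS]mul1e.
  apply: sumU => //.
  move=> j y [_ _ hj _]; rewrite cstE; last exact: measurable_dcube.
  rewrite integral_dcube mul1e [X in _ * X <= _](leb_dcube a l0 j y).
  by rewrite -EFinM lee_fin ler_wpM2r// ltW.
have hIE : (p / C * LE <= IE)%R.
  rewrite -lee_fin EFinM -LEE -cstE// -IEE.
  apply: ae_le_integral_in => //; first by move=> y; rewrite lee_fin divr_ge0// ltW.
  apply: filterS (dmean_le_ae k x) => y hy /EP Py.
  by rewrite lee_fin ler_pdivrMr// mulrC hy.
have IEpos : (0 <= IE)%R by rewrite fine_ge0// integral_ge0.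
(* Averages above [2 * p] on [U] leave it at most half of the volume of [P]. So [E] has at least
   half of it, and by the A_1 condition at least the fraction [(2 * C)^-1] of the mass. *)
have hIU : (IU <= (1 - (2 * C)^-1) * (p * s k))%R.
  have hLU : (LU <= s k / 2)%R.
    rewrite ler_pdivlMr// -(@ler_pM2l _ p)//; move: hU; rewrite -hI in IEpos *; lra.
  have hLE : (s k / 2 <= LE)%R by lra.
  have : (p / C * (s k / 2) <= IE)%R.
    by apply: le_trans hIE; rewrite ler_wpM2l// divr_ge0// ltW.
  have -> : (p / C * (s k / 2) = (2 * C)^-1 * (p * s k))%R by field; rewrite gt_eqF.
  by rewrite mulrBl mul1r; lra.
have phiE : \int[leb]_(y in E) (phi y)%:E <= ((2 * p) `^ (1 + e) * s k)%:E.
  apply: (@le_trans _ _ (\int[leb]_(y in E) (cst ((2 * p) `^ (1 + e))%R y)%:E)).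
    apply: ae_le_integral_in => //; first by move=> y; rewrite lee_fin powR_ge0.
    apply: filterS uE => y hy Ey; rewrite lee_fin powR1e; last first.
      by rewrite mulr_gt0.
    apply: ler_pM; [exact: ltW|exact: powR_ge0|exact: hy|].
    apply: le_powR; [exact: ltW|exact: ltW|].
    by rewrite ge_min hy.
  rewrite cstE// LEE -EFinM lee_fin ler_wpM2l ?powR_ge0//.
  by rewrite -hL lerDl.
have phiU : \int[leb]_(y in U) (phi y)%:E <=
    (c * (2 ^+ n * (2 * p)) `^ e)%:E * IU%:E.
  rewrite -IUE; apply: sumU => //.
    by rewrite mulr_ge0 ?powR_ge0.
  move=> j y [Py kj hj hi]; apply: (le_trans (hc j y (PD0 _ Py))).
  have jy0 := dmean_gt0 j y.
  rewrite integral_dcube -EFinM lee_fin powR1e//.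
  rewrite [leLHS](_ : _ = c * dmean j y `^ e * (dmean j y * s j))%R; last by ring.
  rewrite ler_wpM2r ?mulr_ge0 ?(ltW jy0) ?(ltW (s0 _))// ler_wpM2l//.
  apply: le_powR; [exact: ltW|exact: ltW|].
  (* The parent of a stopping cube was not stopped, so its average is at most [2 * p] and that of
     the stopping cube at most [2 ^+ n] times as much. *)
  case: j {hc} kj hj hi jy0 => // j kj hj hi jy0.
  apply: le_trans (dmeanS_le j y) _; rewrite ler_wpM2l ?exprn_ge0//.
  by apply: hi; rewrite ltnSn andbT -ltnS.
rewrite -/P -/p split_int//; apply: (le_trans (leeD phiE phiU)).
rewrite -EFinM -EFinD lee_fin !powR1e// ?mulr_gt0//.
rewrite [(2 ^+ n * (2 * p))%R]mulrA [((_ * p) `^ e)%R]powRM ?mulr_ge0 ?exprn_ge0 ?(ltW p0)//.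
rewrite [((2 ^+ n * 2 * p) `^ e)%R]powRM ?mulr_ge0 ?exprn_ge0 ?(ltW p0)//.
set A := (p `^ e)%R; have A0 : (0 <= A)%R by rewrite powR_ge0.
have hq' := hq; set B := (2 `^ e)%R; set F := ((2 ^+ n * 2) `^ e)%R in hq' *.
have F0 : (0 <= F)%R by rewrite powR_ge0.
apply: (@le_trans _ _ (2 * p * (B * A) * s k +
    c * (F * A) * ((1 - (2 * C)^-1) * (p * s k))))%R.
  by rewrite lerD2l ler_wpM2l// !mulr_ge0.
rewrite [leLHS](_ : _ = 2 * B * (p * A) * s k +
  c * (F * (1 - (2 * C)^-1)) * (p * A * s k))%R; last by ring.
rewrite [leRHS](_ : _ = 2 * B * (p * A) * s k + c * q * (p * A * s k))%R;
  last by ring.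
rewrite lerD2l.
by rewrite ler_wpM2r ?ler_wpM2l// !mulr_ge0// ltW.
Qed.

Lemma truncated_reverse_hoelder :
  \int[leb]_(y in D 0 a) (phi y)%:E <=
  (2 `^ (1 + e) / (1 - q) * (dmean 0 a `^ (1 + e) * s 0))%:E.
Proof.
have [c0 c00 hc0] := dmean_lower.
have /andP[q0 q1] := q01; have q'0 : (0 < 1 - q)%R by rewrite subr_gt0.
pose d := (2 `^ (1 + e) / (1 - q))%R.
have d0 : (0 <= d)%R by rewrite divr_ge0 ?powR_ge0// ltW.
(* The constant at the start: [phi] is at most [T ^ e * u], and all dyadic averages are at least
   [c0]. *)
pose D0 := ((T / c0) `^ e)%R; have D00 : (0 <= D0)%R by rewrite powR_ge0.
have dE : (d = 2 `^ (1 + e) + q * d)%R by rewrite /d; field; rewrite gt_eqF.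
have claims m : claim (d + q ^+ m * D0).
  elim: m => [|m IH].
    rewrite expr0 mul1r => k x ax.
    apply: (@le_trans _ _ (\int[leb]_(y in D k x) ((T `^ e)%:E * (u y)%:E))).
      apply: ae_le_integral_in.
      - by move=> y; rewrite lee_fin.
      - by move=> y; rewrite mule_ge0// lee_fin powR_ge0.
      apply: aeW => y _; rewrite -EFinM lee_fin /phi mulrC ler_wpM2r ?(ltW (u0 _))//.
      by apply: le_powR; [exact: ltW|exact: ltW|rewrite ge_min lexx orbT].
    rewrite ge0_integralZl_EFin ?powR_ge0//; last 2 first.
    - exact: measurable_dcube.
    - exact: measurable_funTS.
    have k0 := dmean_gt0 k x.
    rewrite integral_dcube -EFinM lee_fin (powR1e k0).
    rewrite [leRHS](_ : _ = (d + D0) * dmean k x `^ e * (dmean k x * s k))%R;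
      last by ring.
    rewrite ler_wpM2r ?mulr_ge0 ?(ltW k0) ?(ltW (s0 _))//.
    apply: (@le_trans _ _ (D0 * dmean k x `^ e)%R); last first.
      by rewrite ler_wpM2r ?powR_ge0// lerDr.
    rewrite /D0 -powRM ?(ltW k0) ?divr_ge0 ?(ltW T0) ?(ltW c00)//.
    apply: le_powR; [exact: ltW|exact: ltW|].
    by rewrite -mulrA ler_peMr ?(ltW T0)// mulrC ler_pdivlMr// mul1r hc0.
  have c0' : (0 <= d + q ^+ m * D0)%R by rewrite addr_ge0// mulr_ge0// exprn_ge0.
  have := stopping_step c0' IH.
  by rewrite mulrDr addrA -dE mulrA -exprS.
have fin : \int[leb]_(y in D 0 a) (phi y)%:E \is a fin_num.
  rewrite ge0_fin_numE; last by apply: integral_ge0 => y _; rewrite lee_fin.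
  exact: le_lt_trans (claims 0%N 0%N a erefl) (ltry _).
rewrite -(fineK fin) lee_fin; apply: (@fixed_point_bound _ _ _ _ D0) => //.
  by rewrite mulr_ge0 ?powR_ge0// ltW.
by move=> m; rewrite -lee_fin fineK// mulrA; exact: claims.
Qed.

End reverse_hoelder_dyadic.

(** As [e] tends to 0 the left-hand side tends to [1 - (2 * C)^-1 < 1]; [q] is taken halfway between
    this limit and 1, and [e] is solved for by logarithms. *)
Lemma reverse_hoelder_exponent (R : realType) (b C : R) : (1 < b)%R -> (1 <= C)%R ->
  exists e q : R, [/\ (0 < e)%R, (0 <= q < 1)%R &
    (b `^ e * (1 - (2 * C)^-1) <= q)%R].
Proof.
move=> b1 C1; have C0 : (0 < C)%R by exact: lt_le_trans C1.
set g := ((2 * C)^-1)%R.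
have g0 : (0 < g)%R by rewrite invr_gt0 mulr_gt0.
have g2 : (g <= 2^-1)%R by rewrite lef_pV2 ?posrE ?mulr_gt0// ler_peMr.
have h12 : (2^-1 < 1 :> R)%R by rewrite invf_lt1// ltr1n.
have g1 : (0 < 1 - g)%R by lra.
pose r := ((1 - g / 2) / (1 - g))%R.
have r1 : (1 < r)%R by rewrite ltr_pdivlMr// mul1r; lra.
have lb : (0 < ln b)%R by rewrite ln_gt0.
exists (ln r / ln b)%R, (1 - g / 2)%R; split.
- by rewrite divr_gt0// ln_gt0.
- by lra.
rewrite /powR gt_eqF ?(lt_trans ltr01)// divfK ?gt_eqF// lnK ?posrE ?(lt_trans ltr01)//.
by rewrite divfK// gt_eqF.
Qed.

(** A reverse Hoelder inequality bounds the mean of [u ^ (1 + e)] by the power of a mean of [u], to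
    which the A_1 condition for [u] applies. *)
Theorem reverse_hoelder (R : realType) (n : nat) (C : R) : (1 <= C)%R ->
  exists e C' : R, [/\ (0 < e)%R, (1 <= C')%R & forall u : Rn R n -> R,
    A1_weight C u -> A1_weight C' (fun x => u x `^ (1 + e))%R].
Proof.
move=> C1; have C0 : (0 < C)%R by exact: lt_le_trans C1.
have b1 : (1 < 2 ^+ n * 2 :> R)%R.
  by rewrite -exprSr exprn_egt1// ltr1n.
have [e [q [e0 q01 hq]]] := reverse_hoelder_exponent b1 C1.
have /andP[q0 q1] := q01; have q'0 : (0 < 1 - q)%R by rewrite subr_gt0.
pose d := (2 `^ (1 + e) / (1 - q))%R.
have d0 : (0 <= d)%R by rewrite divr_ge0 ?powR_ge0// ltW.
exists e, (Num.max 1 (d * 2 ^+ n * C `^ (1 + e)))%R; split=> //.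
  by rewrite le_max lexx.
move=> u hu; have [nu h] := hu; have [u0 mu iu] := nu.
apply: (@A1_weight_le _ _ (d * 2 ^+ n * C `^ (1 + e))%R); first by rewrite le_max lexx orbT.
have e1 : (0 <= 1 + e)%R by rewrite addr_ge0// ltW.
have mue : measurable_fun setT (fun x => (u x `^ (1 + e))%:E).
  by apply/measurable_EFinP; exact: measurable_fun_powR.
have bound (a : Rn R n) (l : R) (l0 : (0 < l)%R) :
    \int[lebesgue_Rn R n]_(x in cube a l) (u x `^ (1 + e))%:E <=
    (d * 2 ^+ n * dmean a (2 * l) u 0 a `^ (1 + e) * l ^+ n)%:E.
  (* The closed cube of side [l] lies in the half-open dyadic cell of side [2 * l] with the same
     corner, whence the factor [2 ^+ n]. The truncation level then tends to infinity. *)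
  have l20 : (0 < 2 * l)%R by rewrite mulr_gt0.
  have -> : cube a l = \bigcup_N (cube a l `&` [set x | (u x <= N.+1%:R)%R]).
    rewrite -setI_bigcupr setIidl// => x _; exists (Num.bound (u x)) => //=.
    by rewrite (le_trans (ltW (archi_boundP (ltW (u0 x)))))// ler_nat.
  apply: integral_bigcup_ub => //.
  - move=> i j ij; apply/subsetPset => x [ax /= ui]; split=> //=.
    by rewrite (le_trans ui)// ler_nat ltnS.
  - move=> N; apply: measurableI; first exact: measurable_cube.
    rewrite -[X in measurable X]setTI -[X in _ `&` X](_ : u @^-1` `]-oo, N.+1%:R] = _).
      by apply: mu => //; exact: measurable_itv.
    by apply/seteqP; split=> x /=; rewrite in_itv.
  - by move=> x; rewrite lee_fin powR_ge0.
  move=> N; have N0 : (0 < N.+1%:R :> R)%R by [].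
  have := truncated_reverse_hoelder a l20 C1 hu e0 N0 q01 hq.
  have -> : (2 `^ (1 + e) / (1 - q) * (dmean a (2 * l) u 0 a `^ (1 + e) *
      dside (2 * l) 0 ^+ n))%R =
      (d * 2 ^+ n * dmean a (2 * l) u 0 a `^ (1 + e) * l ^+ n)%R.
    by rewrite /dside expr0 divr1 exprMn -/d; ring.
  apply: le_trans; apply: (@le_trans _ _ (\int[lebesgue_Rn R n]_(x in
      cube a l `&` [set x | (u x <= N.+1%:R)%R])
      (u x * Num.min (u x) N.+1%:R `^ e)%:E)).
    apply: ae_le_integral_in.
    - by move=> x; rewrite lee_fin powR_ge0.
    - by move=> x; rewrite lee_fin mulr_ge0 ?powR_ge0// ltW.
    apply: aeW => x [_ /= uN]; rewrite min_l// powRDpos// powRr1//.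
    exact: ltW.
  apply: le_integral_subset.
    by move=> x; rewrite lee_fin mulr_ge0 ?powR_ge0// ltW.
  by move=> x [ax _]; apply: cube_sub_dcube0 ax => //; rewrite ltr_pMl// ltr1n.
have dm0 (a : Rn R n) (l : R) (l0 : (0 < l)%R) : (0 <= dmean a (2 * l) u 0 a)%R.
  rewrite /dmean -lock divr_ge0//.
    by rewrite fine_ge0// integral_ge0// => x _; rewrite lee_fin ltW.
  by rewrite exprn_ge0// ltW// dside_gt0// mulr_gt0.
have nue : nice (fun x => u x `^ (1 + e))%R.
  split; [by move=> x; rewrite powR_gt0|exact: measurable_fun_powR|].
  by move=> a l l0; apply: le_lt_trans (bound a l l0) (ltry _).
split=> // a l l0; have l20 : (0 < 2 * l)%R by rewrite mulr_gt0.
have := h (dcorner a (2 * l) 0 a) _ (dside_gt0 l20 0).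
apply: filterS => x hx ax.
have xD : dcube a (2 * l) 0 a x.
  by apply: cube_sub_dcube0 ax => //; rewrite ltr_pMl// ltr1n.
have {}hx := hx (dcube_sub_cube l20 xD).
have dx : (dmean a (2 * l) u 0 a <= C * u x)%R.
  by apply: le_trans hx; exact: dmean_le_mean l20 hu 0%N a.
rewrite -(@ler_pM2r _ (l ^+ n)) ?exprn_gt0//.
rewrite -lee_fin -integral_mean//; apply: le_trans (bound a l l0) _.
rewrite lee_fin ler_wpM2r ?exprn_ge0 ?(ltW l0)//.
have dn0 : (0 <= d * 2 ^+ n)%R by apply: mulr_ge0 => //; exact: exprn_ge0.
rewrite -[leRHS]mulrA ler_wpM2l//=.
by rewrite -powRM ?(ltW C0) ?(ltW (u0 x))// le_powR// dm0.
Qed.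

(** * The Fujii-Wilson constant *)

Section fujii_wilson.
Context (R : realType) (n : nat).
Implicit Types (a x : Rn R n) (l p K : R) (w : Rn R n -> R).
Local Notation leb := (lebesgue_Rn R n).

Lemma maximal_bounded_Ap p K : (1 < p)%R -> exists2 C : R, (1 <= C)%R &
  forall w, Ap_weight p K w -> maximal_bounded p C w.
Proof.
move=> p1; have p0 : (0 < p)%R by exact: lt_trans p1.
have [C C0 hC] := @muckenhoupt R n p K p1.
exists (Num.max 1 (C `^ p^-1))%R; first by rewrite le_max lexx.
move=> w hw f mf f0; have [[w0 _ _] _ _] := hw.
apply: le_trans (hC w hw f mf f0) _; apply: lee_wpmul2r.
  by apply: integral_ge0 => x _; rewrite mule_ge0 ?poweR_ge0// lee_fin ltW.
rewrite lee_fin -{1}(powRr1 C0) -(mulVf (lt0r_neq0 p0)) powRrM.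
by apply: le_powR; [exact: ltW|exact: powR_ge0|rewrite le_max lexx orbT].
Qed.

Lemma Ap_weight_cst p : (1 < p)%R -> Ap_weight p 1 (cst 1%R : Rn R n -> R).
Proof.
move=> p1; have E : (fun x : Rn R n => cst 1 x `^ (- (p - 1)^-1))%R = cst 1%R.
  by apply/funext => x; rewrite powR1.
split; rewrite ?E; [exact: nice_cst|exact: nice_cst|].
by move=> a l l0; rewrite !mean_cst// powR1 mulr1.
Qed.

Lemma avg_mean w a l : nice w -> (0 < l)%R ->
  avg (EFin \o w) (cube a l) = (mean w a l)%:E.
Proof.
move=> nw l0; rewrite /avg [X in X / _](integral_mean a nw l0).
rewrite leb_cube ?(ltW l0)// inver gt_eqF ?exprn_gt0// -EFinM mulfK//.
by rewrite gt_eqF// exprn_gt0.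
Qed.

Lemma nice_regular w : nice w -> regular_weight w.
Proof.
move=> [w0 mw iw]; split.
- split; first by move=> x; exact: ltW.
  exists (EFin \o w); first exact/measurable_EFinP.
  exact: aeW.
- by move=> _ [a [l [l0 ->]]]; exact: iw.
- exact: aeW.
Qed.

Lemma Ap_weight_Ainfty p K w : (1 < p)%R -> Ap_weight p K w -> Ainfty w.
Proof.
move=> p1 [nw ns hK]; right; exists p => //; split; first exact: nice_regular.
exists K => _ [a [l [l0 ->]]]; rewrite avg_mean//.
rewrite (avg_mean a ns l0) poweR_EFin -EFinM lee_fin.
exact: hK.
Qed.

Lemma le_maximal (f g : Rn R n -> \bar R) (r : R) x : (0 <= r)%R ->
  measurable_fun setT g ->
  (forall y, 0 <= f y) -> (forall y, 0 <= g y) ->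
  (forall y, f y <= r%:E * g y) -> maximal f x <= r%:E * maximal g x.
Proof.
move=> r0 mg f0 g0 fg; apply: maximal_le => //.
  by rewrite mule_ge0// maximal_ge0.
move=> a l l0 ax; apply: (@le_trans _ _ (r%:E * \int[leb]_(y in cube a l) g y)).
  rewrite -ge0_integralZl_EFin//; last 2 first.
  - exact: measurable_cube.
  - exact: measurable_funTS.
  apply: ae_le_integral_in => //; first by move=> y; rewrite mule_ge0.
  exact: aeW.
by rewrite muleCA; apply: lee_wpmul2l => //; exact: maximal_ge.
Qed.

Definition local_weight w a l : Rn R n -> \bar R :=
  fun y => (w y * \1_(cube a l) y)%:E.

Lemma local_weight_ge0 w a l y : (forall x, (0 <= w x)%R) ->
  0 <= local_weight w a l y.
Proof. by move=> w0; rewrite lee_fin mulr_ge0. Qed.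

Lemma measurable_local_weight w a l : measurable_fun setT w ->
  measurable_fun setT (local_weight w a l).
Proof.
move=> mw; apply/measurable_EFinP; apply: measurable_funM => //.
apply: measurable_indic; exact: measurable_cube.
Qed.

Lemma Ainfty_const_le w (K : R) : nice w ->
  (forall a l, (0 < l)%R ->
    \int[leb]_(x in cube a l) maximal (local_weight w a l) x <=
    (K * (mean w a l * l ^+ n))%:E) -> Ainfty_const w <= K%:E.
Proof.
move=> nw h; apply: ge_ereal_sup => _ [_ [a [l [l0 ->]]] <-].
have m0 : (0 < mean w a l * l ^+ n)%R by rewrite mulr_gt0 ?mean_gt0// exprn_gt0.
rewrite (integral_mean a nw l0) inver gt_eqF// lee_pdivrMr// -EFinM.
exact: h.
Qed.

Lemma Ainfty_const_ge w a l : nice w -> (0 < l)%R ->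
  \int[leb]_(x in cube a l) maximal (local_weight w a l) x <=
  (mean w a l * l ^+ n)%:E * Ainfty_const w.
Proof.
move=> nw l0.
have m0 : (0 < mean w a l * l ^+ n)%R by rewrite mulr_gt0 ?mean_gt0// exprn_gt0.
rewrite -lee_pdivrMl//; apply: ereal_sup_ubound; exists (cube a l).
  by exists a, l.
by rewrite (integral_mean a nw l0) inver gt_eqF// muleC.
Qed.

Lemma Ainfty_const_ge0 w : nice w -> 0 <= Ainfty_const w.
Proof.
move=> nw; have [w0 _ _] := nw.
have [a [l [_ l0 _ _]]] := exists_cube_sup (shift_tuple [tuple 0%R | i < n] 0) [tuple 0%R | i < n] (0 : R).
have := Ainfty_const_ge a nw l0.
have m0 : (0 < mean w a l * l ^+ n)%R by rewrite mulr_gt0 ?mean_gt0// exprn_gt0.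
rewrite -lee_pdivrMl//; apply: le_trans; apply: mule_ge0.
  by rewrite lee_fin invr_ge0 ltW.
apply: integral_ge0 => x _; apply: maximal_ge0 => y.
by apply: local_weight_ge0 => z; exact: ltW.
Qed.

(** A form of continuity: weights whose quotient is close to 1 have close Fujii-Wilson constants. *)
Lemma Ainfty_const_compare w1 w2 (r1 r2 : R) : nice w1 -> nice w2 ->
  (0 < r1)%R -> (0 < r2)%R ->
  (forall x, w2 x <= r2 * w1 x)%R -> (forall x, w1 x <= r1 * w2 x)%R ->
  Ainfty_const w2 <= (r1 * r2)%:E * Ainfty_const w1.
Proof.
move=> nw1 nw2 r10 r20 h2 h1.
have [w10 mw1 _] := nw1; have [w20 mw2 _] := nw2.
apply: ge_ereal_sup => _ [_ [a [l [l0 ->]]] <-].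
have m1 := mean_gt0 a nw1 l0; have m2 := mean_gt0 a nw2 l0.
have ln0 : (0 < l ^+ n)%R by rewrite exprn_gt0.
have ml2 : (0 < mean w2 a l * l ^+ n)%R by rewrite mulr_gt0.
rewrite (integral_mean a nw2 l0) inver gt_eqF// muleC lee_pdivrMl//.
have A0 := Ainfty_const_ge0 nw1.
have w10' z : (0 <= w1 z)%R by exact: ltW.
have w20' z : (0 <= w2 z)%R by exact: ltW.
apply: (@le_trans _ _ (r2%:E *
    \int[leb]_(x in cube a l) maximal (local_weight w1 a l) x)).
  rewrite -ge0_integralZl_EFin//; last 4 first.
  - exact: measurable_cube.
  - by move=> x _; apply: maximal_ge0 => y; exact: local_weight_ge0.
  - apply: measurable_funTS; apply: measurable_maximal => y.
    exact: local_weight_ge0.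
  - exact: ltW.
  apply: ae_le_integral_in.
  - by move=> x; apply: maximal_ge0 => y; exact: local_weight_ge0.
  - move=> x; rewrite mule_ge0 ?lee_fin ?(ltW r20)// maximal_ge0// => y.
    exact: local_weight_ge0.
  apply: aeW => x _; apply: le_maximal; [exact: ltW|exact: measurable_local_weight| | |].
  - by move=> y; exact: local_weight_ge0.
  - by move=> y; exact: local_weight_ge0.
  by move=> y; rewrite -EFinM lee_fin mulrA ler_wpM2r.
apply: (@le_trans _ _ (r2%:E * ((mean w1 a l * l ^+ n)%:E * Ainfty_const w1))).
  by apply: lee_wpmul2l; [rewrite lee_fin ltW|exact: Ainfty_const_ge].
rewrite !muleA -!EFinM; apply: lee_wpmul2r => //; rewrite lee_fin.
have h : (mean w1 a l <= r1 * mean w2 a l)%R.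
  by apply: mean_le => //; [exact: ltW|exact: aeW].
rewrite [leLHS](_ : _ = (r2 * l ^+ n) * mean w1 a l)%R; last by ring.
rewrite [leRHS](_ : _ = (r2 * l ^+ n) * (r1 * mean w2 a l))%R; last by ring.
by rewrite ler_wpM2l// mulr_ge0// ltW.
Qed.

(** The maximal operator is bounded on the unweighted L^(1/t), and the power [1 / t] of the weight
    is [A * B ^ (- (b / t))], again of factored form, so that its means are comparable to powers of
    the means of the weight. This is where [t < 1] is needed. *)
Lemma Ainfty_const_factored (C t b : R) : (1 <= C)%R -> (0 < t < 1)%R -> (0 < b)%R ->
  exists2 K : R, (0 < K)%R & forall A B : Rn R n -> R,
    A1_weight C A -> A1_weight C B ->
    Ainfty_const (fun x => A x `^ t * B x `^ (- b))%R <= K%:E.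
Proof.
move=> C1 t01 b0; have /andP[t0 t1] := t01.
have C0 : (0 < C)%R by exact: lt_le_trans C1.
have ti1 : (1 < t^-1)%R by rewrite invf_gt1.
have [K0 K01 hK0] := @maximal_bounded_Ap _ 1%R ti1.
have {}hK0 := hK0 _ (Ap_weight_cst ti1).
have K00 : (0 < K0)%R by exact: lt_le_trans K01.
exists (K0 * (C `^ b * C `^ t))%R; first by rewrite !mulr_gt0 ?powR_gt0.
move=> A B hA hB.
have t01' : (0 < t <= 1)%R by rewrite t0 ltW.
set W := (fun x => A x `^ t * B x `^ (- b))%R.
have nW : nice W by exact: (nice_factored hA hB).
have [W0 mW _] := nW; have W0' z : (0 <= W z)%R by exact: ltW.
have i1 : (0 < (1 : R) <= 1)%R by rewrite ltr01 lexx.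
have bt0 : (0 < b / t)%R by rewrite divr_gt0.
apply: Ainfty_const_le => // a l l0.
have ln0 : (0 < l ^+ n)%R by rewrite exprn_gt0.
have [[nA _] [nB _]] := (hA, hB).
have mA0 := mean_gt0 a nA l0; have mB0 := mean_gt0 a nB l0.
set g := maximal (local_weight W a l).
have lw0 y : 0 <= local_weight W a l y by exact: local_weight_ge0.
have g0 x : 0 <= g x by exact: maximal_ge0.
have mg : measurable_fun setT g by exact: measurable_maximal.
have mlw : measurable_fun setT (local_weight W a l) by exact: measurable_local_weight.
have mI : measurable_fun setT (fun x => (\1_(cube a l) x)%:E : \bar R).
  by apply/measurable_EFinP; apply: measurable_indic; exact: measurable_cube.
have -> : \int[leb]_(x in cube a l) g x =
    \int[leb]_x ((g x `^ t^-1) `^ t * (\1_(cube a l) x)%:E `^ (1 - t)).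
  rewrite integral_mkcond; apply: eq_integral => x _.
  rewrite patchE indicE -poweRrM mulVf ?gt_eqF// poweRe1//.
  case: (x \in cube a l); first by rewrite poweR1r mule1.
  by rewrite poweR0r ?mule0// gt_eqF// subr_gt0.
apply: le_trans (hoelder_geo leb t01 _ _ _ _) _ => //.
- exact: measurableT_comp (measurable_poweR _) mg.
- by move=> x; exact: poweR_ge0.
have IE : \int[leb]_x (\1_(cube a l) x)%:E = (l ^+ n)%:E.
  rewrite integral_indic ?setIT//; last exact: measurable_cube.
  by rewrite [LHS](leb_cube a (ltW l0)).
rewrite IE.
have step : \int[leb]_x (g x `^ t^-1) <=
    (K0 `^ t^-1 * (C `^ (b / t) * (mean A a l `^ 1 * mean B a l `^ (- (b / t))) * l ^+ n))%:E.
  have := hK0 _ mlw lw0; under eq_integral do rewrite mule1.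
  move=> /le_trans; apply; rewrite EFinM; apply: lee_wpmul2l.
    by rewrite lee_fin powR_ge0.
  apply: (@le_trans _ _ (\int[leb]_(x in cube a l)
      (A x `^ 1 * B x `^ (- (b / t)))%:E)).
    rewrite [leRHS]integral_mkcond; apply: le_integralT.
      by move=> x; rewrite mule_ge0 ?poweR_ge0.
    move=> x; rewrite mule1 patchE /local_weight indicE.
    case: (x \in cube a l); last by rewrite mulr0 poweR0r// invr_eq0 gt_eqF.
    rewrite mulr1 poweR_EFin lee_fin /W powRM ?powR_ge0// -!powRrM mulfV ?gt_eqF//.
    by rewrite mulNr.
  rewrite integral_mean//; last exact: (nice_factored hA hB).
  rewrite lee_fin ler_wpM2r ?(ltW ln0)//.
  exact: mean_factored_le.
have h0 : 0 <= \int[leb]_x (g x `^ t^-1).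
  by apply: integral_ge0 => x _; exact: poweR_ge0.
apply: (@le_trans _ _ ((K0 `^ t^-1 * (C `^ (b / t) * (mean A a l `^ 1 *
    mean B a l `^ (- (b / t))) * l ^+ n))%:E `^ t * (l ^+ n)%:E `^ (1 - t))).
  by apply: lee_wpmul2r; [exact: poweR_ge0|apply: le_poweR => //; exact: ltW].
rewrite !poweR_EFin -EFinM lee_fin.
rewrite !powRM ?mulr_ge0 ?powR_ge0 ?(ltW ln0)// -!powRrM mulVf ?gt_eqF// mul1r.
rewrite mulNr divfK ?gt_eqF// (powRr1 (ltW K00)).
rewrite [leLHS](_ : _ = K0 * (C `^ b * (mean A a l `^ t * mean B a l `^ (- b)) *
    ((l ^+ n) `^ t * (l ^+ n) `^ (1 - t))))%R; last by ring.
rewrite -powRDpos// [(t + _)%R]addrC subrK (powRr1 (ltW ln0)).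
rewrite [leRHS](_ : _ = K0 * (C `^ b * (C `^ t * mean W a l) * l ^+ n))%R; last by ring.
rewrite ler_wpM2l ?(ltW K00)// ler_wpM2r ?(ltW ln0)// ler_wpM2l ?powR_ge0//.
exact: mean_factored_ge.
Qed.

End fujii_wilson.

(** Since [a * c a] does not decrease, [c] has no downward jump, and this suffices for an
    intermediate value at the supremum of the points where [c] is at least [K]. *)
Lemma scaling_ivt (R : realType) (c : R -> R) (e K : R) : (0 < e <= 1)%R -> (0 < K)%R ->
  (forall a b, e <= a -> a <= b -> b <= 1 ->
    a * c a <= b * c b /\ a * c b <= b * c a)%R ->
  (K <= c e)%R -> (c 1 <= K)%R -> exists2 s, (e <= s <= 1)%R & c s = K.
Proof.
move=> /andP[e0 e1] K0 h he h1.
pose S := [set a : R | (e <= a <= 1)%R /\ (K <= c a)%R].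
have Se : S e by split; rewrite ?lexx.
have Su : has_ubound S by exists 1%R => a [/andP[]].
have Ss : has_sup S by split; [exists e|].
set s := sup S.
have es : (e <= s)%R by exact: ub_le_sup.
have s1 : (s <= 1)%R by apply: ge_sup; [exists e|move=> a [/andP[]]].
have s0 : (0 < s)%R by exact: lt_le_trans es.
exists s; first by rewrite es.
apply/eqP; rewrite eq_le; apply/andP; split; rewrite leNgt; apply/negP => csK.
  have s1' : (s < 1)%R.
    rewrite lt_neqAle s1 andbT; apply/negP => /eqP sE.
    by move: csK; rewrite sE ltNge h1.
  (* To the right of [s] the function is at least [s * c s / b], hence still at least [K] at this
     [b]. *)
  pose b := (Num.min 1 (s * c s / K))%R.
  have sb : (s < b)%R.
    by rewrite lt_min s1' ltr_pdivlMr// ltr_pM2l.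
  have b1 : (b <= 1)%R by rewrite ge_min lexx.
  have b0 : (0 < b)%R by exact: lt_trans sb.
  have : (b <= s)%R.
    apply: ub_le_sup => //; split; first by rewrite b1 (le_trans es (ltW sb)).
    rewrite -(ler_pM2l b0); apply: le_trans (h s b es (ltW sb) b1).1.
    by rewrite -ler_pdivlMr// ge_min lexx orbT.
  by rewrite leNgt sb.
have : (s * (c s / K) < s)%R by rewrite gtr_pMr// ltr_pdivrMr// mul1r.
move=> /sup_gt[]; first by exists e.
move=> a [/andP[ea a1] Ka] csa.
have as_ : (a <= s)%R by apply: ub_le_sup => //; rewrite /S /= ea.
have := (h a s ea as_ s1).1.
rewrite leNgt => /negP; apply.
apply: (@lt_le_trans _ _ (a * K)%R); last by rewrite ler_pM2l// (lt_le_trans e0 ea).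
by move: csa; rewrite -(ltr_pM2r K0) -mulrA divfK// lt0r_neq0.
Qed.

Section damping.
Context (R : realType) (n : nat).
Implicit Types (a x : Rn R n) (l p K : R) (w : Rn R n -> R).
Local Notation leb := (lebesgue_Rn R n).

Lemma Ap_weight_compare w w' p K (r : R) : (1 < p)%R -> (0 < r)%R ->
  measurable_fun setT w' -> (forall x, r * w x <= w' x <= w x)%R ->
  Ap_weight p K w -> Ap_weight p (K / r) w'.
Proof.
move=> p1 r0 mw' ww' [nw ns hK]; have [w0 mw _] := nw.
have p10 : (0 < p - 1)%R by rewrite subr_gt0.
have w'0 x : (0 < w' x)%R.
  by have /andP[+ _] := ww' x; apply: lt_le_trans; rewrite mulr_gt0.
have sle x : (w' x `^ (- (p - 1)^-1) <= r `^ (- (p - 1)^-1) * w x `^ (- (p - 1)^-1))%R.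
  rewrite -powRM ?(ltW r0) ?(ltW (w0 x))//.
  have /andP[h _] := ww' x.
  by apply: ge_powRN h; rewrite ?mulr_gt0// invr_ge0 ltW.
have nw' : nice w'.
  apply: nice_le => // a l l0; exists w => //; exists 1%R => //.
  by apply: aeW => x _; rewrite mul1r; have /andP[] := ww' x.
have ns' : nice (fun x => w' x `^ (- (p - 1)^-1))%R.
  apply: nice_le; [by move=> x; rewrite powR_gt0|exact: measurable_fun_powR|].
  move=> a l l0; eexists; first exact: ns.
  by eexists; [|apply: aeW => x _; exact: sle]; exact: powR_ge0.
split => // a l l0; apply: le_trans (_ : _ <= r^-1 * (mean w a l *
    mean (fun x => w x `^ (- (p - 1)^-1))%R a l `^ (p - 1)))%R _; last first.
  by rewrite [leRHS]mulrC ler_wpM2l ?invr_ge0 ?(ltW r0)// hK.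
have h1 : (mean w' a l <= 1 * mean w a l)%R.
  by apply: mean_le => //; apply: aeW => x _; rewrite mul1r; have /andP[] := ww' x.
have h2 := mean_le ns' ns l0 (powR_ge0 _ _) (aeW _ (fun x (_ : cube a l x) => sle x)).
rewrite mul1r in h1; rewrite mulrCA; apply: ler_pM => //.
- exact/ltW/mean_gt0.
- exact: powR_ge0.
apply: le_trans (le_powR (ltW p10) _ h2) _; first exact/ltW/mean_gt0.
rewrite powRM ?powR_ge0 ?(ltW (mean_gt0 _ ns l0))// -powRrM mulNr mulVf ?gt_eqF//.
by rewrite powR_inv1 // ltW.
Qed.

Lemma Ap_weight_double w p K a l : (1 < p)%R -> Ap_weight p K w -> (0 < l)%R ->
  (mean w a (2 * l) * (2 * l) ^+ n <=
   K * (3 ^+ n) `^ (p - 1) * 3 ^+ n * (mean w a l * l ^+ n))%R.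
Proof.
move=> p1 [nw ns hK] l0; have [w0 mw _] := nw.
have p10 : (0 < p - 1)%R by rewrite subr_gt0.
rewrite -lee_fin -integral_mean ?mulr_gt0//.
have ws x : (w x = (w x `^ (- (p - 1)^-1)) `^ (- (p - 1)))%R.
  by rewrite -powRrM mulrNN mulVf ?gt_eqF// powRr1// ltW.
apply: le_trans (Ap_doubling a nw ns p10 ws l0 hK).
apply: le_integral_subset; first by move=> x; rewrite lee_fin ltW.
move=> x ax i; have /andP[h1 h2] := ax i; rewrite tnth_mktuple.
by apply/andP; split; lra.
Qed.

Definition origin_cube (k : nat) := cube [tuple 0%R | i < n] (2 ^+ k : R).

Lemma origin_cube_nd k N : (k <= N)%N -> origin_cube k `<=` origin_cube N.
Proof.
move=> kN x hx i; have := hx i; rewrite tnth_mktuple !add0r => /andP[-> /=].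
by move=> /le_trans; apply; rewrite ler_weXn2l// ler1n.
Qed.

(* On each of the annuli [cube 0 (2 ^ k.+1)] minus [cube 0 (2 ^ k)] the maximal
   function is at least the mean over the larger cube, so each of them
   contributes at least half of the mass of the unit cube. *)
Lemma integral_maximal_annuli w N : (0 < n)%N -> nice w ->
  (N%:R / 2 * mean w [tuple 0%R | i < n] 1)%:E <=
  \int[leb]_(x in origin_cube N) maximal (local_weight w [tuple 0%R | i < n] (2 ^+ N)) x.
Proof.
move=> n0 nw; have [w0 mw _] := nw.
set o := [tuple 0%R | i < n]; set g := maximal _.
have lw0 y : 0 <= local_weight w o (2 ^+ N) y.
  by apply: local_weight_ge0 => z; exact: ltW.
have g0 x : 0 <= g x by exact: maximal_ge0.
have mg : measurable_fun setT g by exact: measurable_maximal.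
suff H k : (k <= N)%N -> (k%:R / 2 * mean w o 1)%:E <= \int[leb]_(x in origin_cube k) g x.
  exact: H.
elim: k => [_|k IH kN]; first by rewrite !mul0r; apply: integral_ge0.
have mB j : measurable (origin_cube j) by exact: measurable_cube.
have m0 : (0 < mean w o 1)%R by exact: mean_gt0.
set D := origin_cube k.+1 `\` origin_cube k.
have mD : measurable D by exact: measurableD.
have sub : origin_cube k `<=` origin_cube k.+1 by exact: origin_cube_nd.
rewrite (_ : origin_cube k.+1 = origin_cube k `|` D); last by rewrite setDUK.
rewrite ge0_integral_setU//; last 2 first.
- exact: measurable_funTS.
- by apply/disj_setPS => x [? []].
rewrite -addn1 natrD 2!mulrDl EFinD; apply: leeD; first exact/IH/ltnW.
have c0 : (0 < (2 : R) ^+ k.+1)%R by rewrite exprn_gt0.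
have d0 : (0 < ((2 : R) ^+ k.+1) ^+ n)%R by rewrite exprn_gt0.
apply: (@le_trans _ _ (\int[leb]_(x in D) (cst (((2 ^+ k.+1) ^+ n)^-1 * mean w o 1)%:E x))).
  rewrite integral_cst//= [X in _ * X](_ : _ = ((2 ^+ k.+1) ^+ n - (2 ^+ k) ^+ n)%:E); last first.
    rewrite measureD//; last first.
      by rewrite /origin_cube [X in X < _](leb_cube _ (ltW c0)) ltry.
    rewrite setIidr// EFinB; congr (_ - _).
      exact: (leb_cube _ (ltW c0)).
    by apply: (leb_cube o); rewrite exprn_ge0.
  rewrite -EFinM lee_fin [leRHS]mulrAC ler_pM2r// mul1r ler_pdivlMl//.
  (* As [n] is positive, the annulus has at least half of the volume of the larger cube. *)
  suff : ((2 ^+ k) ^+ n * 2 <= (2 ^+ k.+1) ^+ n :> R)%R by lra.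
  rewrite exprS exprMn mulrC ler_wpM2r// ?exprn_ge0//.
  by rewrite -[leLHS]expr1 ler_weXn2l// ler1n.
apply: ae_le_integral_in => //.
  by move=> x; rewrite lee_fin mulr_ge0 ?invr_ge0 ?(ltW d0)// ltW.
apply: aeW => x [Dx _].
rewrite EFinM lee_pdivrMl//; apply: le_trans (maximal_ge lw0 c0 Dx).
apply: (@le_trans _ _ (\int[leb]_(y in cube o 1) (w y)%:E)).
  by rewrite integral_mean// expr1n mulr1.
apply: (@le_trans _ _ (\int[leb]_(y in cube o 1) local_weight w o (2 ^+ N) y)).
  apply: ae_le_integral_in => //; first by move=> y; rewrite lee_fin ltW.
  apply: aeW => y oy; rewrite /local_weight indicE mem_set ?mulr1//.
  by apply: (@origin_cube_nd 0 N) => //; rewrite /origin_cube expr0.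
apply: le_integral_subset => //.
by have := @origin_cube_nd 0 k.+1; rewrite /origin_cube expr0; apply.
Qed.

(** For small [e] the mass of a large cube is concentrated on the unit cube; the weight then looks
    like a point mass, whose Fujii-Wilson quotient grows with the logarithm of the side of the
    cube. *)
Definition damp w (e : R) x : R := (w x * (e + (1 - e) * \1_(origin_cube 0) x))%R.

Lemma damp1 w : damp w 1 = w.
Proof. by apply/funext => x; rewrite /damp subrr mul0r addr0 mulr1. Qed.

Lemma damp_bound w (e : R) x : (0 <= w x)%R -> (0 < e <= 1)%R ->
  (e * w x <= damp w e x <= w x)%R.
Proof.
move=> w0 /andP[e0 e1]; rewrite /damp indicE.
by case: (x \in _); rewrite /= ?mulr1 ?mulr0; apply/andP; split; nra.
Qed.

Lemma damp_mono w (e e' : R) x : (0 <= w x)%R -> (0 < e)%R -> (e <= e')%R -> (e' <= 1)%R ->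
  (damp w e x <= damp w e' x /\ e * damp w e' x <= e' * damp w e x)%R.
Proof.
move=> w0 e0 ee' e'1; rewrite /damp indicE.
have h : (e * w x <= e' * w x)%R by rewrite ler_wpM2r.
by case: (x \in _); rewrite /= ?mulr1 ?mulr0; split; nra.
Qed.

Lemma measurable_damp w (e : R) : measurable_fun setT w ->
  measurable_fun setT (damp w e).
Proof.
move=> mw; apply: measurable_funM => //; apply: measurable_funD => //.
apply: measurable_funM => //; apply: measurable_indic; exact: measurable_cube.
Qed.

Lemma nice_damp w (e : R) : nice w -> (0 < e <= 1)%R -> nice (damp w e).
Proof.
move=> nw e01; have [w0 mw _] := nw; have /andP[e0 _] := e01.
apply: nice_le; [|exact: measurable_damp|].
  move=> x; have /andP[+ _] := damp_bound (ltW (w0 x)) e01.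
  by apply: lt_le_trans; rewrite mulr_gt0.
move=> a l l0; exists w => //; exists 1%R => //; apply: aeW => x _.
by rewrite mul1r; have /andP[] := damp_bound (ltW (w0 x)) e01.
Qed.

(** By the hypothesis on [e] the large cube has at most twice the mass of the unit cube, whereas the
    [N] annuli contribute [N / 2] times the latter to the integral of the maximal function. *)
Lemma Ainfty_const_damp w (e : R) N : (0 < n)%N -> nice w -> (0 < e <= 1)%R ->
  (e * (mean w [tuple 0%R | i < n] (2 ^+ N) * (2 ^+ N) ^+ n) <=
   mean w [tuple 0%R | i < n] 1)%R ->
  (N%:R / 4)%:E <= Ainfty_const (damp w e).
Proof.
set o := [tuple 0%R | i < n] => n0 nw e01 h.
have [w0 mw _] := nw; have /andP[e0 e1] := e01.
have c0 : (0 < (2 : R) ^+ N)%R by rewrite exprn_gt0.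
have m0 : (0 < mean w o 1)%R by exact: mean_gt0.
have nd : nice (damp w e) by exact: nice_damp.
have [d0 md _] := nd.
have E1 : mean (damp w e) o 1 = mean w o 1.
  have sub x : cube o 1 x -> damp w e x = w x.
    by move=> ox; rewrite /damp /origin_cube expr0 indicE mem_set// mulr1 addrC subrK mulr1.
  apply/eqP; rewrite eq_le -[leRHS]mul1r -[X in _ && (_ <= X)%R]mul1r.
  by apply/andP; split; apply: mean_le => //; apply: aeW => x /sub ->; rewrite mul1r.
have := integral_maximal_annuli N n0 nd; rewrite -/o E1.
move=> /le_trans/(_ (Ainfty_const_ge o nd c0)).
have : (mean (damp w e) o (2 ^+ N) * (2 ^+ N) ^+ n <= 2 * mean w o 1)%R.
  rewrite -lee_fin -integral_mean//.
  apply: (@le_trans _ _ (\int[leb]_(x in cube o (2 ^+ N)) (e%:E * (w x)%:E + (w x * \1_(cube o 1) x)%:E))).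
    apply: ae_le_integral_in.
    - by move=> x; rewrite lee_fin ltW.
    - move=> x; apply: adde_ge0; rewrite lee_fin mulr_ge0 ?(ltW e0)//; exact: ltW.
    apply: aeW => x _; rewrite -EFinM -EFinD lee_fin /damp /origin_cube expr0 indicE.
    by have := w0 x; case: (x \in _); rewrite /= ?mulr1 ?mulr0; nra.
  have mI : measurable_fun setT (fun x => (w x * \1_(cube o 1) x)%:E).
    apply/measurable_EFinP; apply: measurable_funM => //.
    apply: measurable_indic; exact: measurable_cube.
  rewrite ge0_integralD//; last 5 first.
  - exact: measurable_cube.
  - by move=> x _; rewrite lee_fin mulr_ge0 ?(ltW e0) ?(ltW (w0 x)).
  - by apply: measurable_funTS; apply: measurable_funeM; exact/measurable_EFinP.
  - by move=> x _; rewrite lee_fin mulr_ge0 ?(ltW (w0 x)).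
  - exact: measurable_funTS.
  rewrite integral_cubeZl ?(ltW e0)//; last by move=> x; exact: ltW.
  rewrite integral_mean// mulrDl mul1r EFinD; apply: leeD.
    by rewrite -EFinM lee_fin.
  apply: (@le_trans _ _ (\int[leb]_(x in cube o 1) (w x)%:E)); last first.
    by rewrite integral_mean// expr1n mulr1.
  rewrite [leRHS]integral_mkcond; apply: le_trans (le_integral_subset _ _ (@subsetT _ _)) _.
    by move=> x; rewrite lee_fin mulr_ge0 ?(ltW (w0 x)).
  apply: le_integralT => x; first by rewrite lee_fin mulr_ge0 ?(ltW (w0 x)).
  rewrite patchE indicE.
  by case: (x \in cube o 1) => /=; rewrite ?mulr1 ?mulr0.
have A0 := Ainfty_const_ge0 nd.
move=> h1 h2.
have {}h2 := le_trans h2 (lee_wpmul2r A0 (_ : (_%:E <= (2 * mean w o 1)%:E)%E)).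
have {h2} := h2 h1.
rewrite -lee_pdivrMl ?mulr_gt0// -EFinM; congr (_%:E <= _).
by field; rewrite gt_eqF.
Qed.

(* The constant varies continuously between [w] and a strongly damped [w], whose
   constant is large: this is how a bound that depends on the constant through an
   arbitrary function is made uniform. *)
Lemma prescribed_Ainfty_const p K K0 : (0 < n)%N -> (1 < p)%R ->
  exists e K' : R, (0 < e)%R /\ forall w, Ap_weight p K w ->
    Ainfty_const w <= K0%:E ->
    exists w', [/\ Ainfty w', Ainfty_const w' = K'%:E &
      forall x, (e * w x <= w' x <= w x)%R].
Proof.
move=> n0 p1; have p10 : (0 < p - 1)%R by rewrite subr_gt0.
(* A positive value that no constant of the given weights exceeds; [N] is such that enough damping
   lifts the constant above it. *)
pose K' := Num.max K0 1%R; pose N := (Num.truncn (4 * K')).+1.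
have K'0 : (0 < K')%R by rewrite lt_max ltr01 orbT.
have NK' : (K' <= N%:R / 4)%R.
  by rewrite ler_pdivlMr// mulrC ltW// truncnS_gt.
pose D := Num.max 1%R (K * (3 ^+ n) `^ (p - 1) * 3 ^+ n)%R.
have D1 : (1 <= D)%R by rewrite le_max lexx.
have D0 : (0 < D)%R by exact: lt_le_trans D1.
(* Each doubling of the cube multiplies its mass by at most [D], so this factor brings the mass of
   the cube of side [2 ^+ N] down to that of the unit cube. *)
pose e := (D ^- N)%R.
have e0 : (0 < e)%R by rewrite invr_gt0 exprn_gt0.
have e1 : (e <= 1)%R by rewrite invf_le1 ?exprn_gt0// exprn_ege1.
exists e, K'; split => // w hw cw; have [nw ns hK] := hw; have [w0 mw _] := nw.
pose o : Rn R n := [tuple 0%R | i < n].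
have dbl k : (mean w o (2 ^+ k) * (2 ^+ k) ^+ n <= D ^+ k * mean w o 1)%R.
  elim: k => [|k IH]; first by rewrite !expr0 expr1n mulr1 mul1r.
  have c0 : (0 < (2 : R) ^+ k)%R by rewrite exprn_gt0.
  rewrite [(2 ^+ k.+1)%R]exprS; apply: le_trans (Ap_weight_double o p1 hw c0) _.
  rewrite exprS -[leRHS]mulrA; apply: le_trans (ler_wpM2l (ltW D0) IH).
  rewrite ler_wpM2r ?le_max ?lexx ?orbT//.
  by rewrite mulr_ge0 ?exprn_ge0 ?(ltW (mean_gt0 o nw c0)) ?(ltW c0).
have e01 : (0 < e <= 1)%R by rewrite e0.
have ce : (N%:R / 4)%:E <= Ainfty_const (damp w e).
  by apply: Ainfty_const_damp => //; rewrite ler_pdivrMl ?exprn_gt0.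
have cmp (a b : R) : (e <= a)%R -> (a <= b)%R -> (b <= 1)%R ->
    Ainfty_const (damp w a) <= (b / a)%:E * Ainfty_const (damp w b) /\
    Ainfty_const (damp w b) <= (b / a)%:E * Ainfty_const (damp w a).
  move=> ea ab b1; have a0 := lt_le_trans e0 ea; have b0 := lt_le_trans a0 ab.
  have na : nice (damp w a) by apply: nice_damp => //; rewrite a0 (le_trans ab).
  have nb : nice (damp w b) by apply: nice_damp => //; rewrite b0.
  have h x := damp_mono (ltW (w0 x)) a0 ab b1.
  have ba0 : (0 < b / a)%R by rewrite divr_gt0.
  have h2 x : (damp w b x <= b / a * damp w a x)%R.
    by rewrite mulrAC ler_pdivlMr// mulrC (h x).2.
  split.
    rewrite -[(b / a)%R]mulr1; apply: Ainfty_const_compare => // x.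
    by rewrite mul1r (h x).1.
  rewrite -[(b / a)%R]mul1r; apply: Ainfty_const_compare => // x.
  by rewrite mul1r (h x).1.
pose c (a : R) := fine (Ainfty_const (damp w a)).
have cE (a : R) : (e <= a <= 1)%R -> Ainfty_const (damp w a) = (c a)%:E.
  move=> /andP[ea a1]; have a0 := lt_le_trans e0 ea.
  have na : nice (damp w a) by apply: nice_damp => //; rewrite a0.
  rewrite fineK// ge0_fin_numE ?Ainfty_const_ge0//.
  apply: le_lt_trans (cmp a 1%R ea a1 (lexx _)).1 _; rewrite damp1.
  apply: (@le_lt_trans _ _ ((1 / a)%:E * K0%:E)); last by rewrite -EFinM ltry.
  by apply: lee_wpmul2l => //; rewrite lee_fin divr_ge0// ltW.
have [|||s es sK] := @scaling_ivt R c e K' e01 K'0.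
- move=> a b ea ab b1.
  have a0 := lt_le_trans e0 ea.
  have ea1 : (e <= a <= 1)%R by rewrite ea (le_trans ab b1).
  have eb1 : (e <= b <= 1)%R by rewrite b1 (le_trans ea ab).
  have real (y z : R) : y%:E <= (b / a)%:E * z%:E -> (a * y <= b * z)%R.
    by rewrite -EFinM lee_fin mulrAC ler_pdivlMr// [(y * a)%R]mulrC.
  have [h2 h3] := cmp _ _ ea ab b1; rewrite (cE _ ea1) (cE _ eb1) in h2.
  by rewrite (cE _ ea1) (cE _ eb1) in h3; split; exact: real.
- by rewrite -lee_fin -cE ?lexx//; apply: le_trans ce; rewrite lee_fin.
- rewrite -lee_fin -cE ?lexx ?e1// damp1; apply: le_trans cw _.
  by rewrite lee_fin le_max lexx.
have /andP[es1 s1] := es; have s0 := lt_le_trans e0 es1.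
have s01 : (0 < s <= 1)%R by rewrite s0.
exists (damp w s); split; last 2 first.
- by rewrite cE// sK.
- move=> x; have /andP[h ->] := damp_bound (ltW (w0 x)) s01; rewrite andbT.
  by apply: le_trans h; rewrite ler_pM2r.
apply: (@Ap_weight_Ainfty _ _ p (K / s)) => //.
apply: (@Ap_weight_compare w) => //; first exact: measurable_damp.
by move=> x; exact: damp_bound (ltW (w0 x)) s01.
Qed.

End damping.

(** * Extrapolation of strong type estimates *)

Section good_pairs.
Context (R : realType) (n : nat).
Implicit Types (x : Rn R n) (p q t b C K : R) (w A B : Rn R n -> R).
Implicit Types (f g : Rn R n -> \bar R).
Implicit Types (G : set ((Rn R n -> \bar R) * (Rn R n -> \bar R))).
Local Notation leb := (lebesgue_Rn R n).

Definition factored A B t b x : R := (A x `^ t * B x `^ (- b))%R.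

(** The weights to be used are built from the pair [(f, g)]; therefore [K] comes before [A] and [B],
    which enter only through the bound [C] for their A_1 constants. *)
Definition good G p : Prop :=
  forall t b C, (0 < t < 1)%R -> (0 < b)%R -> (1 <= C)%R ->
  exists2 K, (0 < K)%R & forall A B, A1_weight C A -> A1_weight C B ->
    forall f g, G (f, g) ->
    \int[leb]_x (f x `^ p * (factored A B t b x)%:E) < +oo ->
    \int[leb]_x (f x `^ p * (factored A B t b x)%:E) <=
    K%:E * \int[leb]_x (g x `^ p * (factored A B t b x)%:E).

Definition borel_pairs G : Prop := forall f g, G (f, g) ->
  [/\ measurable_fun setT f, measurable_fun setT g,
      forall x, 0 <= f x & forall x, 0 <= g x].

(** Hypothesis and conclusion only see functions up to null sets, so the whole extrapolation can be
    carried out with Borel functions. *)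
Definition borel_version G := [set fg : (Rn R n -> \bar R) * (Rn R n -> \bar R) |
  [/\ measurable_fun setT fg.1, measurable_fun setT fg.2,
      forall x, 0 <= fg.1 x & forall x, 0 <= fg.2 x] /\
  exists f g, [/\ G (f, g), \forall x \ae leb, f x = fg.1 x &
    \forall x \ae leb, g x = fg.2 x]].

Lemma borel_version_borel G : borel_pairs (borel_version G).
Proof. by move=> f g []. Qed.

Lemma measurable_poweR_mul f w p : measurable_fun setT f -> measurable_fun setT w ->
  measurable_fun setT (fun x => f x `^ p * (w x)%:E).
Proof.
move=> mf mw; apply: emeasurable_funM; last exact/measurable_EFinP.
exact: measurableT_comp (measurable_poweR _) mf.
Qed.

Lemma poweR_mul_ge0 f w p x : (forall x, (0 < w x)%R) -> 0 <= f x `^ p * (w x)%:E.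
Proof. by move=> w0; rewrite mule_ge0 ?poweR_ge0// lee_fin ltW. Qed.

Lemma good_Ainfty G p : (0 < n)%N -> Ainfty_comparable G p -> good (borel_version G) p.
Proof.
move=> n0 [phi phi0 hphi] t b C t01 b0 C1; have /andP[t0 t1] := t01.
have C0 : (0 < C)%R by exact: lt_le_trans C1.
have b1 : (1 < 1 + b)%R by rewrite ltrDl.
have [K0 _ hK0] := @Ainfty_const_factored R n C t b C1 t01 b0.
have [e [K' [e0 H]]] := @prescribed_Ainfty_const R n (1 + b) (C `^ b * C `^ t) K0 n0 b1.
(* [phi] is evaluated at the single value [K']; [e^-1] is the price of passing from the weight to
   [w']. *)
exists (e^-1 * phi K'%:E)%R; first by rewrite mulr_gt0 ?invr_gt0.
move=> A B hA hB f g [/= [mf mg f0 g0] [f1 [g1 [Gfg fE gE]]]].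
have t01' : (0 < t <= 1)%R by rewrite t0 ltW.
have hW := Ap_factored hA hB C0 t01' b0.
have [nW _ _] := hW; have [W0 mW _] := nW.
have [w' [Aw' cw' ww']] := H _ hW (hK0 _ _ hA hB).
have w'0 x : (0 < w' x)%R.
  by have /andP[+ _] := ww' x; apply: lt_le_trans; rewrite mulr_gt0.
rewrite -/(factored A B t b) in hW nW W0 mW ww' *.
have transfer f2 f3 : (\forall x \ae leb, f2 x = f3 x) ->
    \int[leb]_x (f2 x `^ p * (w' x)%:E) = \int[leb]_x (f3 x `^ p * (w' x)%:E).
  move=> h; apply: ae_eq_integralT => [x|x|]; [exact: poweR_mul_ge0|exact: poweR_mul_ge0|].
  by apply: filterS h => x ->.
have le_w f2 : \int[leb]_x (f2 x `^ p * (w' x)%:E) <=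
    \int[leb]_x (f2 x `^ p * (factored A B t b x)%:E).
  apply: le_integralT => x; first exact: poweR_mul_ge0.
  by apply: lee_wpmul2l; [exact: poweR_ge0|rewrite lee_fin; have /andP[] := ww' x].
move=> foo; rewrite EFinM -muleA lee_pdivlMl//.
rewrite -ge0_integralZl_EFin//; last 3 first.
- by move=> x _; exact: poweR_mul_ge0.
- exact: measurable_poweR_mul.
- exact: ltW.
apply: (@le_trans _ _ (\int[leb]_x (f x `^ p * (w' x)%:E))).
  apply: le_integralT => x; first by rewrite mule_ge0 ?lee_fin ?(ltW e0)// poweR_mul_ge0.
  rewrite muleCA; apply: lee_wpmul2l; first exact: poweR_ge0.
  by rewrite -EFinM lee_fin; have /andP[] := ww' x.
rewrite -(transfer _ _ fE); apply: le_trans (hphi _ Aw' _ _ Gfg _) _.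
  by rewrite (transfer _ _ fE); exact: le_lt_trans foo.
rewrite cw' (transfer _ _ gE); apply: lee_wpmul2l => //.
by rewrite lee_fin ltW.
Qed.

Lemma A1_weight_geomean C A B s : (1 <= C)%R -> (0 < s < 1)%R ->
  A1_weight C A -> A1_weight C B -> A1_weight C (fun x => A x `^ s * B x `^ (1 - s))%R.
Proof.
move=> C1 s01 [nA hA] [nB hB]; have /andP[s0 s1] := s01.
have C0 : (0 < C)%R by exact: lt_le_trans C1.
have [nAB hAB] := mean_hoelder s01 nA nB.
split => // a l l0; move: (hA a l l0) (hB a l l0); apply: filterS2 => x hAx hBx ax.
have [A0 _ _] := nA; have [B0 _ _] := nB.
apply: le_trans (hAB a l l0) _.
apply: (@le_trans _ _ ((C * A x) `^ s * (C * B x) `^ (1 - s))%R).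
  apply: ler_pM; rewrite ?powR_ge0//; apply: le_powR; rewrite ?subr_ge0 ?(ltW s0) ?(ltW s1)//.
  - by apply: mean_ge0 (ltW l0) => y; exact: ltW.
  - exact: hAx.
  - by apply: mean_ge0 (ltW l0) => y; exact: ltW.
  - exact: hBx.
rewrite !powRM ?(ltW C0) ?(ltW (A0 x)) ?(ltW (B0 x))//.
rewrite mulrACA -powRDpos// [(s + _)%R]addrC subrK powRr1 ?(ltW C0)//.
Qed.

(* [A^t B^-b Y^-c] is again factored, the negative powers being a single
   negative power of a geometric mean. *)
Lemma factored_mulN C A B Y t b c : (1 <= C)%R -> (0 < b)%R -> (0 < c)%R ->
  A1_weight C B -> A1_weight C Y -> exists2 Z, A1_weight C Z &
  forall x, (factored A B t b x * Y x `^ (- c))%R = factored A Z t (b + c) x.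
Proof.
move=> C1 b0 c0 hB hY; have bc0 : (0 < b + c)%R by rewrite addr_gt0.
have bcn : (b + c)%R != 0%R by rewrite gt_eqF.
have s01 : (0 < b / (b + c) < 1)%R.
  by rewrite divr_gt0//= ltr_pdivrMr// mul1r ltrDl.
have [[B0 _ _] _] := hB; have [[Y0 _ _] _] := hY.
eexists; first exact: (A1_weight_geomean C1 s01 hB hY).
move=> x; rewrite /factored -mulrA powRM ?powR_ge0// -!powRrM.
by congr (_ * (_ `^ _ * _ `^ _))%R; field.
Qed.

(** The counterpart of [factored_mulN] for positive powers: [X ^ s] and [A ^ (t * c)] merge into one
    power of a geometric mean. *)
Lemma factored_mulp C A B X t s b c : (1 <= C)%R -> (0 < t)%R -> (0 < s)%R -> (0 < c)%R ->
  A1_weight C A -> A1_weight C X -> (forall x, 0 < B x)%R -> exists2 Z, A1_weight C Z &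
  forall x, (X x `^ s * factored A B t b x `^ c)%R = factored Z B (s + t * c) (b * c) x.
Proof.
move=> C1 t0 s0 c0 hA hX B0; have tc0 : (0 < t * c)%R by rewrite mulr_gt0.
have st0 : (0 < s + t * c)%R by rewrite addr_gt0.
have stn : (s + t * c)%R != 0%R by rewrite gt_eqF.
have s01 : (0 < s / (s + t * c) < 1)%R.
  by rewrite divr_gt0//= ltr_pdivrMr// mul1r ltrDl.
have [[A0 _ _] _] := hA; have [[X0 _ _] _] := hX.
eexists; first exact: (A1_weight_geomean C1 s01 hX hA).
move=> x; rewrite /factored !powRM ?powR_ge0// -!powRrM mulrA.
by congr (_ `^ _ * _ `^ _ * _ `^ _)%R; field.
Qed.

Lemma gt0_le_fin (I : \bar R) : 0 < I -> I < +oo -> exists2 r : R, (0 < r)%R & I = r%:E.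
Proof. by case: I => // r; rewrite lte_fin => r0 _; exists r. Qed.

Definition lq_pairs q G := [set fg : (Rn R n -> \bar R) * (Rn R n -> \bar R) |
  exists f g : nat -> Rn R n -> \bar R, (forall j, G (f j, g j)) /\
    fg = (lq_sum q f, lq_sum q g)].

Lemma lq_pairs_borel q G : borel_pairs G -> borel_pairs (lq_pairs q G).
Proof.
move=> bG _ _ [f [g [fg [-> ->]]]].
have m (h : nat -> Rn R n -> \bar R) : (forall j, measurable_fun setT (h j)) ->
    measurable_fun setT (lq_sum q h).
  move=> mh; apply: measurableT_comp (measurable_poweR _) _.
  apply: ge0_emeasurable_sum => [k x _ _|k _]; first exact: poweR_ge0.
  exact: measurableT_comp (measurable_poweR _) (mh k).
split; [apply: m|apply: m| |] => j; last 2 first.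
- exact: poweR_ge0.
- exact: poweR_ge0.
- by have [] := bG _ _ (fg j).
- by have [] := bG _ _ (fg j).
Qed.

Lemma good_lq G q : (0 < q)%R -> borel_pairs G -> good G q -> good (lq_pairs q G) q.
Proof.
move=> q0 bG gG t b C t01 b0 C1; have [K K0 hK] := gG t b C t01 b0 C1.
exists K => // A B hA hB _ _ [f [g [fg [-> ->]]]].
have /andP[t0 t1] := t01; have t01' : (0 < t <= 1)%R by rewrite t0 ltW.
have C0 : (0 < C)%R by exact: lt_le_trans C1.
have [nW _ _] := Ap_factored hA hB C0 t01' b0; have [W0 mW _] := nW.
have E (h : nat -> Rn R n -> \bar R) :
    (forall j, measurable_fun setT (h j)) -> (forall j x, 0 <= h j x) ->
    \int[leb]_x (lq_sum q h x `^ q * (factored A B t b x)%:E) =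
    \sum_(0 <= j <oo) \int[leb]_x (h j x `^ q * (factored A B t b x)%:E).
  move=> mh h0; rewrite -integral_nneseries//; last 2 first.
  - by move=> j; exact: measurable_poweR_mul.
  - by move=> j x _; exact: poweR_mul_ge0.
  apply: eq_integral => x _; rewrite /lq_sum poweRVK//; last first.
    by apply: nneseries_ge0 => j _ _; exact: poweR_ge0.
  by rewrite ge0_nneseriesZr ?lee_fin ?(ltW (W0 _))// => j; exact: poweR_ge0.
have Ef := E f (fun j => let: And4 h _ _ _ := bG _ _ (fg j) in h)
  (fun j => let: And4 _ _ h _ := bG _ _ (fg j) in h).
have Eg := E g (fun j => let: And4 _ h _ _ := bG _ _ (fg j) in h)
  (fun j => let: And4 _ _ _ h := bG _ _ (fg j) in h).
rewrite Ef Eg => foo.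
have i0 (h : nat -> Rn R n -> \bar R) j :
    0 <= \int[leb]_x (h j x `^ q * (factored A B t b x)%:E).
  by apply: integral_ge0 => x _; exact: poweR_mul_ge0.
rewrite -nneseriesZl//; apply: lee_nneseries => // j _.
apply: hK => //; apply: le_lt_trans foo.
exact: (le_nneseries_term j (i0 f)).
Qed.

End good_pairs.

Section extrapolation.
Context (R : realType) (n : nat).
Implicit Types (x : Rn R n) (p q t b C K : R) (w A B : Rn R n -> R).
Implicit Types (f g : Rn R n -> \bar R).
Implicit Types (G : set ((Rn R n -> \bar R) * (Rn R n -> \bar R))).
Local Notation leb := (lebesgue_Rn R n).

(** Normalizing by the right-hand side requires a positive real: any such [j] above [J] will do, and
    [J = 0] is reached in the limit. *)
Lemma le_mul_real_bounds (I J : \bar R) K : (0 < K)%R -> 0 <= J ->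
  (forall j : R, (0 < j)%R -> J <= j%:E -> I <= (K * j)%:E) -> I <= K%:E * J.
Proof.
move=> K0; case: J => [r| |] // r0 h; last by rewrite gt0_muley ?lte_fin// leey.
apply/lee_addgt0Pr => e e0.
rewrite -EFinM -EFinD (_ : K * r + e = K * (r + e / K))%R; last first.
  by field; rewrite gt_eqF.
have eK : (0 < e / K)%R by rewrite divr_gt0.
by apply: h; rewrite ?lee_fin ?lerDl ?(ltW eK)// ltr_wpDl.
Qed.

(** The exponent of [y] in the first factor is the one for which the powers of [y] cancel; Hoelder's
    inequality then passes from [p] to [p0]. *)
Lemma powR_split (y w p p0 P : R) (z : \bar R) : (0 < p)%R -> (p < p0)%R -> (0 < P)%R ->
  (0 < y)%R -> (0 < w)%R -> 0 <= z ->
  z `^ p * w%:E = (z `^ p0 * (w * y `^ (- ((p0 - p) * P / p)))%:E) `^ (p / p0) *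
    (y%:E `^ P * w%:E) `^ (1 - p / p0).
Proof.
move=> p_0 pp0 P0 y0 w0 z0; have p00 : (0 < p0)%R by exact: lt_trans pp0.
rewrite !poweRM ?poweR_ge0 ?lee_fin ?mulr_ge0 ?powR_ge0 ?(ltW w0)//.
rewrite -poweRrM mulrCA mulfV ?gt_eqF// mulr1 -muleA; congr (_ * _).
rewrite !poweR_EFin -!EFinM; congr (_%:E).
rewrite !powRM ?powR_ge0 ?(ltW w0)// -!powRrM mulrACA -mulrA [(_ * w `^ _)%R]mulrC mulrA.
rewrite mulrACA -!powRDpos// [(p / p0 + _)%R]addrC subrK powRr1 ?(ltW w0)//.
rewrite (_ : P * _ + _ = 0)%R ?powRr0 ?mulr1//.
by field; rewrite !gt_eqF.
Qed.

(** Where [phi ^ p] is dominated by [Y ^ P], the negative power of [Y] absorbs the excess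
    [phi ^ (p0 - p)]. *)
Lemma integral_powRN_le (Y W : Rn R n -> R) (phi : Rn R n -> \bar R) (a p p0 P : R) :
  (0 < p)%R -> (p < p0)%R -> (0 < P)%R -> (0 < a)%R ->
  measurable_fun setT phi -> measurable_fun setT W -> (forall x, 0 <= phi x) ->
  (forall x, 0 < Y x)%R -> (forall x, 0 < W x)%R ->
  (\forall x \ae leb, phi x `^ p <= (a * Y x `^ P)%:E) ->
  \int[leb]_x (phi x `^ p0 * (W x * Y x `^ (- ((p0 - p) * P / p)))%:E) <=
  (a `^ ((p0 - p) / p))%:E * \int[leb]_x (phi x `^ p * (W x)%:E).
Proof.
move=> p_0 pp0 P0 a0 mphi mW phi0 Y0 W0 h.
have pp : (0 < p0 - p)%R by rewrite subr_gt0.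
have r0 : (0 <= (p0 - p) / p)%R by rewrite divr_ge0 ?(ltW pp) ?(ltW p_0).
rewrite -ge0_integralZl_EFin ?powR_ge0//; last 2 first.
- by move=> x _; exact: poweR_mul_ge0.
- exact: measurable_poweR_mul.
apply: ae_le_integral.
- by move=> x; rewrite mule_ge0 ?poweR_ge0// lee_fin mulr_ge0 ?powR_ge0// ltW.
- by move=> x; rewrite mule_ge0 ?poweR_mul_ge0// lee_fin powR_ge0.
apply: filterS h => x hx.
rewrite (_ : p0 = p + (p0 - p))%R; last by rewrite addrC subrK.
rewrite poweRDp// [(p + _)%R]addrC subrK.
have h2 : phi x `^ (p0 - p) <= (a `^ ((p0 - p) / p) * Y x `^ ((p0 - p) * P / p))%:E.
  rewrite (_ : p0 - p = p * ((p0 - p) / p))%R; last by field; rewrite gt_eqF.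
  rewrite poweRrM; apply: le_trans (le_poweR r0 (poweR_ge0 _ _) hx) _.
  rewrite poweR_EFin lee_fin powRM ?powR_ge0 ?(ltW a0)// -powRrM.
  by apply/eq_le_refl; congr (_ `^ _ * _ `^ _)%R; field; rewrite gt_eqF.
rewrite -muleA [leRHS]muleCA; apply: lee_wpmul2l; first exact: poweR_ge0.
rewrite EFinM muleCA [leRHS]muleC; apply: lee_wpmul2l; first by rewrite lee_fin ltW.
apply: le_trans (lee_wpmul2r _ h2) _; first by rewrite lee_fin powR_ge0.
by rewrite -EFinM lee_fin -[leLHS]mulrA -powRDpos// subrr powRr0 mulr1.
Qed.

(** The weight [W] is an A_(1+b) weight, and the algorithm is run in L^(1+b)(W) on a root of the
    normalized sum of [f ^ p] and [g ^ p]. The majorant enters with a negative power, so the new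
    weight stays factored. The term with [g] bounds the new right-hand side, the one with [f] makes
    the new left-hand side finite. *)
Lemma good_down G p p0 : (0 < p)%R -> (p < p0)%R -> borel_pairs G -> good G p0 -> good G p.
Proof.
move=> p_0 pp0 bG gG t b C t01 b0 C1; have /andP[t0 t1] := t01.
have p00 : (0 < p0)%R by exact: lt_trans pp0.
have pp : (0 < p0 - p)%R by rewrite subr_gt0.
have C0 : (0 < C)%R by exact: lt_le_trans C1.
have P1 : (1 < 1 + b)%R by rewrite ltrDl.
have P0 : (0 < 1 + b)%R by exact: lt_trans P1.
have [KM KM1 hKM] := @maximal_bounded_Ap R n (1 + b) (C `^ b * C `^ t) P1.
have KM0 : (0 < KM)%R by exact: lt_le_trans KM1.
(* The exponent dictated by [powR_split] for [P = 1 + b]. *)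
set beta := ((p0 - p) * (1 + b) / p)%R.
have beta0 : (0 < beta)%R by rewrite !mulr_gt0// invr_gt0.
pose C' := Num.max C (2 * KM)%R.
have C'1 : (1 <= C')%R by rewrite le_max C1.
have bb0 : (0 < b + beta)%R by rewrite addr_gt0.
have [K' K'0 hK'] := gG t (b + beta)%R C' t01 bb0 C'1.
have s01 : (0 < p / p0 < 1)%R by rewrite divr_gt0//= ltr_pdivrMr// mul1r.
have /andP[s0 s1] := s01.
exists (K' `^ (p / p0) * (2 `^ (1 + b) * 2) `^ (1 - p / p0))%R.
  by rewrite mulr_gt0 ?powR_gt0 ?mulr_gt0 ?powR_gt0.
move=> A B hA hB f g fg.
have t01' : (0 < t <= 1)%R by rewrite t0 ltW.
have hW := Ap_factored hA hB C0 t01' b0; rewrite -/(factored A B t b) in hW.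
set W := factored A B t b in hW *.
have [[W0 mW _] _ _] := hW.
have [mf mg f0 g0] := bG _ _ fg.
have I0 : 0 <= \int[leb]_x (f x `^ p * (W x)%:E).
  by apply: integral_ge0 => x _; exact: poweR_mul_ge0.
have J0 : 0 <= \int[leb]_x (g x `^ p * (W x)%:E).
  by apply: integral_ge0 => x _; exact: poweR_mul_ge0.
move=> Ioo; apply: le_mul_real_bounds => //.
  by rewrite mulr_gt0 ?powR_gt0 ?mulr_gt0 ?powR_gt0.
move=> j j0 Jj.
move: I0; rewrite le_eqVlt => /orP[/eqP <-|I0].
  by rewrite lee_fin !mulr_ge0 ?powR_ge0// ltW.
have [i i0 iE] := gt0_le_fin I0 Ioo.
pose h x := (i^-1)%:E * f x `^ p + (j^-1)%:E * g x `^ p.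
have hf0 x : 0 <= (i^-1)%:E * f x `^ p.
  by rewrite mule_ge0 ?poweR_ge0// lee_fin invr_ge0 ltW.
have hg0 x : 0 <= (j^-1)%:E * g x `^ p.
  by rewrite mule_ge0 ?poweR_ge0// lee_fin invr_ge0 ltW.
have h0 x : 0 <= h x by exact: adde_ge0.
have mf' : measurable_fun setT (fun x => (i^-1)%:E * f x `^ p).
  by apply: measurable_funeM; exact: measurableT_comp (measurable_poweR _) mf.
have mg' : measurable_fun setT (fun x => (j^-1)%:E * g x `^ p).
  by apply: measurable_funeM; exact: measurableT_comp (measurable_poweR _) mg.
have mh : measurable_fun setT h by exact: emeasurable_funD.
have hW2 : \int[leb]_x ((h x `^ (1 + b)^-1) `^ (1 + b) * (W x)%:E) =
    1 + (j^-1)%:E * \int[leb]_x (g x `^ p * (W x)%:E).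
  transitivity (\int[leb]_x ((i^-1)%:E * (f x `^ p * (W x)%:E) + (j^-1)%:E * (g x `^ p * (W x)%:E))).
    apply: eq_integral => x _; rewrite poweRVK// ge0_muleDl//.
    by rewrite !muleA.
  rewrite ge0_integralD//; last 4 first.
  - by move=> x _; rewrite mule_ge0 ?poweR_mul_ge0// lee_fin invr_ge0 ltW.
  - by apply: measurable_funeM; exact: measurable_poweR_mul.
  - by move=> x _; rewrite mule_ge0 ?poweR_mul_ge0// lee_fin invr_ge0 ltW.
  - by apply: measurable_funeM; exact: measurable_poweR_mul.
  rewrite !ge0_integralZl_EFin ?invr_ge0 ?(ltW i0) ?(ltW j0)//; last 4 first.
  - by move=> x _; exact: poweR_mul_ge0.
  - exact: measurable_poweR_mul.
  - by move=> x _; exact: poweR_mul_ge0.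
  - exact: measurable_poweR_mul.
  by rewrite iE -EFinM mulVf// gt_eqF.
have hW2_le : \int[leb]_x ((h x `^ (1 + b)^-1) `^ (1 + b) * (W x)%:E) <= 2%:E.
  rewrite hW2 (_ : 2%:E = 1 + 1)//; apply: leeD2l.
  by rewrite lee_pdivrMl// mule1.
have hW2_gt : 0 < \int[leb]_x ((h x `^ (1 + b)^-1) `^ (1 + b) * (W x)%:E) < +oo.
  rewrite (le_lt_trans hW2_le) ?ltry// andbT hW2.
  by apply: (@lt_le_trans _ _ 1) => //; apply: leeDl; rewrite mule_ge0// lee_fin invr_ge0 ltW.
have mhP : measurable_fun setT (fun x => h x `^ (1 + b)^-1).
  exact: measurableT_comp (measurable_poweR _) mh.
have hP0 x : 0 <= h x `^ (1 + b)^-1 by exact: poweR_ge0.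
have [Y [hY hY1 hY2 _]] := rubio_de_francia KM0 mhP hP0 (ltW P1) (ltW P1) mW mW W0 W0
  (hKM _ hW) (hKM _ hW) hW2_gt.
have [[Y0 mY _] _] := hY.
have hA' : A1_weight C' A by apply: A1_weight_le hA; rewrite le_max lexx.
have hB' : A1_weight C' B by apply: A1_weight_le hB; rewrite le_max lexx.
have {}hY : A1_weight C' Y by apply: A1_weight_le hY; rewrite le_max lexx orbT.
have [Z hZ ZE] := @factored_mulN R n C' A B Y t b beta C'1 b0 beta0 hB' hY.
have hYP : \forall x \ae leb, h x <= (Y x `^ (1 + b))%:E.
  apply: filterS hY1 => x hx; rewrite -(poweRVK P0 (h0 x)) -poweR_EFin.
  by apply: le_poweR => //; exact: ltW.
have fY : \forall x \ae leb, f x `^ p <= (i * Y x `^ (1 + b))%:E.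
  apply: filterS hYP => x hx; rewrite EFinM -lee_pdivrMl//.
  by apply: le_trans hx; exact: leeDl.
have gY : \forall x \ae leb, g x `^ p <= (j * Y x `^ (1 + b))%:E.
  apply: filterS hYP => x hx; rewrite EFinM -lee_pdivrMl//.
  by apply: le_trans hx; exact: leeDr.
have WE x : (W x * Y x `^ (- beta))%R = factored A Z t (b + beta) x by exact: ZE.
have bound (phi : Rn R n -> \bar R) (a : R) : (0 < a)%R -> measurable_fun setT phi ->
    (forall x, 0 <= phi x) -> (\forall x \ae leb, phi x `^ p <= (a * Y x `^ (1 + b))%:E) ->
    \int[leb]_x (phi x `^ p0 * (factored A Z t (b + beta) x)%:E) <=
    (a `^ ((p0 - p) / p))%:E * \int[leb]_x (phi x `^ p * (W x)%:E).
  by move=> *; under eq_integral do rewrite -WE; exact: integral_powRN_le.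
have fb := bound _ _ i0 mf f0 fY; have gb := bound _ _ j0 mg g0 gY.
have foo : \int[leb]_x (f x `^ p0 * (factored A Z t (b + beta) x)%:E) < +oo.
  by apply: le_lt_trans fb _; rewrite iE -EFinM ltry.
have key := hK' A Z hA' hZ f g fg foo.
have {}key : \int[leb]_x (f x `^ p0 * (factored A Z t (b + beta) x)%:E) <=
    (K' * j `^ (p0 / p))%:E.
  apply: le_trans key _; rewrite EFinM; apply: lee_wpmul2l; first by rewrite lee_fin ltW.
  apply: le_trans gb _.
  apply: (@le_trans _ _ ((j `^ ((p0 - p) / p))%:E * j%:E)).
    by apply: lee_wpmul2l => //; rewrite lee_fin powR_ge0.
  rewrite -EFinM lee_fin; apply: eq_le_refl.
  rewrite -[X in (_ * X)%R](powRr1 (ltW j0)) -powRDpos//.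
  by congr (_ `^ _)%R; field; rewrite gt_eqF.
have -> : \int[leb]_x (f x `^ p * (W x)%:E) =
  \int[leb]_x ((f x `^ p0 * (factored A Z t (b + beta) x)%:E) `^ (p / p0) *
    ((Y x)%:E `^ (1 + b) * (W x)%:E) `^ (1 - p / p0)).
  by apply: eq_integral => x _; rewrite -WE; exact: powR_split.
have [Z0 mZ _] := hZ.1.
have mWZ : measurable_fun setT (factored A Z t (b + beta)).
  rewrite (_ : factored _ _ _ _ = fun x => (W x * Y x `^ (- beta))%R); last first.
    by apply/funext => x; rewrite WE.
  by apply: measurable_funM => //; exact: measurable_fun_powR.
have WZ0 x : (0 < factored A Z t (b + beta) x)%R by rewrite -WE mulr_gt0 ?powR_gt0.
apply: le_trans (hoelder_geo leb s01 _ _ _ _) _.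
- exact: measurable_poweR_mul.
- by apply: measurable_poweR_mul => //; exact/measurable_EFinP.
- by move=> x; apply: (@poweR_mul_ge0 _ _ f (factored A Z t (b + beta))) => y; exact: WZ0.
- by move=> x; exact: (@poweR_mul_ge0 _ _ (EFin \o Y) W).
apply: (@le_trans _ _ ((K' * j `^ (p0 / p))%:E `^ (p / p0) *
    (2 `^ (1 + b) * 2)%:E `^ (1 - p / p0))).
  apply: lee_pmul; rewrite ?poweR_ge0//.
    by apply: le_poweR key; [exact: ltW|apply: integral_ge0 => x _; exact: poweR_mul_ge0].
  apply: le_poweR; [by rewrite subr_ge0 ltW|by apply: integral_ge0 => x _; exact: (@poweR_mul_ge0 _ _ (EFin \o Y) W)|].
  apply: le_trans hY2 _; rewrite EFinM; apply: lee_wpmul2l hW2_le.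
  by rewrite lee_fin powR_ge0.
rewrite !poweR_EFin -EFinM lee_fin [X in (X * _ <= _)%R]powRM ?powR_ge0 ?(ltW K'0)//.
rewrite -[X in (_ * X * _ <= _)%R]powRrM.
rewrite (_ : p0 / p * _ = 1)%R; last by field; rewrite !gt_eqF.
by rewrite (powRr1 (ltW j0)) mulrAC.
Qed.

(** Duality in L^(q/p0): with [s = p0 / q] the function [f ^ (q - p0) * W ^ (1 - s)] is majorized by
    a power [al < 1] of an A_1 weight [X] found in an unweighted space. The hypothesis is used for
    [X ^ al * W ^ s], and Hoelder's inequality leads back to the exponent [q]. *)
Lemma good_up G p0 q : (0 < p0)%R -> (p0 < q)%R -> borel_pairs G -> good G p0 -> good G q.
Proof.
move=> p00 p0q bG gG t b C t01 b0 C1; have /andP[t0 t1] := t01.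
have q0 : (0 < q)%R by exact: lt_trans p0q.
have C0 : (0 < C)%R by exact: lt_le_trans C1.
pose s : R := (p0 / q)%R.
have s0 : (0 < s)%R by rewrite divr_gt0.
have s1 : (s < 1)%R by rewrite ltr_pdivrMr// mul1r.
have s01 : (0 < s < 1)%R by rewrite s0.
have sq : (q * s = p0)%R by rewrite /s mulrCA mulfV ?mulr1// gt_eqF.
have s'0 : (0 < 1 - s)%R by rewrite subr_gt0.
have qp : (0 < q - p0)%R by rewrite subr_gt0.
clearbody s.
(* The midpoint between [1 - s] and [1 - t * s]: above the former, [rho] exceeds 1 and the maximal
   operator is bounded on L^rho; below the latter, the total positive exponent [al + t * s] is less
   than 1. *)
pose al : R := (1 - (1 + t) * s / 2)%R.
have ts0 : (0 < t * s)%R by rewrite mulr_gt0.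
have ts1 : (t * s < s)%R by rewrite gtr_pMl.
have al0 : (0 < al)%R by rewrite /al; lra.
have al1 : (al < 1)%R by rewrite /al; lra.
pose rho : R := (al / (1 - s))%R.
have rho1 : (1 < rho)%R by rewrite /rho ltr_pdivlMr// mul1r /al; lra.
have rho0 : (0 < rho)%R by exact: lt_trans rho1.
have rhos : (rho * (1 - s) = al)%R by rewrite /rho divfK// gt_eqF.
have t'01 : (0 < al + t * s < 1)%R.
  by rewrite addr_gt0//= /al; lra.
clearbody al rho.
have [KM KM1 hKM] := @maximal_bounded_Ap R n rho 1%R rho1.
have {}hKM := hKM _ (@Ap_weight_cst R n rho rho1).
have KM0 : (0 < KM)%R by exact: lt_le_trans KM1.
pose C' := Num.max C (2 * KM)%R.
have C'1 : (1 <= C')%R by rewrite le_max C1.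
have bs0 : (0 < b * s)%R by rewrite mulr_gt0.
have [K' K'0 hK'] := gG _ _ C' t'01 bs0 C'1.
have K0 : (0 < (K' * 2 `^ al) `^ s^-1)%R by rewrite powR_gt0// mulr_gt0// powR_gt0.
exists ((K' * 2 `^ al) `^ s^-1)%R => //.
move=> A B hA hB f g fg.
have t01' : (0 < t <= 1)%R by rewrite t0 ltW.
have hW := Ap_factored hA hB C0 t01' b0; rewrite -/(factored A B t b) in hW.
set W := factored A B t b in hW *.
have [[W0 mW _] _ _] := hW.
have [mf mg f0 g0] := bG _ _ fg.
have I0 : 0 <= \int[leb]_x (f x `^ q * (W x)%:E).
  by apply: integral_ge0 => x _; exact: poweR_mul_ge0.
have J0 : 0 <= \int[leb]_x (g x `^ q * (W x)%:E).
  by apply: integral_ge0 => x _; exact: poweR_mul_ge0.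
move=> Ioo; apply: le_mul_real_bounds => // j j0 Jj.
move: I0; rewrite le_eqVlt => /orP[/eqP <-|I0].
  by rewrite lee_fin mulr_ge0 ?(ltW j0) ?(ltW K0).
have [i i0 iE] := gt0_le_fin I0 Ioo.
pose h x := (f x `^ (q - p0) * (W x `^ (1 - s))%:E) `^ al^-1.
have h'0 x : 0 <= f x `^ (q - p0) * (W x `^ (1 - s))%:E.
  by apply: mule_ge0; [exact: poweR_ge0|rewrite lee_fin; exact: powR_ge0].
have h0 x : 0 <= h x by exact: poweR_ge0.
have mh : measurable_fun setT h.
  apply: measurableT_comp (measurable_poweR _) _; apply: measurable_poweR_mul => //.
  exact: measurable_fun_powR.
have hE x : h x `^ rho = f x `^ q * (W x)%:E.
  rewrite /h -poweRrM poweRM ?poweR_ge0 ?lee_fin ?powR_ge0// -poweRrM poweR_EFin -powRrM.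
  have -> : ((1 - s) * (al^-1 * rho) = 1)%R by rewrite -rhos; field; rewrite !gt_eqF.
  have -> : ((q - p0) * (al^-1 * rho) = q)%R.
    by rewrite -sq -rhos; field; rewrite !gt_eqF.
  by rewrite powRr1 // ltW.
have hI : \int[leb]_x (h x `^ rho * (cst 1%R x)%:E) = i%:E.
  by rewrite -iE; apply: eq_integral => x _; rewrite mule1 hE.
have hI_gt : 0 < \int[leb]_x (h x `^ rho * (cst 1%R x)%:E) < +oo.
  by rewrite hI ltry lte_fin i0.
have m1 : measurable_fun setT (cst 1%R : Rn R n -> R) by exact: measurable_cst.
have [X [hX hX1 hX2 _]] := rubio_de_francia KM0 mh h0 (ltW rho1) (ltW rho1) m1 m1
  (fun=> ltr01) (fun=> ltr01) hKM hKM hI_gt.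
rewrite hI in hX2; have [[X0 mX _] _] := hX.
have hA' : A1_weight C' A by apply: A1_weight_le hA; rewrite le_max lexx.
have {}hX : A1_weight C' X by apply: A1_weight_le hX; rewrite le_max lexx orbT.
have hB' : A1_weight C' B by apply: A1_weight_le hB; rewrite le_max lexx.
have [[B0 _ _] _] := hB.
have [Z hZ ZE] := @factored_mulp R n C' A B X t al b s C'1 t0 al0 s0 hA' hX B0.
have WE x : factored Z B (al + t * s) (b * s) x = (X x `^ al * W x `^ s)%R by rewrite ZE.
have dual (phi : Rn R n -> \bar R) : measurable_fun setT phi -> (forall x, 0 <= phi x) ->
    \int[leb]_x (phi x `^ p0 * (factored Z B (al + t * s) (b * s) x)%:E) <=
    (\int[leb]_x (phi x `^ q * (W x)%:E)) `^ s * (2 `^ rho * i)%:E `^ (1 - s).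
  move=> mphi phi0.
  have -> : \int[leb]_x (phi x `^ p0 * (factored Z B (al + t * s) (b * s) x)%:E) =
      \int[leb]_x ((phi x `^ q * (W x)%:E) `^ s * ((X x)%:E `^ rho) `^ (1 - s)).
    apply: eq_integral => x _; rewrite poweRM ?poweR_ge0 ?lee_fin ?(ltW (W0 x))//.
    rewrite -!poweRrM sq rhos !poweR_EFin -muleA -EFinM WE.
    by rewrite [(X x `^ al * _)%R]mulrC.
  apply: le_trans (hoelder_geo leb s01 _ _ _ _) _.
  - exact: measurable_poweR_mul.
  - by apply: measurableT_comp (measurable_poweR _) _; exact/measurable_EFinP.
  - by move=> x; exact: poweR_mul_ge0.
  - by move=> x; exact: poweR_ge0.
  apply: lee_wpmul2l; first exact: poweR_ge0.
  apply: le_poweR; [exact: ltW|by apply: integral_ge0 => x _; exact: poweR_ge0|].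
  rewrite EFinM; apply: le_trans hX2; apply: le_integralT => x; first exact: poweR_ge0.
  by rewrite mule1.
have foo : \int[leb]_x (f x `^ p0 * (factored Z B (al + t * s) (b * s) x)%:E) < +oo.
  by apply: le_lt_trans (dual f mf f0) _; rewrite iE !poweR_EFin -EFinM ltry.
have key := hK' Z B hZ hB' f g fg foo.
have {}key : (i <= K' * (j `^ s * (2 `^ rho * i) `^ (1 - s)))%R.
  rewrite -lee_fin -iE.
  apply: (@le_trans _ _ (\int[leb]_x (f x `^ p0 * (factored Z B (al + t * s) (b * s) x)%:E))).
    apply: ae_le_integral => [x|x|].
    - exact: poweR_mul_ge0.
    - by rewrite WE mule_ge0 ?poweR_ge0// lee_fin mulr_ge0 ?powR_ge0.
    apply: filterS hX1 => x hx.
    have -> : f x `^ q = f x `^ p0 * f x `^ (q - p0).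
      by rewrite -poweRDp// addrC subrK.
    have h2 : f x `^ (q - p0) * (W x `^ (1 - s))%:E <= (X x `^ al)%:E.
      rewrite -(poweRVK al0 (h'0 x)) -[leRHS]poweR_EFin.
      by apply: le_poweR hx; [exact: ltW|].
    rewrite WE -muleA; apply: lee_wpmul2l; first exact: poweR_ge0.
    have WsE : W x = (W x `^ (1 - s) * W x `^ s)%R.
      by rewrite -powRDpos// subrK powRr1// ltW.
    apply: (@le_trans _ _ (f x `^ (q - p0) * (W x `^ (1 - s))%:E * (W x `^ s)%:E)).
      by rewrite -muleA -EFinM -WsE.
    rewrite [leRHS]EFinM; apply: lee_wpmul2r h2.
    by rewrite lee_fin; exact: powR_ge0.
  apply: le_trans key _; rewrite EFinM; apply: lee_wpmul2l; first by rewrite lee_fin ltW.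
  apply: le_trans (dual g mg g0) _; rewrite poweR_EFin [leRHS]EFinM.
  apply: lee_wpmul2r; first by rewrite lee_fin powR_ge0.
  by rewrite -poweR_EFin; apply: le_poweR => //; exact: ltW.
(* As [i] is positive and finite, its power [1 - s] cancels from both sides. *)
have {}key : (i `^ s <= K' * 2 `^ al * j `^ s)%R.
  rewrite -(@ler_pM2r _ (i `^ (1 - s))%R) ?powR_gt0//.
  rewrite -powRDpos// [(s + _)%R]addrC subrK powRr1 ?(ltW i0)//.
  apply: le_trans key _; rewrite powRM ?powR_ge0 ?(ltW i0)// -powRrM rhos.
  by apply: eq_le_refl; ring.
rewrite iE lee_fin -[leLHS](powRr1 (ltW i0)) -(mulfV (lt0r_neq0 s0)) powRrM.
have si0 : (0 <= s^-1)%R by rewrite invr_ge0 ltW.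
apply: le_trans (le_powR si0 (powR_ge0 _ _) key) _.
rewrite powRM; last 2 first.
- by apply: mulr_ge0; [exact: ltW|exact: powR_ge0].
- exact: powR_ge0.
by rewrite -(powRrM j) mulfV ?lt0r_neq0 ?(powRr1 (ltW j0)).
Qed.

Lemma good_all G p q : (0 < p)%R -> (0 < q)%R -> borel_pairs G -> good G p -> good G q.
Proof.
move=> p0 q0 bG gG; case: (ltgtP p q) => [pq|qp|<-//].
- exact: (good_up p0 pq).
- exact: (good_down q0 qp).
Qed.

End extrapolation.

(** * Weak type estimates *)

Section weak_duality.
Context d (T : measurableType d) (R : realType).
Variable mu : {measure set T -> \bar R}.
Implicit Types (phi H h : T -> \bar R) (m : T -> R).

Lemma nneseries_geometric_le (c r : R) : (0 <= c)%R -> (0 < r < 1)%R ->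
  \sum_(0 <= k <oo) (c * r ^+ k)%:E <= (c / (1 - r))%:E.
Proof.
move=> c0 /andP[r0 r1]; apply: lime_le.
  apply: is_cvg_nneseries => k _ _.
  by rewrite lee_fin mulr_ge0// exprn_ge0// ltW.
apply: nearW => K; rewrite sumEFin lee_fin -mulr_sumr ler_wpM2l// big_mkord.
have r1' : (0 < 1 - r)%R by rewrite subr_gt0.
rewrite -[leRHS]mul1r ler_pdivlMr// mulrC -opprB mulNr -subrX1 opprB.
by rewrite gerBl exprn_ge0// ltW.
Qed.

(** The companion of [integral_gt_levels] below the level [e]: the first of the decreasing levels to
    fall under [phi x] is at least half of it. *)
Lemma integral_le_levels (e : R) phi h : (0 < e)%R ->
  measurable_fun setT phi -> measurable_fun setT h ->
  (forall x, 0 <= phi x) -> (forall x, 0 <= h x) ->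
  \int[mu]_(x in [set x | phi x <= e%:E]) (phi x * h x) <=
  \sum_(0 <= k <oo) (2 * (e / 2 ^+ k.+1))%:E *
    \int[mu]_(x in [set x | (e / 2 ^+ k.+1)%:E < phi x]) h x.
Proof.
move=> e0 mphi mh phi0 h0.
have c0 k : (0 < e / 2 ^+ k.+1 :> R)%R by rewrite divr_gt0// exprn_gt0.
have c20 k : (0 <= 2 * (e / 2 ^+ k.+1) :> R)%R by rewrite mulr_ge0// ltW.
pose L k := [set x | (e / 2 ^+ k.+1)%:E < phi x].
have mL k : measurable (L k).
  by rewrite -[L k]setTI; apply: emeasurable_fun_o_infty.
have -> : \sum_(0 <= k <oo) (2 * (e / 2 ^+ k.+1))%:E * \int[mu]_(x in L k) h x =
    \int[mu]_x (\sum_(0 <= k <oo) (2 * (e / 2 ^+ k.+1) * \1_(L k) x)%:E * h x).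
  rewrite integral_nneseries//; last 2 first.
  - move=> k; apply: emeasurable_funM => //; apply/measurable_EFinP.
    by apply: measurable_funM => //; exact: measurable_indic.
  - by move=> k x _; rewrite mule_ge0// lee_fin mulr_ge0.
  by apply: eq_eseriesr => k _; rewrite integral_mul_indic.
have t0 k x : 0 <= (2 * (e / 2 ^+ k.+1) * \1_(L k) x)%:E * h x.
  by rewrite mule_ge0// lee_fin mulr_ge0.
rewrite integral_mkcond; apply: le_integralT => x.
  by rewrite patchE; case: ifP => // _; exact: mule_ge0.
rewrite patchE; case: ifPn => [|_]; last by apply: nneseries_ge0.
rewrite inE/= => phie.
have [->|phin0] := eqVneq (phi x) 0; first by rewrite mul0e; apply: nneseries_ge0.
have phi_gt0 : 0 < phi x by rewrite lt_def phin0 phi0.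
have [r r0 rE] := gt0_le_fin phi_gt0 (le_lt_trans phie (ltry _)).
rewrite rE lee_fin in phie.
have ex : exists k, (e / 2 ^+ k.+1 < r)%R.
  have [k hk] := @exists_pow2_ge R r e r0; exists k.
  rewrite ltr_pdivrMr ?exprn_gt0//; apply: le_lt_trans hk _.
  by rewrite ltr_pM2l// exprS ltr_pMl ?exprn_gt0// ltr1n.
have [k hk kmin] := ex_minnP ex.
apply: le_trans (le_nneseries_term k (fun k => t0 k x)).
rewrite indicE mem_set ?mulr1; last by rewrite /L/= rE lte_fin.
apply: lee_wpmul2r => //; rewrite rE lee_fin.
case: k hk kmin {t0} => [_ _|k hk kmin]; first by rewrite expr1 mulrC divfK.
rewrite (_ : 2 * _ = e / 2 ^+ k.+1)%R; last first.
  by rewrite [(2 ^+ k.+2)%R]exprS; field; rewrite expf_neq0.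
by rewrite leNgt; apply/negP => /kmin; rewrite ltnn.
Qed.

(** Hoelder's inequality on the level set, whose mass is at most [(rho / s) ^+ 2] by the weak L^2
    bound. The exponent [2 / p - 1] of [s] is negative for [p > 2] and positive for [p < 2], so that
    high and low levels respectively can be summed. *)
Lemma weak_level_bound (p s N rho c : R) phi H m : (1 < p)%R -> (0 < s)%R ->
  (0 < N)%R -> (0 < rho)%R -> (1 <= c)%R ->
  measurable_fun setT phi -> measurable_fun setT H -> measurable_fun setT m ->
  (forall x, 0 <= phi x) -> (forall x, 0 <= H x) -> (forall x, 0 < m x)%R ->
  (forall l : R, (0 < l)%R ->
    (l ^+ 2)%:E * \int[mu]_(x in [set x | l%:E < phi x]) (m x)%:E <= (N ^+ 2)%:E) ->
  \int[mu]_x (H x `^ p * (m x)%:E) <= (c * rho ^+ 2)%:E ->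
  (N / rho * s)%:E *
    \int[mu]_(x in [set x | (N / rho * s)%:E < phi x]) (H x * (m x)%:E) <=
  (c * (N * rho) * s `^ (2 / p - 1))%:E.
Proof.
move=> p1 s0 N0 rho0 c1 mphi mH mm phi0 H0 m0 weak hH.
have p0 : (0 < p)%R by exact: lt_trans p1.
have pi01 : (0 < p^-1 < 1)%R by rewrite invr_gt0 p0/= invf_lt1.
have /andP[pi0 pi1] := pi01.
set l := (N / rho * s)%R; have l0 : (0 < l)%R by rewrite !mulr_gt0// invr_gt0.
set L := [set x | l%:E < phi x].
have mL : measurable L by rewrite -[L]setTI; apply: emeasurable_fun_o_infty.
have mI : measurable_fun setT (fun x => (\1_L x * m x)%:E).
  by apply/measurable_EFinP; apply: measurable_funM => //; exact: measurable_indic.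
have hL : \int[mu]_x (\1_L x * m x)%:E <= ((rho / s) ^+ 2)%:E.
  have -> : \int[mu]_x (\1_L x * m x)%:E = \int[mu]_(x in L) (m x)%:E.
    rewrite [RHS]integral_mkcond; apply: eq_integral => x _.
    by rewrite patchE indicE; case: (x \in L); rewrite ?mul1r ?mul0r.
  have := weak l l0; rewrite -lee_pdivlMl ?exprn_gt0// => /le_trans; apply.
  rewrite -EFinM lee_fin; apply: eq_le_refl.
  by rewrite /l; field; rewrite !gt_eqF.
have -> : \int[mu]_(x in L) (H x * (m x)%:E) =
    \int[mu]_x ((H x `^ p * (m x)%:E) `^ p^-1 * (\1_L x * m x)%:E `^ (1 - p^-1)).
  rewrite integral_mkcond; apply: eq_integral => x _; rewrite patchE indicE.
  case: (x \in L); last first.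
    by rewrite mul0r poweR0r ?mule0// gt_eqF// subr_gt0.
  rewrite mul1r poweRM ?poweR_ge0 ?lee_fin ?(ltW (m0 x))// poweRK// -muleA.
  congr (_ * _); rewrite !poweR_EFin -EFinM -powRDpos// addrC subrK.
  by rewrite powRr1 // ltW.
apply: (@le_trans _ _ (l%:E * ((c * rho ^+ 2)%:E `^ p^-1 * ((rho / s) ^+ 2)%:E `^ (1 - p^-1)))).
  apply: lee_wpmul2l; first by rewrite lee_fin ltW.
  apply: le_trans (hoelder_geo mu pi01 _ _ _ _) _ => //.
  - apply: emeasurable_funM; last exact/measurable_EFinP.
    exact: measurableT_comp (measurable_poweR _) mH.
  - by move=> x; rewrite mule_ge0 ?poweR_ge0// lee_fin ltW.
  - by move=> x; rewrite lee_fin mulr_ge0// ltW.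
  have i1 : 0 <= \int[mu]_x (H x `^ p * (m x)%:E).
    by apply: integral_ge0 => x _; rewrite mule_ge0 ?poweR_ge0// lee_fin ltW.
  have i2 : 0 <= \int[mu]_x (\1_L x * m x)%:E.
    by apply: integral_ge0 => x _; rewrite lee_fin mulr_ge0// ltW.
  apply: lee_pmul; rewrite ?poweR_ge0//; apply: le_poweR => //.
    exact: ltW.
  by rewrite subr_ge0 ltW.
have c0 : (0 < c)%R by exact: lt_le_trans c1.
rewrite !poweR_EFin -!EFinM lee_fin powRM ?exprn_ge0 ?(ltW c0) ?(ltW rho0)//.
have -> : ((rho / s) ^+ 2 = rho ^+ 2 * s `^ (- 2))%R.
  by rewrite expr_div_n powRN (powR_mulrn 2 (ltW s0)).
rewrite powRM ?exprn_ge0 ?powR_ge0 ?(ltW rho0)// -powRrM.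
rewrite (_ : l * _ = (c `^ p^-1 * (N / rho * ((rho ^+ 2) `^ p^-1 * (rho ^+ 2) `^ (1 - p^-1)))
  * (s * s `^ (- 2 * (1 - p^-1)))))%R; last by rewrite /l; ring.
have r20 : (0 < rho ^+ 2)%R by rewrite exprn_gt0.
rewrite -powRDpos// [(p^-1 + _)%R]addrC subrK powRr1 ?(ltW r20)//.
rewrite -{1}(powRr1 (ltW s0)) -powRDpos// (_ : 1 + _ = 2 / p - 1)%R; last by field; rewrite gt_eqF.
rewrite (_ : N / rho * rho ^+ 2 = N * rho)%R; last by field; rewrite gt_eqF.
rewrite ler_wpM2r ?powR_ge0// ler_wpM2r ?mulr_ge0 ?(ltW N0) ?(ltW rho0)//.
rewrite -[leRHS](powRr1 (ltW c0)); apply: ler_powR => //; exact: ltW.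
Qed.

(** A concrete form of the duality between weak L^2 and L^(2,1): the levels of [phi] above
    [N / rho], where the bounds for both exponents agree, are treated with [p2], those below with
    [p1]. *)
Lemma weak_duality (p1 p2 : R) : (1 < p1 < 2)%R -> (2 < p2)%R ->
  exists2 K : R, (0 < K)%R & forall phi H m (N rho c : R),
  (0 < N)%R -> (0 < rho)%R -> (1 <= c)%R ->
  measurable_fun setT phi -> measurable_fun setT H -> measurable_fun setT m ->
  (forall x, 0 <= phi x) -> (forall x, 0 <= H x) -> (forall x, 0 < m x)%R ->
  (forall l : R, (0 < l)%R ->
    (l ^+ 2)%:E * \int[mu]_(x in [set x | l%:E < phi x]) (m x)%:E <= (N ^+ 2)%:E) ->
  \int[mu]_x (H x `^ p1 * (m x)%:E) <= (c * rho ^+ 2)%:E ->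
  \int[mu]_x (H x `^ p2 * (m x)%:E) <= (c * rho ^+ 2)%:E ->
  \int[mu]_x (phi x * (H x * (m x)%:E)) <= (K * (c * (N * rho)))%:E.
Proof.
move=> /andP[p11 p12] p22.
have p10 : (0 < p1)%R by exact: lt_trans p11.
have p20 : (0 < p2)%R by exact: lt_trans p22.
have p21 : (1 < p2)%R by apply: lt_trans p22; rewrite ltr1n.
pose r1 : R := (2 `^ (- (2 / p1 - 1)))%R.
pose r2 : R := (2 `^ (2 / p2 - 1))%R.
have r101 : (0 < r1 < 1)%R.
  rewrite powR_gt0//= /r1 powRN invf_lt1 ?powR_gt0//; apply: pow2_gt1.
  by rewrite subr_gt0 ltr_pdivlMr// mul1r.
have r201 : (0 < r2 < 1)%R.
  rewrite powR_gt0//= /r2 -[(2 / p2 - 1)%R]opprB powRN invf_lt1 ?powR_gt0//.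
  by apply: pow2_gt1; rewrite subr_gt0 ltr_pdivrMr// mul1r.
have /andP[r10 r11] := r101; have /andP[r20 r21] := r201.
exists (2 / (1 - r2) + 2 * r1 / (1 - r1))%R.
  by rewrite addr_gt0// divr_gt0 ?mulr_gt0// subr_gt0.
move=> phi H m N rho c N0 rho0 c1 mphi mH mm phi0 H0 m0 weak h1 h2.
have lb p s p1 s0 := @weak_level_bound p s N rho c phi H m p1 s0 N0 rho0 c1 mphi mH mm phi0 H0 m0 weak.
have D0 : (0 < c * (N * rho))%R by rewrite !mulr_gt0// (lt_le_trans _ c1).
set e := (N / rho)%R; have e0 : (0 < e)%R by rewrite divr_gt0.
pose L := [set x | e%:E < phi x].
have mL : measurable L by rewrite -[L]setTI; apply: emeasurable_fun_o_infty.
have mh : measurable_fun setT (fun x => H x * (m x)%:E).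
  by apply: emeasurable_funM => //; exact/measurable_EFinP.
have h0 x : 0 <= H x * (m x)%:E by rewrite mule_ge0// lee_fin ltW.
have mph : measurable_fun setT (fun x => phi x * (H x * (m x)%:E)).
  exact: emeasurable_funM.
have ph0 x : 0 <= phi x * (H x * (m x)%:E) by exact: mule_ge0.
rewrite -(setUv L) ge0_integral_setU//; last 3 first.
- exact: measurableC.
- exact: measurable_funTS.
- by apply/disj_setPS; rewrite setICr.
rewrite mulrDl EFinD; apply: leeD.
  have := integral_gt_levels mu ltr01 e0 mphi mh phi0 h0.
  under eq_integral do rewrite poweRe1//.
  move=> /le_trans; apply; rewrite powRr1// -[(2 / (1 - r2) * _)%R]mulrA EFinM.
  apply: lee_wpmul2l => //.
  apply: (@le_trans _ _ (\sum_(0 <= k <oo) (c * (N * rho) * r2 ^+ k)%:E)).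
    apply: lee_nneseries => k _.
      rewrite mule_ge0 ?integral_ge0// lee_fin powR_ge0//.
    rewrite powRr1; last by rewrite mulr_ge0 ?exprn_ge0 ?(ltW e0).
    have k0 : (0 < (2 : R) ^+ k)%R by rewrite exprn_gt0.
    apply: le_trans (lb p2 (2 ^+ k)%R p21 k0 h2) _; rewrite lee_fin.
    by have := powR2M (2 / p2 - 1)%R k (@ltr01 R); rewrite !mul1r powR1 mul1r => ->.
  by apply: le_trans (nneseries_geometric_le (ltW D0) r201) _; rewrite mulrC.
have -> : ~` L = [set x | phi x <= e%:E].
  by apply/seteqP; split=> x /=; rewrite leNgt => /negP.
apply: le_trans (integral_le_levels e0 mphi mh phi0 h0) _.
apply: (@le_trans _ _ (\sum_(0 <= k <oo) (2 * r1 * (c * (N * rho)) * r1 ^+ k)%:E)).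
  apply: lee_nneseries => k _.
    by rewrite mule_ge0 ?integral_ge0// lee_fin mulr_ge0// divr_ge0 ?exprn_ge0 ?(ltW e0).
  have k0 : (0 < ((2 : R) ^+ k.+1)^-1)%R by rewrite invr_gt0 exprn_gt0.
  rewrite EFinM -muleA.
  apply: (@le_trans _ _ (2%:E * (c * (N * rho) * (2 ^+ k.+1)^-1 `^ (2 / p1 - 1))%:E)).
    by apply: lee_wpmul2l => //; exact: (lb p1 _ p11 k0 h1).
  rewrite -EFinM lee_fin powRV ?exprn_ge0//.
  have := powR2M (- (2 / p1 - 1))%R k.+1 (@ltr01 R).
  rewrite !mul1r powR1 mul1r -/r1 => ->.
  by rewrite [(r1 ^+ k.+1)%R]exprS; apply: eq_le_refl; ring.
apply: le_trans (nneseries_geometric_le _ r101) _.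
  by rewrite mulr_ge0 ?(ltW D0)// mulr_ge0 ?(ltW r10).
by rewrite lee_fin; apply: eq_le_refl; ring.
Qed.

End weak_duality.

Section weak_extrapolation.
Context (R : realType) (n : nat).
Implicit Types (a x : Rn R n) (p q t b C K : R) (w U V : Rn R n -> R).
Implicit Types (f g : Rn R n -> \bar R).
Implicit Types (G : set ((Rn R n -> \bar R) * (Rn R n -> \bar R))).
Local Notation leb := (lebesgue_Rn R n).

Lemma powR_dual_exponent (y z z' s q e : R) : (forall r, z' `^ r = z `^ (- r))%R ->
  (0 < s)%R -> (s < q)%R ->
  ((y `^ (- s) * z `^ e) `^ (- (1 + q - 1)^-1) =
   y `^ (s / q) * (z' `^ (e / (q - s))) `^ (1 - s / q))%R.
Proof.
move=> z'E s0 sq; have q0 := lt_trans s0 sq.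
have qs0 : (q - s)%R != 0%R by rewrite gt_eqF// subr_gt0.
have -> : (1 + q - 1 = q)%R by ring.
rewrite z'E powRM; [|exact: powR_ge0|exact: powR_ge0]; rewrite -!powRrM.
by congr (_ `^ _ * _ `^ _)%R; field; rewrite ?qs0 ?gt_eqF.
Qed.

Lemma powR_split_exponent (y z s q e : R) : (0 < s)%R -> (s < q)%R ->
  ((y `^ (s / q) * (z `^ (e / (q - s))) `^ (1 - s / q)) `^ q = y `^ s * z `^ e)%R.
Proof.
move=> s0 sq; have q0 := lt_trans s0 sq.
have qs0 : (q - s)%R != 0%R by rewrite gt_eqF// subr_gt0.
rewrite powRM ?powR_ge0// -!powRrM.
by congr (_ `^ _ * _ `^ _)%R; field; rewrite ?qs0 ?gt_eqF.
Qed.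

Lemma powR_cancel_le (y z z' C K s e : R) : (0 < y)%R -> (0 < z)%R -> (0 < z')%R ->
  (0 < C)%R -> (0 < e)%R -> (z * z' <= K)%R ->
  ((y / C) `^ (- s) * z `^ e * (y `^ s * z' `^ e) <= C `^ s * K `^ e)%R.
Proof.
move=> y0 z0 z'0 C0 e0 h.
rewrite powRM ?invr_ge0 ?(ltW C0) ?(ltW y0)// powRV ?(ltW C0)// opprK.
rewrite [leLHS](_ : _ = (y `^ (- s) * y `^ s) * C `^ s * (z `^ e * z' `^ e))%R; last by ring.
rewrite -powRDpos// addNr powRr0 mul1r -powRM ?(ltW z0) ?(ltW z'0)//.
by rewrite ler_wpM2l ?powR_ge0//; apply: le_powR h; [exact: ltW|rewrite mulr_ge0 ?(ltW z0) ?(ltW z'0)].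
Qed.

(** The A_2 condition for [V], with the inverse weight carried along so that the two can be
    exchanged. *)
Definition dual_weights K V V' : Prop :=
  [/\ nice V, nice V', forall x, V' x = (V x)^-1%R &
      forall a l, (0 < l)%R -> (mean V a l * mean V' a l <= K)%R].

Lemma dual_weights_sym K V V' : dual_weights K V V' -> dual_weights K V' V.
Proof.
move=> [nV nV' V'E h]; split => // [x|a l l0]; first by rewrite V'E invrK.
by rewrite mulrC h.
Qed.

(** The negative power of [U] is controlled by the A_1 condition. In the dual weight, [U ^ (s / q)]
    times [V' ^ (e / q)], Hoelder's inequality separates the two factors, and [e <= q - s] allows
    Jensen's inequality for the power [e / (q - s)] of [V'] that remains. *)
Lemma Ap_weight_dual C K U V V' (s e q : R) : (1 <= C)%R -> A1_weight C U ->
  dual_weights K V V' -> (0 < s)%R -> (s < q)%R -> (0 < e <= 1)%R -> (e <= q - s)%R ->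
  Ap_weight (1 + q) (C `^ s * K `^ e) (fun x => U x `^ (- s) * V x `^ e)%R.
Proof.
move=> C1 [nU hU] [nV nV' V'E hK] s0 sq e01 eqs.
have C0 : (0 < C)%R by exact: lt_le_trans C1.
have q0 : (0 < q)%R by exact: lt_trans sq.
have qs0 : (0 < q - s)%R by rewrite subr_gt0.
have /andP[e0 e1] := e01.
have [U0 mU _] := nU; have [V0 mV _] := nV; have [V'0 mV' _] := nV'.
have r01 : (0 < s / q < 1)%R by rewrite divr_gt0//= ltr_pdivrMr// mul1r.
have /andP[r0 r1] := r01.
have g01 : (0 < e / (q - s) <= 1)%R by rewrite divr_gt0//= ler_pdivrMr// mul1r.
have [nVe hVe] := mean_powR e01 nV.
have [nG hG] := mean_powR g01 nV'.
have [nS hS] := mean_hoelder r01 nU nG.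
have Ule a l : (0 < l)%R -> \forall x \ae leb, cube a l x ->
    (U x `^ (- s) * V x `^ e <= (mean U a l / C) `^ (- s) * V x `^ e)%R.
  move=> l0; apply: filterS (hU a l l0) => x hx ax.
  rewrite ler_wpM2r ?powR_ge0//; apply: ge_powRN; first exact: ltW.
    by rewrite divr_gt0// mean_gt0.
  by rewrite ler_pdivrMr// mulrC; exact: hx.
set W := (fun x => _)%R.
have W0 x : (0 < W x)%R by rewrite mulr_gt0 ?powR_gt0.
have nW : nice W.
  apply: nice_le => //.
    by apply: measurable_funM; exact: measurable_fun_powR.
  move=> a l l0; exists (fun x => V x `^ e)%R => //.
  by exists ((mean U a l / C) `^ (- s))%R; [exact: powR_ge0|exact: Ule].
have SE : (fun x => W x `^ (- (1 + q - 1)^-1))%R =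
    (fun x => U x `^ (s / q) * (V' x `^ (e / (q - s))) `^ (1 - s / q))%R.
  apply/funext => x; apply: powR_dual_exponent => // r.
  by rewrite V'E powRV// ltW.
split; rewrite ?SE// => a l l0.
have mU0 := mean_gt0 a nU l0; have mV0 := mean_gt0 a nV l0.
have mV'0 := mean_gt0 a nV' l0; have mG0 := mean_gt0 a nG l0.
have h1 : (mean W a l <= (mean U a l / C) `^ (- s) * mean V a l `^ e)%R.
  apply: le_trans (mean_le nW nVe l0 (powR_ge0 _ _) (Ule a l l0)) _.
  by rewrite ler_wpM2l ?powR_ge0// hVe.
have h2 : (mean (fun x => U x `^ (s / q) * (V' x `^ (e / (q - s))) `^ (1 - s / q)) a l
    `^ (1 + q - 1) <= mean U a l `^ s * mean V' a l `^ e)%R.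
  rewrite [(1 + q)%R]addrC addrK.
  apply: (@le_trans _ _ ((mean U a l `^ (s / q) *
      (mean V' a l `^ (e / (q - s))) `^ (1 - s / q)) `^ q)%R).
    apply: le_powR; [exact: ltW|by apply: mean_ge0 (ltW l0) => x; rewrite mulr_ge0 ?powR_ge0|].
    apply: le_trans (hS a l l0) _; rewrite ler_wpM2l ?powR_ge0//.
    apply: le_powR; [by rewrite subr_ge0 ltW|exact: ltW|exact: hG].
  by apply: eq_le_refl; exact: powR_split_exponent.
apply: le_trans (ler_pM _ _ h1 h2) _.
- exact/ltW/mean_gt0.
- exact: powR_ge0.
by apply: powR_cancel_le (hK a l l0); rewrite ?(ltW C0).
Qed.

(** With [u = U ^ tau] and [v = V ^ d] this is [u ^ (1 - p) * v ^ (1 - p / 2)]. *)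
Definition interp_weight (tau d p : R) U V x : R :=
  (U x `^ (- (tau * (p - 1))) * V x `^ (d * (1 - p / 2)))%R.

Lemma Ap_weight_congr p p' K K' w w' : p = p' -> (K <= K')%R -> w =1 w' ->
  Ap_weight p K w -> Ap_weight p' K' w'.
Proof.
move=> -> KK' /funext -> [nw ns h]; split => // a l l0.
exact: le_trans (h a l l0) KK'.
Qed.

(* At [p = 2] the weight [u^(1-p) v^(1-p/2)] does not involve [v]; near [2] the
   power of [v] is so small that [v] being a power of an [A_2] weight suffices,
   the room being provided by [u] being a power less than [1] of [U]. *)
Lemma Ap_weight_interp C K U V V' (tau d : R) : (1 <= C)%R -> A1_weight C U ->
  dual_weights K V V' -> (0 < tau < 1)%R -> (0 < d)%R ->
  exists al xi K', [/\ (0 < al < 1)%R, (0 < xi <= 3^-1)%R &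
    forall p, p = (2 - xi)%R \/ p = (2 + xi)%R -> (1 < p * al)%R /\
      Ap_weight (p * al) K' (interp_weight tau d p U V)].
Proof.
move=> C1 hU hV /andP[tau0 tau1] d0.
(* For [p = 2] the room [p * al - 1 - tau * (p - 1)] equals [(1 - tau) / 2]. For [p = 2 - xi] and
   [p = 2 + xi] at least half of it is left, and [xi] is so small that the power [d * xi / 2] of [V]
   or [V'] fits in. *)
pose al : R := ((3 + tau) / 4)%R.
pose xi : R := Num.min (3^-1)%R ((1 - tau) / (2 * d))%R.
have xi0 : (0 < xi)%R.
  by rewrite lt_min invr_gt0 ltr0n/= divr_gt0 ?subr_gt0// mulr_gt0.
have xi3 : (xi <= 3^-1)%R by rewrite ge_min lexx.
have xid : (d * xi / 2 <= (1 - tau) / 4)%R.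
  have : (xi <= (1 - tau) / (2 * d))%R by rewrite ge_min lexx orbT.
  rewrite ler_pdivlMr ?mulr_gt0//; lra.
have e0 : (0 < d * xi / 2)%R by rewrite divr_gt0// mulr_gt0.
have al34 : (3 / 4 < al < 1)%R by rewrite /al; lra.
have xit : (0 <= xi * (1 - tau) <= (1 - tau) / 3)%R by rewrite /al; nra.
have xi13 : (xi <= 1 / 3)%R by rewrite div1r.
clearbody xi.
have e01 : (0 < d * xi / 2 <= 1)%R by rewrite e0; lra.
have c1 : (0 < tau * (1 - xi))%R by rewrite mulr_gt0//; lra.
have c2 : (0 < tau * (1 + xi))%R by rewrite mulr_gt0//; lra.
have c3 : (d * xi / 2 <= (2 - xi) * al - 1 - tau * (1 - xi))%R by rewrite /al; lra.
have c4 : (d * xi / 2 <= (2 + xi) * al - 1 - tau * (1 + xi))%R by rewrite /al; lra.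
have c5 : (tau * (1 - xi) < (2 - xi) * al - 1)%R by lra.
have c6 : (tau * (1 + xi) < (2 + xi) * al - 1)%R by lra.
have A1 := Ap_weight_dual C1 hU hV c1 c5 e01 c3.
(* For [p > 2] the power of [V] is negative, that is, a positive power of [V']. *)
have A2 := Ap_weight_dual C1 hU (dual_weights_sym hV) c2 c6 e01 c4.
exists al, xi, (Num.max (C `^ (tau * (1 - xi)) * K `^ (d * xi / 2))
  (C `^ (tau * (1 + xi)) * K `^ (d * xi / 2)))%R.
split; [by move: al34; lra|by rewrite xi0|].
have [[V0 _ _] _ V'E _] := hV.
move=> p [->|->]; (split; first by lra).
  apply: Ap_weight_congr A1; [by ring|by rewrite le_max lexx|move=> x].
  by congr (_ `^ _ * _ `^ _)%R; field.
apply: Ap_weight_congr A2; [by ring|by rewrite le_max lexx orbT|move=> x].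
rewrite V'E powRV ?(ltW (V0 x))//.
by congr (_ `^ _ * _ `^ _)%R; field.
Qed.

(** This identity dictates the exponents of [interp_weight]: whatever [p], the test function built
    on a level set has as its integral the mass of that set under [u v dx]. *)
Lemma interp_weight_mass (tau d p : R) U V x : (0 < U x)%R -> (0 < V x)%R ->
  ((U x `^ tau * V x `^ (d / 2)) `^ p * interp_weight tau d p U V x =
   U x `^ tau * V x `^ d)%R.
Proof.
move=> U0 V0; rewrite /interp_weight powRM ?powR_ge0// -!powRrM mulrACA.
by rewrite -!powRDpos//; congr (_ `^ _ * _ `^ _)%R; field.
Qed.

Lemma interp_weight_dual (tau d p al X : R) U V x : (0 < U x)%R -> (0 < V x)%R ->
  ((X `^ al * (U x `^ tau * V x `^ (d / 2))^-1) `^ p * (U x `^ tau * V x `^ d) =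
   X `^ (p * al) * interp_weight tau d p U V x)%R.
Proof.
move=> U0 V0; rewrite -(interp_weight_mass tau d p U0 V0) mulrA.
set z := (U x `^ tau * V x `^ (d / 2))%R.
have z0 : (0 < z)%R by rewrite mulr_gt0 ?powR_gt0.
rewrite -powRM ?mulr_ge0 ?powR_ge0 ?invr_ge0 ?(ltW z0)// divfK ?gt_eqF//.
by rewrite -powRrM [(al * p)%R]mulrC.
Qed.

(** With [m = u * v] and [r = v ^ (- theta)], a bound for the weak norm of [f / v ^ theta], free of
    suprema and divisions. *)
Definition weak_bounded theta (m r : Rn R n -> R) f (D : R) : Prop :=
  forall s : R, (0 < s)%R ->
  s%:E * (\int[leb]_(x in [set x | s%:E < f x * (r x)%:E]) (m x)%:E) `^ theta <= D%:E.

Theorem weak_extrapolation G theta C K U V V' (tau d : R) : (0 < theta)%R ->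
  borel_pairs G -> good G (2 * theta)^-1 ->
  (1 <= C)%R -> A1_weight C U -> dual_weights K V V' -> (0 < tau < 1)%R -> (0 < d)%R ->
  let m x := (U x `^ tau * V x `^ d)%R in
  let r x := (V x `^ (- (d * theta)))%R in
  exists2 K1 : R, (0 < K1)%R & forall f g, G (f, g) -> forall D0 D : R,
    (0 < D0)%R -> (0 < D)%R -> weak_bounded theta m r f D0 ->
    weak_bounded theta m r g D -> weak_bounded theta m r f (K1 * D).
Proof.
move=> th0 bG gG C1 hU hV tau01 d0 m r.
have [[U0 mU _] _] := hU; have [[V0 mV _] _ _ _] := hV.
have m0 x : (0 < m x)%R by rewrite mulr_gt0 ?powR_gt0.
have r0 x : (0 < r x)%R by rewrite powR_gt0.
have mm : measurable_fun setT m.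
  by apply: measurable_funM; exact: measurable_fun_powR.
have mr : measurable_fun setT r by exact: measurable_fun_powR.
have [al [xi [K' [al01 /andP[xi0 xi3] hAp]]]] := Ap_weight_interp C1 hU hV tau01 d0.
have /andP[al0 al1] := al01.
set p1 : R := (2 - xi)%R in hAp; set p2 : R := (2 + xi)%R in hAp.
have [p1al hA1] := hAp p1 (or_introl erefl).
have [p2al hA2] := hAp p2 (or_intror erefl).
have p12 : (1 < p1 < 2)%R by rewrite /p1; lra.
have p22 : (2 < p2)%R by rewrite /p2; lra.
have p1al3 : (p1 * al <= 3)%R by rewrite /p1; nra.
have p2al3 : (p2 * al <= 3)%R by rewrite /p2; nra.
clearbody p1 p2.
have [KM1 KM11 hKM1] := @maximal_bounded_Ap R n (p1 * al) K' p1al.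
have [KM2 KM21 hKM2] := @maximal_bounded_Ap R n (p2 * al) K' p2al.
have {}hKM1 := hKM1 _ hA1; have {}hKM2 := hKM2 _ hA2.
pose KM := Num.max KM1 KM2.
have KM1' : (1 <= KM)%R by rewrite le_max KM11.
have KM0 : (0 < KM)%R by exact: lt_le_trans KM1'.
have bounded_le (p K0 : R) w : (0 < p)%R -> (forall x, 0 < w x)%R -> (1 <= K0 <= KM)%R ->
    maximal_bounded p K0 w -> maximal_bounded p KM w.
  move=> p0 w0 /andP[K01 K0M] h f mf f0; apply: le_trans (h f mf f0) _.
  apply: lee_wpmul2r; first by apply: integral_ge0 => x _; exact: poweR_mul_ge0.
  rewrite lee_fin; apply: le_powR => //; first exact: ltW.
  exact: le_trans K01.
have w0 p x : (0 < interp_weight tau d p U V x)%R by rewrite mulr_gt0 ?powR_gt0.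
have mw p : measurable_fun setT (interp_weight tau d p U V).
  by apply: measurable_funM; exact: measurable_fun_powR.
have {}hKM1 : maximal_bounded (p1 * al) KM (interp_weight tau d p1 U V).
  apply: bounded_le hKM1 => //; first exact: lt_trans p1al.
  by rewrite KM11 le_max lexx.
have {}hKM2 : maximal_bounded (p2 * al) KM (interp_weight tau d p2 U V).
  apply: bounded_le hKM2 => //; first exact: lt_trans p2al.
  by rewrite KM21 le_max lexx orbT.
pose C' := (2 * KM)%R.
have C'1 : (1 <= C')%R by rewrite /C'; lra.
(* The weight will be a power [al] of a majorant; it is put in factored form with [B = 1]. *)
have [KG KG0 hKG] := gG al 1%R C' al01 ltr01 C'1.
have [KD KD0 hKD] := weak_duality leb p12 p22.
set p := ((2 * theta)^-1)%R in gG hKG.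
have p0 : (0 < p)%R by rewrite invr_gt0 mulr_gt0.
(* Both exponents [p1 * al] and [p2 * al] are at most 3, so the factors [2 ^ (p * al)] of the
   algorithm are at most 8. *)
have c8 (z : R) : (0 < z)%R -> (z <= 3)%R -> (2 `^ z <= 8 :> R)%R.
  move=> z0 z3; apply: (@le_trans _ _ (2 `^ 3%:R)%R).
    by apply: ler_powR => //; rewrite ler1n.
  by rewrite powR_mulrn// -natrX.
pose K3 := (KG * (KD * 8))%R; have K30 : (0 < K3)%R by rewrite !mulr_gt0.
exists (K3 `^ p^-1)%R; first exact: powR_gt0.
move=> f g fg D0 D D00 DD0 wf wg t t0.
have [mf mg f0 g0] := bG _ _ fg.
have mfr phi : measurable_fun setT phi ->
    measurable_fun setT (fun x => phi x * (r x)%:E).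
  by move=> mphi; apply: emeasurable_funM => //; exact/measurable_EFinP.
have fr0 phi x : (forall x, 0 <= phi x) -> 0 <= phi x * (r x)%:E.
  by move=> h; rewrite mule_ge0// lee_fin ltW.
set E := [set x | t%:E < f x * (r x)%:E].
have mE : measurable E by rewrite -[E]setTI; exact: emeasurable_fun_o_infty (mfr _ mf) _.
have E0 : 0 <= \int[leb]_(x in E) (m x)%:E.
  by apply: integral_ge0 => x _; rewrite lee_fin ltW.
have K3D : (0 < K3 `^ p^-1 * D)%R by rewrite mulr_gt0 ?powR_gt0.
move: E0; rewrite le_eqVlt => /orP[/eqP <-|E0].
  by rewrite poweR0r ?gt_eqF// mule0 lee_fin ltW.
have Eoo : \int[leb]_(x in E) (m x)%:E < +oo.
  rewrite ltNge; apply/negP; rewrite leye_eq => /eqP Eoo.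
  by have := wf t t0; rewrite -/E Eoo poweRyr ?gt_eqF// gt0_muley.
have [M M0 ME] := gt0_le_fin E0 Eoo.
(* The square root of the mass of [E] is its norm in L^2, the scale in which [weak_duality] is
   stated. *)
pose rho := Num.sqrt M; have rho0 : (0 < rho)%R by rewrite sqrtr_gt0.
have rho2 : M = (rho ^+ 2)%R by rewrite sqr_sqrtr// ltW.
clearbody rho; subst M.
rewrite ME.
pose z x := (U x `^ tau * V x `^ (d / 2))%R.
have z0 x : (0 < z x)%R by rewrite mulr_gt0 ?powR_gt0.
have mz : measurable_fun setT z by apply: measurable_funM; exact: measurable_fun_powR.
pose h x := (z x `^ al^-1 * \1_E x)%:E.
have mh : measurable_fun setT h.
  apply/measurable_EFinP; apply: measurable_funM; first exact: measurable_fun_powR.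
  exact: measurable_indic.
have h0 x : 0 <= h x by rewrite lee_fin mulr_ge0 ?powR_ge0.
have hI (q : R) : (0 < q)%R -> \int[leb]_x (h x `^ (q * al) * (interp_weight tau d q U V x)%:E) = (rho ^+ 2)%:E.
  move=> q0; rewrite -ME [RHS]integral_mkcond; apply: eq_integral => x _.
  rewrite patchE /h indicE; case: (x \in E); last first.
    by rewrite mulr0 poweR0r ?mul0e// gt_eqF// mulr_gt0.
  rewrite mulr1 poweR_EFin -EFinM -powRrM (_ : al^-1 * (q * al) = q)%R; last first.
    by field; rewrite gt_eqF.
  by rewrite interp_weight_mass.
have p10 : (0 < p1)%R by case/andP: p12 => + _; exact: lt_trans.
have p20 : (0 < p2)%R by exact: lt_trans p22.
have hgt : 0 < \int[leb]_x (h x `^ (p1 * al) * (interp_weight tau d p1 U V x)%:E) < +oo.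
  by rewrite hI// ltry lte_fin exprn_gt0.
have [X [hX hX1 hX2 hX3]] := rubio_de_francia KM0 mh h0 (ltW p1al) (ltW p2al)
  (mw p1) (mw p2) (w0 p1) (w0 p2) hKM1 hKM2 hgt.
have [[X0 mX _] _] := hX.
rewrite hI// in hX2; rewrite hI// in hX3.
have h1 : A1_weight C' (cst 1%R : Rn R n -> R).
  by apply: A1_weight_le C'1 _; exact: A1_weight_cst.
have WE x : factored X (cst 1%R) al 1 x = (X x `^ al)%R.
  by rewrite /factored powR1 mulr1.
pose H x := (X x `^ al * (z x)^-1)%:E.
have H0 x : 0 <= H x by rewrite lee_fin mulr_ge0 ?powR_ge0// invr_ge0 ltW.
have mH : measurable_fun setT H.
  apply/measurable_EFinP; apply: measurable_funM; first exact: measurable_fun_powR.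
  exact: measurable_inv_pos.
have HI q : (0 < q)%R -> (q * al <= 3)%R ->
    \int[leb]_x ((X x)%:E `^ (q * al) * (interp_weight tau d q U V x)%:E) <=
      (2 `^ (q * al))%:E * (rho ^+ 2)%:E ->
    \int[leb]_x (H x `^ q * (m x)%:E) <= (8 * rho ^+ 2)%:E.
  move=> q0 q3 hq; have -> : \int[leb]_x (H x `^ q * (m x)%:E) =
      \int[leb]_x ((X x)%:E `^ (q * al) * (interp_weight tau d q U V x)%:E).
    by apply: eq_integral => x _; rewrite !poweR_EFin -!EFinM interp_weight_dual.
  apply: le_trans hq _; rewrite -EFinM lee_fin ler_wpM2r ?exprn_ge0 ?(ltW rho0)//.
  by apply: c8 => //; rewrite mulr_gt0.
have rE x : ((r x) `^ p = (V x `^ (d / 2))^-1)%R.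
  rewrite /r -powRrM -powRN; congr (_ `^ _)%R; rewrite /p; field.
  by rewrite gt_eqF.
(* With [v = V ^ d], the choice [p = 1 / (2 * theta)] makes [r ^ p] the inverse of the square root
   of [v], which is just the factor by which [m] differs from [z]. Hence pairing with [H * m] gives
   the weight [X ^ al]. *)
have rm x : (r x `^ p * ((z x)^-1 * m x) = 1)%R.
  have -> : m x = (z x * V x `^ (d / 2))%R.
    by rewrite /m /z -mulrA -powRDpos// -splitr.
  by rewrite rE; field; rewrite !gt_eqF// powR_gt0.
have dual (phi : Rn R n -> \bar R) D' : measurable_fun setT phi -> (forall x, 0 <= phi x) ->
    (0 < D')%R -> weak_bounded theta m r phi D' ->
    \int[leb]_x (phi x `^ p * (factored X (cst 1%R) al 1 x)%:E) <=
    (KD * (8 * (D' `^ p * rho)))%:E.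
  move=> mphi phi0 D'0 wphi.
  have -> : \int[leb]_x (phi x `^ p * (factored X (cst 1%R) al 1 x)%:E) =
      \int[leb]_x ((phi x * (r x)%:E) `^ p * (H x * (m x)%:E)).
    apply: eq_integral => x _; rewrite poweRM ?lee_fin ?(ltW (r0 x))// -muleA.
    rewrite poweR_EFin -!EFinM WE; congr (_ * _%:E).
    rewrite -[in LHS](mulr1 (X x `^ al)%R) -(rm x).
    by ring.
  apply: hKD => //.
  - exact: powR_gt0.
  - by rewrite ler1n.
  - exact: measurableT_comp (measurable_poweR _) (mfr _ mphi).
  - by move=> x; exact: poweR_ge0.
  (* The weak bound at the level [l ^ (1 / p)], raised to the power [2 * p], is a weak L^2 bound, as
     [theta * (2 * p) = 1]. *)
  - move=> l l0; have sp : (0 < l `^ p^-1)%R by exact: powR_gt0.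
    have I0 S : 0 <= \int[leb]_(x in S) (m x)%:E.
      by apply: integral_ge0 => x _; rewrite lee_fin ltW.
    have := wphi _ sp; set S := [set x | _] => hS.
    apply: (@le_trans _ _ ((l ^+ 2)%:E * \int[leb]_(x in S) (m x)%:E)).
      apply: lee_wpmul2l; first by rewrite lee_fin exprn_ge0// ltW.
      apply: le_integral_subset => [x|x /=]; first by rewrite lee_fin ltW.
      rewrite ltNge => /negP xl; rewrite /S/= ltNge; apply/negP; rewrite -(poweR_EFin l) => le1.
      apply: xl; apply: (le_poweR_rootl p0) le1; [exact: fr0|by rewrite lee_fin ltW].
    have p20' : (0 <= 2 * p)%R by rewrite mulr_ge0// ltW.
    have lp0 : 0 <= (l `^ p^-1)%:E by rewrite lee_fin ltW.
    have It0 : 0 <= (\int[leb]_(x in S) (m x)%:E) `^ theta by exact: poweR_ge0.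
    have := le_poweR p20' (mule_ge0 lp0 It0) hS.
    rewrite (poweRM _ lp0 It0) (poweR_EFin (l `^ p^-1)) -(powRrM l).
    rewrite -(poweRrM (\int[leb]_(x in S) (m x)%:E)).
    have -> : (theta * (2 * p) = 1)%R by rewrite /p; field; rewrite gt_eqF.
    have -> : (p^-1 * (2 * p) = 2%:R)%R by field; rewrite gt_eqF.
    rewrite poweRe1// powR_mulrn ?(ltW l0)// => /le_trans; apply.
    by rewrite poweR_EFin lee_fin [(2 * p)%R]mulrC powRrM powR_mulrn ?powR_ge0.
  - exact: HI.
  - exact: HI.
have fb := dual f D0 mf f0 D00 wf; have gb := dual g D mg g0 DD0 wg.
have key := hKG X (cst 1%R) hX h1 f g fg (le_lt_trans fb (ltry _)).
have {}key : ((t `^ p * rho ^+ 2)%:E <= (KG * (KD * (8 * (D `^ p * rho))))%:E)%E.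
  apply: (@le_trans _ _ (\int[leb]_x (f x `^ p * (factored X (cst 1%R) al 1 x)%:E))); last first.
    apply: le_trans key _; rewrite [leRHS]EFinM; apply: lee_wpmul2l => //.
    by rewrite lee_fin ltW.
  rewrite EFinM -ME -ge0_integralZl_EFin//; last 3 first.
  - by move=> x _; rewrite lee_fin ltW.
  - by apply: measurable_funTS; exact/measurable_EFinP.
  - exact: powR_ge0.
  rewrite integral_mkcond; apply: ae_le_integral => [x|x|].
  - by rewrite patchE; case: ifP => // _; rewrite lee_fin mulr_ge0 ?powR_ge0// ltW.
  - by rewrite mule_ge0 ?poweR_ge0// WE lee_fin powR_ge0.
  apply: filterS hX1 => x hx; rewrite patchE; case: ifPn => [|_]; last first.
    by rewrite mule_ge0 ?poweR_ge0// WE lee_fin powR_ge0.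
  move=> xE; rewrite WE.
  have : (z x <= X x `^ al)%R.
    move: hx; rewrite /h indicE xE mulr1 lee_fin => hx.
    rewrite -[leLHS](powRr1 (ltW (z0 x))) -(mulVf (lt0r_neq0 al0)) powRrM.
    by apply: le_powR => //; [exact: ltW|exact: powR_ge0].
  move=> zX; apply: (@le_trans _ _ (f x `^ p * (z x)%:E)); last first.
    by apply: lee_wpmul2l; [exact: poweR_ge0|].
  move: xE; rewrite inE /E/= => xE.
  have : (t `^ p)%:E <= (f x * (r x)%:E) `^ p.
    by rewrite -poweR_EFin; apply: le_poweR; [exact: ltW|rewrite lee_fin ltW|exact: ltW].
  rewrite poweRM ?lee_fin ?(ltW (r0 x))// poweR_EFin => ht.
  apply: (@le_trans _ _ (f x `^ p * (r x `^ p)%:E * (m x)%:E)).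
    by apply: lee_wpmul2r => //; rewrite lee_fin ltW.
  rewrite -muleA -EFinM; apply: lee_wpmul2l; first exact: poweR_ge0.
  rewrite lee_fin; apply: eq_le_refl.
  rewrite -[RHS]mulr1 -[X in (_ = _ * X)%R](rm x) [RHS]mulrCA.
  congr (_ * _)%R; rewrite mulrA mulfV; first by rewrite mul1r.
  by rewrite gt_eqF.
have {}key : (t `^ p * rho <= K3 * D `^ p)%R.
  rewrite -(ler_pM2r rho0) -mulrA -expr2; move: key; rewrite lee_fin => /le_trans; apply.
  by rewrite /K3; apply: eq_le_refl; ring.
rewrite poweR_EFin -EFinM lee_fin.
have pi0 : (0 <= p^-1)%R by rewrite invr_ge0 ltW.
have pn : p != 0%R by rewrite gt_eqF.
have tk : ((t `^ p * rho) `^ p^-1 = t * rho `^ p^-1)%R.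
  rewrite (@powRM _ (t `^ p)%R); [|exact: powR_ge0|exact: ltW].
  by rewrite -(powRrM t) mulfV// powRr1// ltW.
have Dk : ((K3 * D `^ p) `^ p^-1 = K3 `^ p^-1 * D)%R.
  rewrite (@powRM _ K3); [|exact: ltW|exact: powR_ge0].
  by rewrite -(powRrM D) mulfV// (powRr1 (ltW DD0)).
have tp0 : (0 <= t `^ p * rho)%R by rewrite mulr_ge0 ?powR_ge0// ltW.
have := le_powR pi0 tp0 key; rewrite tk Dk; apply: le_trans.
rewrite -(powR_mulrn 2 (ltW rho0)) -(powRrM rho) /p invrK.
exact: lexx.
Qed.

End weak_extrapolation.

(** * Non-Borel functions and weights *)

Section borel_versions.
Context (R : realType) (n : nat).
Implicit Types (a x : Rn R n) (u v w : Rn R n -> R) (f g : Rn R n -> \bar R).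
Local Notation leb := (lebesgue_Rn R n).

Lemma borel_ge0 f : (forall x, 0 <= f x) -> lebesgue_measurable_fun f ->
  exists f', [/\ measurable_fun setT f', forall x, 0 <= f' x &
    \forall x \ae leb, f x = f' x].
Proof.
move=> f0 [k mk fk]; exists (fun x => maxe (k x) 0); split.
- exact: measurable_maxe.
- by move=> x; rewrite le_max lexx orbT.
- by apply: filterS fk => x fk; rewrite -fk; apply/esym/max_idPl.
Qed.

Lemma borel_gt0 w : weight w -> (\forall x \ae leb, (0 < w x)%R) ->
  exists w', [/\ measurable_fun setT w', forall x, (0 < w' x)%R &
    \forall x \ae leb, w x = w' x].
Proof.
move=> [w0 [k mk wk]] wpos.
have mf : measurable_fun setT (fun x => fine (k x)) by exact: measurableT_comp mk.
exists (fun x => if (0 < fine (k x))%R then fine (k x) else 1%R); split.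
- by apply: measurable_fun_ifT => //; exact: measurable_fun_ltr.
- by move=> x; case: ifPn.
- by apply: filterS2 wk wpos => x wkx wx; rewrite -wkx /= wx.
Qed.

Lemma ae_eq_integral_cube f g a l : (forall x, 0 <= f x) -> (forall x, 0 <= g x) ->
  (\forall x \ae leb, f x = g x) ->
  \int[leb]_(x in cube a l) f x = \int[leb]_(x in cube a l) g x.
Proof.
move=> f0 g0 fg; apply/eqP; rewrite eq_le; apply/andP; split;
  by apply: ae_le_integral_in => //; apply: filterS fg => x -> _.
Qed.

Lemma nice_borel w w' : regular_weight w -> measurable_fun setT w' ->
  (forall x, (0 < w' x)%R) -> (\forall x \ae leb, w x = w' x) -> nice w'.
Proof.
move=> [[w0 _] iw _] mw' w'0 ww'; split => // a l l0.
rewrite -(@ae_eq_integral_cube (EFin \o w)).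
- by apply: iw; exists a, l.
- by move=> x; rewrite lee_fin.
- by move=> x; rewrite lee_fin ltW.
- by apply: filterS ww' => x /= ->.
Qed.

Lemma avg_borel w w' a l : (forall x, 0 <= w x)%R -> nice w' ->
  (\forall x \ae leb, w x = w' x) -> (0 < l)%R ->
  avg (EFin \o w) (cube a l) = (mean w' a l)%:E.
Proof.
move=> w0 nw' ww' l0; rewrite -avg_mean// /avg; congr (_ / _).
have [w'0 _ _] := nw'; apply: ae_eq_integral_cube => [x|x|].
- by rewrite lee_fin.
- by rewrite lee_fin ltW.
- by apply: filterS ww' => x /= ->.
Qed.

Lemma A1_borel w w' : A1 w -> measurable_fun setT w' -> (forall x, (0 < w' x)%R) ->
  (\forall x \ae leb, w x = w' x) -> exists2 C : R, (1 <= C)%R & A1_weight C w'.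
Proof.
move=> [rw [C hC]] mw' w'0 ww'; have nw' := nice_borel rw mw' w'0 ww'.
have [[w0 _] _ _] := rw.
exists (Num.max 1 C)%R; first by rewrite le_max lexx.
split => // a l l0; have aww' := ww'; apply: filterS2 hC aww' => x hx wx ax.
rewrite -lee_fin -(avg_borel a w0 nw' ww' l0).
apply: (@le_trans _ _ (maximal (EFin \o w) x)).
  by apply: ereal_sup_ubound; exists (cube a l) => //; split => //; exists a, l.
apply: le_trans hx _; rewrite wx lee_fin ler_wpM2r ?(ltW (w'0 x))//.
by rewrite le_max lexx orbT.
Qed.

Lemma Ainfty_borel w w' : Ainfty w -> measurable_fun setT w' ->
  (forall x, (0 < w' x)%R) -> (\forall x \ae leb, w x = w' x) ->
  exists p K : R, (1 < p)%R /\ Ap_weight p K w'.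
Proof.
move=> [A1w|[p p1 [rw [C hC]]]] mw' w'0 ww'.
  have [C C1 hw'] := A1_borel A1w mw' w'0 ww'.
  have C0 : (0 < C)%R by exact: lt_le_trans C1.
  have h1 : A1_weight C (cst 1%R : Rn R n -> R).
    exact: A1_weight_le C1 (@A1_weight_cst R n).
  (* An A_1 weight is an A_2 weight, being factored with [B = 1] and [t = b = 1]. *)
  exists (1 + 1)%R, (C `^ 1 * C `^ 1)%R; split; first by rewrite ltrDl.
  apply: Ap_weight_congr (Ap_factored hw' h1 C0 _ ltr01) => //.
    by move=> x; rewrite powR1 mulr1 powRr1// ltW.
  by rewrite ltr01 lexx.
have nw' := nice_borel rw mw' w'0 ww'; have [[w0 _] _ _] := rw.
have p10 : (0 < p - 1)%R by rewrite subr_gt0.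
pose s x := (w' x `^ (- (p - 1)^-1))%R.
have s0 x : (0 < s x)%R by exact: powR_gt0.
have ms : measurable_fun setT s by exact: measurable_fun_powR.
have avgE a l : avg (fun x => (w x `^ (- (p - 1)^-1))%:E) (cube a l) =
    avg (EFin \o s) (cube a l).
  rewrite /avg; congr (_ / _); apply: ae_eq_integral_cube => [x|x|].
  - by rewrite lee_fin powR_ge0.
  - by rewrite lee_fin powR_ge0.
  - by apply: filterS ww' => x /= ->.
(* An infinite integral of the dual weight over a cube would make the A_p product infinite there,
   the mean of [w'] being positive. *)
have ns : nice s.
  split => // a l l0; rewrite ltNge leye_eq; apply/negP => /eqP Ioo.
  have := hC (cube a l) (ex_intro _ a (ex_intro _ l (conj l0 erefl))).
  rewrite (avg_borel a w0 nw' ww' l0) avgE /avg Ioo leb_cube ?(ltW l0)//.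
  rewrite inver gt_eqF ?exprn_gt0// gt0_mulye ?lte_fin ?invr_gt0 ?exprn_gt0//.
  by rewrite poweRyr ?gt_eqF// gt0_muley ?lte_fin ?mean_gt0.
exists p, C; split => //; split => // a l l0.
have := hC (cube a l) (ex_intro _ a (ex_intro _ l (conj l0 erefl))).
by rewrite (avg_borel a w0 nw' ww' l0) avgE avg_mean.
Qed.

(** A small power of an A_p weight is an A_2 weight: [t] is taken such that [t] and [t * (p - 1)]
    are both at most 1, so that Jensen's inequality applies to the means of the weight and of its
    dual. *)
Lemma Ap_weight_dual_weights p K w delta v : (1 < p)%R -> Ap_weight p K w ->
  (0 < delta)%R -> (forall x, (0 < v x)%R) -> (forall x, w x = v x `^ delta)%R ->
  exists V V' K' d, [/\ (0 < d)%R, dual_weights K' V V' & forall x, v x = (V x `^ d)%R].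
Proof.
move=> p1 [nw ns hK] d0 v0 wE; have p10 : (0 < p - 1)%R by rewrite subr_gt0.
have [w0 mw _] := nw.
pose t : R := (Num.min 1 (p - 1)^-1)%R.
have t01 : (0 < t <= 1)%R by rewrite lt_min ltr01 invr_gt0 p10 ge_min lexx.
have /andP[t0 t1] := t01.
have tp01 : (0 < t * (p - 1) <= 1)%R.
  by rewrite mulr_gt0//= -ler_pdivlMr// div1r ge_min lexx orbT.
clearbody t.
have [nV hV] := mean_powR t01 nw; have [nV' hV'] := mean_powR tp01 ns.
exists (fun x => w x `^ t)%R, (fun x => (w x `^ (- (p - 1)^-1)) `^ (t * (p - 1)))%R,
  (K `^ t)%R, ((delta * t)^-1)%R.
have pn : (p - 1)%R != 0%R by rewrite gt_eqF.
split.
- by rewrite invr_gt0 mulr_gt0.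
- split => // [x|a l l0].
    rewrite -powRrM -powRN; congr (_ `^ _)%R.
    by field.
  have mw0 := mean_gt0 a nw l0; have ms0 := mean_gt0 a ns l0.
  apply: le_trans (ler_pM _ _ (hV a l l0) (hV' a l l0)) _.
  - exact/ltW/mean_gt0.
  - exact/ltW/mean_gt0.
  have z0 : (0 <= mean w a l * mean (fun x => w x `^ (- (p - 1)^-1)) a l `^ (p - 1))%R.
    by apply: mulr_ge0; [exact: ltW|exact: powR_ge0].
  apply: le_trans (le_powR (ltW t0) z0 (hK a l l0)).
  rewrite (@powRM _ (mean w a l)); [|exact: ltW|exact: powR_ge0].
  by rewrite -(powRrM (mean _ a l)) [(t * _)%R]mulrC.
- move=> x; rewrite wE -!powRrM mulrA mulfV ?powRr1// ?ltW//.
  by rewrite gt_eqF// mulr_gt0.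
Qed.

Lemma weakLnorm_ge0 (mu : set (Rn R n) -> \bar R) p f : (forall S, 0 <= mu S) ->
  0 <= weakLnorm mu p f.
Proof.
move=> mu0; apply: le_trans (ereal_sup_ubound _) => /=; last by exists 1%R => //=.
by rewrite mule_ge0 ?poweR_ge0.
Qed.

Lemma weakLnorm_bounded u v m r theta f f' (D : R) : (0 < theta)%R ->
  (forall x, 0 <= u x)%R -> (forall x, 0 <= v x)%R ->
  (forall x, 0 < m x)%R -> (forall x, 0 < r x)%R -> (forall x, 0 <= f' x) ->
  (\forall x \ae leb, [/\ (u x * v x = m x)%R, (0 < v x)%R,
     (v x `^ (- theta) = r x)%R & f x = f' x]) ->
  weakLnorm (weighted_measure (fun x => u x * v x)%R) theta^-1
    (fun x => f x / (v x `^ theta)%:E) <= D%:E <->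
  weak_bounded theta m r f' D.
Proof.
move=> th0 u0 v0 m0 r0 f'0 h.
have E t : weighted_measure (fun x => u x * v x)%R
    [set x | t%:E < `|f x / (v x `^ theta)%:E|] =
    \int[leb]_(x in [set x | t%:E < f' x * (r x)%:E]) (m x)%:E.
  rewrite /weighted_measure [LHS]integral_mkcond [RHS]integral_mkcond.
  apply: ae_eq_integralT => [x|x|].
  - by rewrite patchE; case: ifP => // _; rewrite lee_fin mulr_ge0.
  - by rewrite patchE; case: ifP => // _; rewrite lee_fin ltW.
  apply: filterS h => x [uvE vx0 rE fE]; rewrite !patchE /=.
  have absE : `|f x / (v x `^ theta)%:E| = f' x * (r x)%:E.
    rewrite inver gt_eqF ?powR_gt0// -powRN rE fE gee0_abs//.
    by rewrite mule_ge0// lee_fin ltW.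
  rewrite (_ : (x \in _) = (x \in [set x | t%:E < f' x * (r x)%:E])) ?uvE//.
  by apply/idP/idP; rewrite !inE /= absE.
split=> [hD t t0|hD].
  rewrite -E; apply: le_trans hD; apply: ereal_sup_ubound.
  by exists t => //; rewrite invrK.
apply: ge_ereal_sup => _ [t t0 <-]; rewrite E invrK.
exact: hD.
Qed.

Theorem weak_estimate G theta u v : (0 < theta)%R -> A1 u -> weight v ->
  (exists2 delta : R, (0 < delta)%R & Ainfty (fun x => v x `^ delta)%R) ->
  borel_pairs G -> good G (2 * theta)^-1 ->
  exists2 C : R, (0 < C)%R & forall f g f' g', G (f', g') ->
    (\forall x \ae leb, f x = f' x) -> (\forall x \ae leb, g x = g' x) ->
    let N h := weakLnorm (weighted_measure (fun x => u x * v x)%R) theta^-1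
      (fun x => h x / (v x `^ theta)%:E) in
    N f < +oo -> N f <= C%:E * N g.
Proof.
move=> th0 A1u wv [delta d0 Av] bG gG.
have [[wu _ upos] _] := A1u; have [u0 _] := wu; have [v0 _] := wv.
have rv : regular_weight (fun x => v x `^ delta)%R by case: Av => [[]|[? _ []]].
have vpos : \forall x \ae leb, (0 < v x)%R.
  have [_ _ h] := rv; apply: filterS h => x.
  by rewrite [(0 < v x)%R]lt0r v0 andbT; apply: contraTneq => ->; rewrite powR0 ?ltxx// gt_eqF.
have [u' [mu' u'0 uu']] := borel_gt0 wu upos.
have [v' [mv' v'0 vv']] := borel_gt0 wv vpos.
have [C C1 hu'] := A1_borel A1u mu' u'0 uu'.
have [e [C' [e0 C'1 hU]]] := @reverse_hoelder R n C C1.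
have {}hU := hU _ hu'.
have [p [K [p1 hA]]] : exists p K : R, (1 < p)%R /\ Ap_weight p K (fun x => v' x `^ delta)%R.
  apply: Ainfty_borel Av _ _ _; first exact: measurable_fun_powR.
    by move=> x; exact: powR_gt0.
  by apply: filterS vv' => x ->.
have [V [V' [K' [d [dd0 hV vE]]]]] := Ap_weight_dual_weights p1 hA d0 v'0 (fun=> erefl).
(* With [U = u' ^ (1 + e)], an A_1 weight by the reverse Hoelder inequality, [u'] is the power
   [(1 + e)^-1 < 1] of [U]. *)
have tau01 : (0 < (1 + e)^-1 < 1)%R.
  by rewrite invr_gt0 addr_gt0//= invf_lt1 ?addr_gt0// ltrDl.
have [K1 K10 hK1] := weak_extrapolation th0 bG gG C'1 hU hV tau01 dd0.
exists K1 => // f g f' g' fg ff' gg' N Noo.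
have [_ _ f'0 g'0] := bG _ _ fg.
have V0 x : (0 < V x)%R by have [[]] := hV.
pose m x := ((u' x `^ (1 + e)) `^ (1 + e)^-1 * V x `^ d)%R.
pose r x := (V x `^ (- (d * theta)))%R.
have m0 x : (0 < m x)%R by rewrite mulr_gt0 ?powR_gt0.
have r0 x : (0 < r x)%R by exact: powR_gt0.
have base : \forall x \ae leb, [/\ (u x * v x = m x)%R, (0 < v x)%R &
    (v x `^ (- theta) = r x)%R].
  apply: filterS2 uu' vv' => x ux vx; rewrite ux vx; split => //.
    by rewrite /m -powRrM mulfV ?lt0r_neq0 ?addr_gt0// powRr1 ?ltW// -vE.
  by rewrite vE -powRrM mulrN.
have hN h h' D : (forall x, 0 <= h' x) -> (\forall x \ae leb, h x = h' x) ->
    N h <= D%:E <-> weak_bounded theta m r h' D.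
  move=> h'0 hh'; apply: weakLnorm_bounded => //.
  by apply: filterS2 base hh' => x [].
have mu0 S : 0 <= weighted_measure (fun x => u x * v x)%R S.
  by apply: integral_ge0 => x _; rewrite lee_fin mulr_ge0.
have N0 h : 0 <= N h by exact: weakLnorm_ge0.
have [D0 D00 D0E] : exists2 D0 : R, (0 < D0)%R & N f <= D0%:E.
  move: (N0 f) Noo; case: (N f) => // z z0 _; exists (z + 1)%R.
    by rewrite ltr_wpDl.
  by rewrite lee_fin lerDl.
apply: le_mul_real_bounds => // D DD0 gD.
apply/(hN f f') => //; apply: (hK1 f' g' fg D0 D) => //.
  exact/(hN f f').
exact/(hN g g').
Qed.

End borel_versions.

Theorem theorem1p5 (R : realType) (n : nat) (n_gt0 : (0 < n)%N)
    (F : set ((Rn R n -> \bar R) * (Rn R n -> \bar R)))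
    (F_meas : forall f g, F (f, g) ->
       [/\ forall x, 0 <= f x, forall x, 0 <= g x,
           lebesgue_measurable_fun f & lebesgue_measurable_fun g])
    (F_Ainfty : exists2 p0 : R, (0 < p0)%R & Ainfty_comparable F p0)
    (theta : R) (theta_ge1 : (1 <= theta)%R)
    (u v : Rn R n -> R) (u_A1 : A1 u) (v_weight : weight v)
    (v_Ainfty : exists2 delta : R, (0 < delta)%R &
       Ainfty (fun x => v x `^ delta)%R) :
  let mu := weighted_measure (fun x => u x * v x)%R in
  let over_v h := fun x : Rn R n => h x / (v x `^ theta)%:E in
  (exists2 C : R, (0 < C)%R &
     forall f g, F (f, g) ->
       weakLnorm mu theta^-1 (over_v f) < +oo ->
       weakLnorm mu theta^-1 (over_v f) <=
       C%:E * weakLnorm mu theta^-1 (over_v g)) /\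
  (forall q : R, (0 < q)%R ->
     exists2 C : R, (0 < C)%R &
       forall f g : nat -> Rn R n -> \bar R, (forall j, F (f j, g j)) ->
         weakLnorm mu theta^-1 (over_v (lq_sum q f)) < +oo ->
         weakLnorm mu theta^-1 (over_v (lq_sum q f)) <=
         C%:E * weakLnorm mu theta^-1 (over_v (lq_sum q g))).
Proof.
move=> mu over_v; have [p0 p00 hF] := F_Ainfty.
have th0 : (0 < theta)%R by exact: lt_le_trans theta_ge1.
have pth0 : (0 < (2 * theta)^-1)%R by rewrite invr_gt0 mulr_gt0.
have bG := @borel_version_borel R n F; have gG := good_Ainfty n_gt0 hF.
have version f g : F (f, g) -> exists fg', [/\ borel_version F fg',
    \forall x \ae lebesgue_Rn R n, f x = fg'.1 x &
    \forall x \ae lebesgue_Rn R n, g x = fg'.2 x].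
  move=> Ffg; have [f0 g0 mf mg] := F_meas _ _ Ffg.
  have [f' [mf' f'0 ff']] := borel_ge0 f0 mf.
  have [g' [mg' g'0 gg']] := borel_ge0 g0 mg.
  by exists (f', g'); split => //; split; [split|exists f, g].
split.
  have [C C0 hC] := weak_estimate th0 u_A1 v_weight v_Ainfty bG
    (good_all p00 pth0 bG gG).
  exists C => // f g /version[[f' g'] [/= G' ff' gg']].
  exact: hC G' ff' gg'.
move=> q q0; have bGq := @lq_pairs_borel R n q _ bG.
have gGq := good_lq q0 bG (good_all p00 q0 bG gG).
have [C C0 hC] := weak_estimate th0 u_A1 v_weight v_Ainfty bGq
  (good_all q0 pth0 bGq gGq).
exists C => // f g Ffg.
have /choice[fg' hfg'] j := version _ _ (Ffg j).
have lq_ae (h h' : nat -> Rn R n -> \bar R) :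
    (forall j, \forall x \ae lebesgue_Rn R n, h j x = h' j x) ->
    \forall x \ae lebesgue_Rn R n, lq_sum q h x = lq_sum q h' x.
  move=> /ae_foralln; apply: filterS => x hx; rewrite /lq_sum; congr (_ `^ _).
  by apply: eq_eseriesr => j _; rewrite hx.
apply: hC (lq_ae _ (fun j => (fg' j).1) _) (lq_ae _ (fun j => (fg' j).2) _).
- exists (fun j => (fg' j).1), (fun j => (fg' j).2); split => // j.
  by have [+ _ _] := hfg' j; rewrite -surjective_pairing.
- by move=> j; have [] := hfg' j.
- by move=> j; have [] := hfg' j.
Qed.
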